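(* Let $W\in\mathbb{C}^{Nd\times 2Nd}$ have full rank and let $A$ be the restriction of the operator $A_0$ to $$D(A)=\Big\{x\in D(A_0):\ W\begin{pmatrix} f_{\partial,\mathcal{H}x}\\ e_{\partial,\mathcal{H}x}\end{pmatrix}=0\Big\}.$$ Assume that for some $\kappa>0$ $$\operatorname{Re}\langle Ax,x\rangle_{\mathcal{H}}\le-\kappa\sum_{k=0}^{N-1}\big|(\mathcal{H}x)^{(k)}(0)\big|^2,\qquad x\in D(A).$$ Then $A$ generates a contractive $C_0$-semigroup $(T(t))_{t\ge0}$ on $(X,\langle\cdot,\cdot\rangle_{\mathcal{H}})$ and this semigroup is asymptotically stable, i.e. $T(t)x\to0$ as $t\to\infty$ for all $x\in X$.
   Context: Fix integers $N,d\ge 1$. Let $P_0,P_1,\dots,P_N\in\mathbb{C}^{d\times d}$ satisfy $P_k^*=(-1)^{k-1}P_k$ for $k=1,\dots,N$, with $P_N$ invertible; $P_0$ is arbitrary. Let $\mathcal{H}:(0,1)\to\mathbb{C}^{d\times d}$ be measurable and such that there are constants $0<m_0\le M_0$ with, for a.e. $\zeta\in(0,1)$, $\mathcal{H}(\zeta)$ self-adjoint and $m_0|\xi|^2\le \xi^*\mathcal{H}(\zeta)\xi\le M_0|\xi|^2$ for all $\xi\in\mathbb{C}^d$. Let $X=L_2(0,1;\mathbb{C}^d)$ with inner product $\langle f,g\rangle_{\mathcal{H}}=\int_0^1 f(\zeta)^*\mathcal{H}(\zeta)g(\zeta)\,d\zeta$ and the associated norm. Define $A_0:D(A_0)\subset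 X\to X$ by $A_0x=\sum_{k=0}^N P_k\frac{d^k}{d\zeta^k}(\mathcal{H}x)$, $D(A_0)=\{x\in X:\mathcal{H}x\in H^N(0,1;\mathbb{C}^d)\}$ (Sobolev space). For $y\in H^N(0,1;\mathbb{C}^d)$ put $\Phi(y)=(y(1),y'(1),\dots,y^{(N-1)}(1),y(0),y'(0),\dots,y^{(N-1)}(0))\in\mathbb{C}^{2Nd}$. The boundary port variables $f_{\partial,\mathcal{H}x},e_{\partial,\mathcal{H}x}\in\mathbb{C}^{Nd}$ of $x\in D(A_0)$ are defined by $$\begin{pmatrix} f_{\partial,\mathcal{H}x}\\ e_{\partial,\mathcal{H}x}\end{pmatrix}=\frac1{\sqrt2}\begin{pmatrix}Q&-Q\\ I&I\end{pmatrix}\Phi(\mathcal{H}x),$$ where $Q\in\mathbb{C}^{Nd\times Nd}$ is the block matrix with $d\times d$ blocks $Q_{ij}=(-1)^{i-1}P_{i+j-1}$ if $i+j\le N+1$ and $Q_{ij}=0$ otherwise ($1\le i,j\le N$). *)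

(* Defs.v *)
From HB Require Import structures.
From mathcomp Require Import all_boot all_order all_algebra.
From mathcomp Require Import generic_quotient ring_quotient complex ring.
From mathcomp Require Import all_classical all_reals all_analysis.
From mathcomp Require Import measurable_realfun.

Set Implicit Arguments.
Unset Strict Implicit.
Unset Printing Implicit Defensive.

Import Order.TTheory GRing.Theory Num.Theory.
Import numFieldNormedType.Exports.

Local Open Scope classical_set_scope.
Local Open Scope ring_scope.
Local Open Scope complex_scope.
Local Open Scope sesquilinear_scope.

(* Functions on (0,1) are represented by functions on R whose values outside
   (0,1) are irrelevant (outside [0,1] for continuous functions); complex matrices are
   measurable or continuous when the real and imaginary parts of all their
   entries are. *)
Definition unit_itv (R : realType) : set R := `]0, 1[.
Arguments unit_itv : clear implicits.

Definition entrywise (R : realType) m n (prop : (R -> R) -> Prop)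
    (f : R -> 'M[R[i]]_(m, n)) : Prop :=
  forall i j, prop (fun z => complex.Re (f z i j)) /\
              prop (fun z => complex.Im (f z i j)).

Definition ae01 (R : realType) (P : R -> Prop) : Prop :=
  {ae (@lebesgue_measure R), forall z, unit_itv R z -> P z}.

Definition int01 (R : realType) (f : R -> R[i]) : R[i] :=
  (\int[@lebesgue_measure R]_(z in unit_itv R) complex.Re (f z)) +i*
  (\int[@lebesgue_measure R]_(z in unit_itv R) complex.Im (f z)).

Definition sqnorm (R : realType) n (v : 'cV[R[i]]_n) : R :=
  complex.Re ((v ^t* *m v) 0 0).

Definition isL2 (R : realType) d (f : R -> 'cV[R[i]]_d) : Prop :=
  entrywise (measurable_fun (unit_itv R)) f /\
  (\int[@lebesgue_measure R]_(z in unit_itv R) (sqnorm (f z))%:E < +oo)%E.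

Section L2space.
Context (R : realType) (d : nat).
Local Notation mu := (@lebesgue_measure R).
Local Notation I := (unit_itv R).
Local Notation fT := (R -> 'cV[R[i]]_d).

Lemma sqnormE n (v : 'cV[R[i]]_n) :
  sqnorm v = \sum_i (complex.Re (v i 0) ^+ 2 + complex.Im (v i 0) ^+ 2).
Proof.
rewrite /sqnorm mxE raddf_sum /=; apply: eq_bigr => i _.
rewrite !mxE; case: (v i 0) => a b /=.
by rewrite mulNr opprK -!expr2.
Qed.

Lemma sqnorm_ge0 n (v : 'cV[R[i]]_n) : 0 <= sqnorm v.
Proof. by rewrite sqnormE sumr_ge0 // => i _; rewrite addr_ge0 ?sqr_ge0. Qed.

Lemma measurable_sqnorm (f : fT) : entrywise (measurable_fun I) f ->
  measurable_fun I (EFin \o (fun z => sqnorm (f z))).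
Proof.
move=> mf; apply/measurable_EFinP; have -> : (fun z => sqnorm (f z)) = (fun z =>
    \sum_(i < d) (complex.Re (f z i 0) ^+ 2 + complex.Im (f z i 0) ^+ 2)).
  by apply/funext => z; rewrite sqnormE.
apply: measurable_sum => i; have [m1 m2] := mf i 0.
by apply: measurable_funD; apply: measurable_funX.
Qed.

Lemma measurable_entrywise_lin (a : R[i]) (f g : fT) :
  entrywise (measurable_fun I) f -> entrywise (measurable_fun I) g ->
  entrywise (measurable_fun I) (a *: f + g).
Proof.
move=> mf mg i j; have [f1 f2] := mf i j; have [g1 g2] := mg i j; split.
  apply: (eq_measurable_fun (fun z => complex.Re a * complex.Re (f z i j)
    - complex.Im a * complex.Im (f z i j) + complex.Re (g z i j))).
    move=> z _; rewrite !fctE !mxE.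
    by case: a (f z i j) (g z i j) => ? ? [? ?] [? ?].
  apply: measurable_funD => //; apply: measurable_funB;
  exact: measurable_funM.
apply: (eq_measurable_fun (fun z => complex.Re a * complex.Im (f z i j)
    + complex.Im a * complex.Re (f z i j) + complex.Im (g z i j))).
  move=> z _; rewrite !fctE !mxE.
  by case: a (f z i j) (g z i j) => ? ? [? ?] [? ?].
apply: measurable_funD => //; apply: measurable_funD;
exact: measurable_funM.
Qed.

Lemma sqnorm_lin (a : R[i]) (u v : 'cV[R[i]]_d) : sqnorm (a *: u + v) <=
  (complex.Re a ^+ 2 + complex.Im a ^+ 2) *+ 2 * sqnorm u + 2 * sqnorm v.
Proof.
rewrite !sqnormE !mulr_sumr -big_split /=; apply: ler_sum => i _; rewrite !mxE.
case: a (u i 0) (v i 0) => a b [x y] [p q] /=; rewrite -subr_ge0.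
have := addr_ge0 (sqr_ge0 (a * x - b * y - p)) (sqr_ge0 (a * y + b * x - q)).
congr (0 <= _); ring.
Qed.

Definition L2pred : {pred fT} := fun f => `[< isL2 f >].

Lemma L2pred_submod : submod_closed L2pred.
Proof.
have mI : measurable I by exact: measurable_itv.
split=> [|a f g /asboolP[mf If] /asboolP[mg Ig]]; apply/asboolP; split.
- move=> i j; split; rewrite [X in measurable_fun _ X](_ : _ = cst 0) //;
    by apply/funext => z; rewrite /= mxE.
- have s0 z : sqnorm ((0 : fT) z) = 0.
    by rewrite sqnormE big1 // => i _; rewrite mxE /= expr0n addr0.
  by under eq_integral => z _ do rewrite s0; rewrite integral0 ltry.
- exact: measurable_entrywise_lin.
- set c := (complex.Re a ^+ 2 + complex.Im a ^+ 2) *+ 2.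
  have c0 : 0 <= c by rewrite mulrn_wge0 // addr_ge0 // sqr_ge0.
  have s0 (h : fT) z : (0 <= (sqnorm (h z))%:E)%E by rewrite lee_fin sqnorm_ge0.
  apply: (@le_lt_trans _ _ (\int[mu]_(z in I)
      (c%:E * (sqnorm (f z))%:E + 2%:E * (sqnorm (g z))%:E))%E).
    apply: ge0_le_integral.
    + exact: mI.
    + by move=> z _; exact: s0.
    + by apply: measurable_sqnorm; exact: measurable_entrywise_lin.
    + by apply: emeasurable_funD; apply: measurable_funeM;
        exact: measurable_sqnorm.
    + by move=> z _; rewrite -!EFinM -EFinD lee_fin; exact: sqnorm_lin.
  rewrite ge0_integralD //=.
  + rewrite !ge0_integralZl_EFin //; try exact: measurable_sqnorm.
    by apply: lte_add_pinfty; apply: lte_mul_pinfty.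
  + by move=> z _; rewrite mule_ge0.
  + by apply: measurable_funeM; exact: measurable_sqnorm.
  + by move=> z _; rewrite mule_ge0.
  + by apply: measurable_funeM; exact: measurable_sqnorm.
Qed.

HB.instance Definition _ :=
  GRing.isSubmodClosed.Build R[i] fT L2pred L2pred_submod.

Record L2fun := MkL2fun { L2val :> fT; _ : L2val \in L2pred }.
HB.instance Definition _ := [isSub for L2val].
HB.instance Definition _ := [Choice of L2fun by <:].
HB.instance Definition _ := [SubChoice_isSubLmodule of L2fun by <:].

Lemma ae01S2 (P Q S : R -> Prop) : (forall z, P z -> Q z -> S z) ->
  ae01 P -> ae01 Q -> ae01 S.
Proof.
move=> PQS; apply: (@filterS2 _ _ (ae_filter_ringOfSetsType mu)) => z /= p q Iz.
by apply: PQS; [exact: p | exact: q].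
Qed.

Definition L2null : {pred L2fun} := fun f => `[< ae01 (fun z => f z = 0) >].

Lemma L2null_zmod : zmod_closed L2null.
Proof.
split=> [|f g /asboolP f0 /asboolP g0]; apply/asboolP.
  by apply: aeW => z _.
apply: (ae01S2 _ f0 g0) => z fz gz.
by transitivity (f z - g z); rewrite // fz gz subr0.
Qed.
HB.instance Definition _ := GRing.isZmodClosed.Build L2fun L2null L2null_zmod.

Definition L2space := ring_quotient.Quotient.quot L2null.
HB.instance Definition _ := GRing.Zmodule.on L2space.

Local Open Scope quotient_scope.

Lemma L2nullZ (a : R[i]) (f : L2fun) : f \in L2null -> a *: f \in L2null.
Proof.
move=> /asboolP f0; apply/asboolP; apply: (ae01S2 _ f0 f0) => z fz _.
by transitivity (a *: f z); rewrite // fz scaler0.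
Qed.

Definition L2scale (a : R[i]) (x : L2space) : L2space :=
  \pi_L2space (a *: repr x).

Lemma pi_L2scale a (f : L2fun) :
  L2scale a (\pi_L2space f) = \pi_L2space (a *: f).
Proof.
apply/eqP; rewrite /L2scale -ring_quotient.Quotient.idealrBE -scalerBr L2nullZ //.
by rewrite ring_quotient.Quotient.idealrBE reprK.
Qed.

Fact L2scaleA a b (x : L2space) : L2scale a (L2scale b x) = L2scale (a * b) x.
Proof.
elim/quotW: x => f.
by rewrite (pi_L2scale b f) (pi_L2scale a) (pi_L2scale (a * b)) scalerA.
Qed.
Fact L2scale1 : left_id 1 L2scale.
Proof. by elim/quotW => f; rewrite pi_L2scale scale1r. Qed.
Fact L2scaleDr : right_distributive L2scale +%R.
Proof.
move=> a; elim/quotW => f; elim/quotW => g.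
have piD := @ring_quotient.Quotient.pi_add _ L2null.
rewrite -[LHS]/(L2scale a (ring_quotient.Quotient.add _ _)) -piD.
rewrite (pi_L2scale a (f + g)) (pi_L2scale a f) (pi_L2scale a g) scalerDr.
exact: piD.
Qed.
Fact L2scaleDl (x : L2space) : {morph L2scale^~ x : a b / a + b}.
Proof.
move=> a b; elim/quotW: x => f /=.
rewrite (pi_L2scale (a + b)) (pi_L2scale a) (pi_L2scale b) scalerDl.
exact: (@ring_quotient.Quotient.pi_add _ L2null).
Qed.
HB.instance Definition _ := GRing.Zmodule_isLmodule.Build R[i] L2space
  L2scaleA L2scale1 L2scaleDr L2scaleDl.

Definition L2repr (x : L2space) : fT := L2val (repr x).

(* The class of [f]; it is 0 when [f] is not square integrable. *)
Definition L2class (f : fT) : L2space := \pi_L2space (insubd (0 : L2fun) f).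
End L2space.

Section semigroups.
Context (R : realType) (V : lmodType R[i]) (nrm : V -> R).

Definition C0_semigroup (T : R -> V -> V) : Prop :=
  [/\ forall t, 0 <= t -> linear (T t) /\
        exists M : R, forall x, nrm (T t x) <= M * nrm x,
      forall x, T 0 x = x,
      forall s t x, 0 <= s -> 0 <= t -> T (s + t) x = T s (T t x) &
      forall x, nrm (T t x - x) @[t --> 0^'+] --> (0 : R)].

Definition contractive (T : R -> V -> V) : Prop :=
  forall t x, 0 <= t -> nrm (T t x) <= nrm x.

(* The operator [A] with domain [D] is exactly the infinitesimal generator
   of [T]: the two operators have the same graph. *)
Definition generates (D : set V) (A : V -> V) (T : R -> V -> V) : Prop :=
  forall x y, (D x /\ A x = y) <->
    nrm ((t^-1)%:C *: (T t x - x) - y) @[t --> 0^'+] --> (0 : R).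

Definition asymptotically_stable (T : R -> V -> V) : Prop :=
  forall x, nrm (T t x) @[t --> +oo] --> (0 : R).
End semigroups.

Section sobolev.
Context (R : realType) (d : nat).
Local Notation fT := (R -> 'cV[R[i]]_d).

(* In dimension one, C^1 test functions with compact support in (0,1) suffice
   to define weak derivatives (Brezis, Functional Analysis, Sobolev Spaces and
   Partial Differential Equations, Section 8.2). *)
Definition test_function (phi : R -> R) : Prop :=
  [/\ forall z, derivable phi z 1, continuous (derive1 phi) &
      exists a b, [/\ 0 < a, b < 1 & forall z, ~~ (a <= z <= b) -> phi z = 0]].

Definition is_weak_deriv (f g : fT) : Prop :=
  forall phi, test_function phi -> forall i,
    int01 (fun z => (derive1 phi z)%:C * f z i 0) =
    - int01 (fun z => (phi z)%:C * g z i 0).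

(* f \in H^n(0,1; C^d) *)
Fixpoint in_sobolev (n : nat) (f : fT) : Prop :=
  match n with
  | 0 => isL2 f
  | n'.+1 => in_sobolev n' f /\ exists g, is_weak_deriv f g /\ in_sobolev n' g
  end.

(* A version of the weak derivative in L2, when there is one; it is unique up
   to null sets. *)
Definition weak_deriv (f : fT) : fT :=
  xget (0 : fT) [set g | isL2 g /\ is_weak_deriv f g].

Definition weak_derivn (k : nat) (f : fT) : fT := iter k weak_deriv f.

(* The continuous representative of [f] on [0,1], when there is one, so that
   the boundary values of H^1 functions make sense. *)
Definition cont_rep (f : fT) : fT :=
  xget f [set g | entrywise (fun h => {within `[0, 1], continuous h}) g /\
                  ae01 (fun z => g z = f z)].

(* f^(k)(z) for z in [0,1] *)
Definition trace (k : nat) (f : fT) (z : R) : 'cV[R[i]]_d :=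
  cont_rep (weak_derivn k f) z.
End sobolev.

Section port_hamiltonian.
Context (R : realType) (N d : nat).
Context (P : nat -> 'M[R[i]]_d) (H : R -> 'M[R[i]]_d).
Local Notation X := (L2space R d).

Definition inner_H (f g : X) : R[i] :=
  int01 (fun z => ((L2repr f z) ^t* *m H z *m L2repr g z) 0 0).

Definition norm_H (f : X) : R := Num.sqrt (complex.Re (inner_H f f)).

Definition Hmul (x : X) : R -> 'cV[R[i]]_d := fun z => H z *m L2repr x z.

Definition dom_A0 : set X := [set x | in_sobolev N (Hmul x)].

Definition A0 (x : X) : X :=
  L2class (fun z => \sum_(k < N.+1) P k *m weak_derivn k (Hmul x) z).

(* With indices starting from 0, block (i, j) is (-1)^i P_{i+j+1}. The size
   N * d of block matrices is written \sum_(k < N) d, as in [\mxblock]. *)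
Definition Qmx : 'M[R[i]]_(\sum_(k < N) d) :=
  \mxblock_(i < N, j < N)
    (if (i + j < N)%N then (-1) ^+ i *: P (i + j).+1 else 0).

Definition Phi (y : R -> 'cV[R[i]]_d) :
    'cV[R[i]]_(\sum_(k < N) d + \sum_(k < N) d) :=
  col_mx (\mxcol_(k < N) trace k y 1) (\mxcol_(k < N) trace k y 0).

Definition port_variables (x : X) :
    'cV[R[i]]_(\sum_(k < N) d + \sum_(k < N) d) :=
  (sqrtC 2)^-1 *: (block_mx Qmx (- Qmx) 1%:M 1%:M *m Phi (Hmul x)).

Definition dom_A m (W : 'M[R[i]]_(m, \sum_(k < N) d + \sum_(k < N) d)) :
    set X :=
  [set x | dom_A0 x /\ W *m port_variables x = 0].
End port_hamiltonian.

(* Main.v *)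
Require Import Defs.
From HB Require Import structures.
From mathcomp Require Import all_boot all_order all_algebra.
From mathcomp Require Import complex ring lra.
From mathcomp Require Import all_classical all_reals all_analysis.
From mathcomp Require Import measurable_realfun.

(** Write y = H x. That x lies in the domain of A_0 means that
    y^(k) = b_k + int_0^. y^(k+1) for k < N, with y^(N) in L2 and b_k = y^(k)(0)
    ([sobolev_chain], [chain_sobolev]; the boundary values are those of
    [chain_trace]). Since P_N is invertible, A_0 x = f with prescribed initial
    values b_k is then a Volterra equation for y^(N). In L2 with the weight
    exp(-a z), the operator int_0^. has norm at most 1/sqrt a
    ([prim_weighted_le]). For large a the Volterra equation is therefore solved
    by iteration ([ivp_exists], [a_priori]), and the solution operator G for
    zero initial values has norm O(1/sqrt a). As a is arbitrary and all these
    norms are equivalent, |G^n| = O(e^n) for every e > 0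
    ([G_quasinilpotent]).

    Inversion of A. If x is in D(A) and A x = 0, the dissipation inequality
    makes all the b_k vanish, and x = 0 by uniqueness for the initial value
    problem. The solutions of A_0 x = 0 are parametrized by the N d numbers
    (b_k), and belonging to D(A) amounts to N d linear conditions; injectivity
    gives surjectivity, so A is a bijection from D(A) to X ([A_injective],
    [A_surjective]). Its inverse K is bounded and dissipative, and
    |K f - G f| is at most a constant times the norm of the traces of H K f
    at 0, because K f - G f solves the homogeneous equation with these traces
    ([K_sub_G_le]).

    Generation. For bounded, injective and dissipative K the operators
    J_h = K (K - h)^-1 = (1 - h A)^-1 are commuting contractions; the implicit
    Euler scheme with t/2^n as step converges on the range of K^2, which is
    dense, and the limit T(t) is a contraction semigroup generated by A
    ([T_C0], [T_generates]).

    Stability. Fix u and let b_m be the limit of |T(n) K^(m+1) u|, which is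
    nonincreasing in n. The energy lost between n and n+1 tends to 0, hence so
    do Re <T(n) K w, T(n) K^2 w> and the traces of H T(n) K^2 w
    ([dissipation_vanishes], [beta_vanishes]). Two consequences contradict each
    other unless the limits vanish. Polarization turns the first limit into
    asymptotic skew-symmetry of K along orbits, so that b is log-convex:
    b_(m+1)^2 <= b_m b_(m+2). The second limit says that K acts like G along
    orbits, so that b_m = O(e^m) for every e > 0. A nonnegative log-convex
    sequence that decays faster than every geometric sequence has b_1 = 0
    ([logconvex_superexp_decay]); therefore T(n) -> 0 strongly on the range of
    K^2, and on X by density and contractivity ([semigroup_stable]). *)

Set Implicit Arguments.
Unset Strict Implicit.
Unset Printing Implicit Defensive.

Import Order.TTheory GRing.Theory Num.Theory.
Import numFieldNormedType.Exports.

Local Open Scope classical_set_scope.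
Local Open Scope ring_scope.
Local Open Scope complex_scope.
Local Open Scope sesquilinear_scope.

#[local] Hint Extern 0 (measurable (unit_itv _)) => exact: measurable_itv : core.

(** * Hilbert space geometry *)

Section cvg0.
Context (R : realType).

Lemma cvg0_le {T} {F : set_system T} {FF : Filter F} (f g : T -> R) :
  (\forall x \near F, 0 <= f x <= g x) -> g @ F --> (0 : R) -> f @ F --> (0 : R).
Proof. by move=> fg g0; apply: (squeeze_cvgr fg) => //; exact: cvg_cst. Qed.

Lemma cvg0P (u : nat -> R) : (forall n, 0 <= u n) ->
  u @ \oo --> (0 : R) <-> (forall e, 0 < e -> exists n0, forall n, (n0 <= n)%N -> u n <= e).
Proof.
move=> u0; split=> [/cvgrPdist_le h e e0|h].
  have [n0 _ nh] := h _ e0; exists n0 => n /nh /=.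
  by rewrite sub0r normrN ger0_norm.
apply/cvgrPdist_le => e /h [n0 nh]; exists n0 => // n /nh /=.
by rewrite sub0r normrN ger0_norm.
Qed.

Lemma cvg0_mull {T} {F : set_system T} {FF : Filter F} (c : R) (f : T -> R) :
  f @ F --> (0 : R) -> c * f x @[x --> F] --> (0 : R).
Proof. by move=> h; rewrite -[0 in X in _ --> X](mulr0 c); apply: cvgM => //; exact: cvg_cst. Qed.

Lemma cvg0D {T} {F : set_system T} {FF : Filter F} (f g : T -> R) :
  f @ F --> (0 : R) -> g @ F --> (0 : R) -> f x + g x @[x --> F] --> (0 : R).
Proof. by move=> h h'; rewrite -[0 in X in _ --> X](addr0 0); apply: cvgD. Qed.

Lemma cvg_geo (c q : R) : 0 <= q < 1 -> c * q ^+ n @[n --> \oo] --> (0 : R).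
Proof.
move=> /andP[q0 q1]; apply: cvg0_mull.
by apply: cvg_expr; rewrite ger0_norm.
Qed.
End cvg0.

Section hilbert.
Context (R : realType) (V : lmodType R[i]).

Definition form_norm (r : V -> V -> R) (x : V) : R := Num.sqrt (r x x).

(** The real part of an inner product on a complex space. The complex structure
    enters only through [formZZ], which makes complex scalars act continuously;
    dissipativity and contractivity are statements about this real part. *)
Record hilbert_form (r : V -> V -> R) : Prop := HilbertForm {
  formDl : forall x y z, r (x + y) z = r x z + r y z;
  formC : forall x y, r x y = r y x;
  formZl : forall (a : R) x y, r (a%:C *: x) y = a * r x y;
  formZZ : forall a x, r (a *: x) (a *: x) =
    (complex.Re a ^+ 2 + complex.Im a ^+ 2) * r x x;
  form_ge0 : forall x, 0 <= r x x;
  form_eq0 : forall x, r x x = 0 -> x = 0;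
  form_complete : forall u : nat -> V,
    (forall e, 0 < e -> exists n0, forall m n, (n0 <= m)%N -> (n0 <= n)%N ->
      form_norm r (u m - u n) <= e) ->
    exists l, form_norm r (u n - l) @[n --> \oo] --> (0 : R) }.

Context (r : V -> V -> R) (hr : hilbert_form r).
Local Notation nrm := (form_norm r).

Lemma formDr x y z : r x (y + z) = r x y + r x z.
Proof. by rewrite formC // formDl // !(formC hr x). Qed.
Lemma formZr (a : R) x y : r x (a%:C *: y) = a * r x y.
Proof. by rewrite formC // formZl // (formC hr x). Qed.
Lemma formNl x y : r (- x) y = - r x y.
Proof.
have -> : - x = (-1 : R)%:C *: x by rewrite rmorphN1 scaleN1r.
by rewrite formZl // mulN1r.
Qed.
Lemma formNr x y : r x (- y) = - r x y.
Proof. by rewrite formC // formNl (formC hr x). Qed.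
Lemma form0l y : r 0 y = 0.
Proof. by rewrite -(scale0r (0 : V)) formZl // mul0r. Qed.
Lemma form0r y : r y 0 = 0.
Proof. by rewrite formC // form0l. Qed.
Definition formE := (formDl hr, formDr, formNl, formNr, formZl hr, formZr).

Lemma nrm_ge0 x : 0 <= nrm x. Proof. exact: sqrtr_ge0. Qed.
Lemma nrm_sqr x : nrm x ^+ 2 = r x x.
Proof. by rewrite sqr_sqrtr // form_ge0. Qed.
Lemma nrm0 : nrm 0 = 0. Proof. by rewrite /form_norm form0l sqrtr0. Qed.
Lemma nrm_eq0 x : nrm x = 0 -> x = 0.
Proof. by move=> h; apply: (form_eq0 hr); rewrite -nrm_sqr h expr0n. Qed.
Lemma nrmN x : nrm (- x) = nrm x.
Proof. by rewrite /form_norm !formE opprK. Qed.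
Lemma nrm_distC x y : nrm (x - y) = nrm (y - x).
Proof. by rewrite -nrmN opprB. Qed.
Lemma nrmZ (a : R) x : nrm (a%:C *: x) = `|a| * nrm x.
Proof.
by rewrite /form_norm !formE mulrA -expr2 sqrtrM ?sqr_ge0 // sqrtr_sqr.
Qed.
Lemma nrmZ_ge0 (a : R) x : 0 <= a -> nrm (a%:C *: x) = a * nrm x.
Proof. by move=> a0; rewrite nrmZ ger0_norm. Qed.
Lemma nrmZC (a : R[i]) x :
  nrm (a *: x) = Num.sqrt (complex.Re a ^+ 2 + complex.Im a ^+ 2) * nrm x.
Proof. by rewrite /form_norm formZZ // sqrtrM // addr_ge0 ?sqr_ge0. Qed.

Lemma nrm_le x c : 0 <= c -> r x x <= c ^+ 2 -> nrm x <= c.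
Proof. by move=> c0 h; rewrite -(ger0_norm c0) -sqrtr_sqr ler_wsqrtr. Qed.

Lemma form_le x y : r x y <= nrm x * nrm y.
Proof.
have [y0|yn0] := eqVneq (nrm y) 0.
  by rewrite (nrm_eq0 y0) form0r nrm0 mulr0.
have yp : 0 < nrm y by rewrite lt_neqAle eq_sym yn0 nrm_ge0.
have [x0|xn0] := eqVneq (nrm x) 0.
  by rewrite (nrm_eq0 x0) form0l nrm0 mul0r.
have xp : 0 < nrm x by rewrite lt_neqAle eq_sym xn0 nrm_ge0.
have := form_ge0 hr ((nrm y)%:C *: x - (nrm x)%:C *: y).
rewrite !formE -!nrm_sqr (formC hr y x) => h.
rewrite -(ler_pM2l (mulr_gt0 xp yp)).
by move: h; set a := nrm x; set b := nrm y; nra.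
Qed.
Lemma form_ge x y : - (nrm x * nrm y) <= r x y.
Proof. by rewrite lerNl -formNl (le_trans (form_le _ _)) // nrmN. Qed.

Lemma nrm_triangle x y : nrm (x + y) <= nrm x + nrm y.
Proof.
apply: nrm_le; first by rewrite addr_ge0 ?nrm_ge0.
rewrite !formE (formC hr y x) -!nrm_sqr sqrrD.
by have := form_le x y; lra.
Qed.
Lemma nrm_triangleB x y : nrm (x - y) <= nrm x + nrm y.
Proof. by rewrite -(nrmN y) nrm_triangle. Qed.
Lemma nrm_dist_triangle z x y : nrm (x - y) <= nrm (x - z) + nrm (z - y).
Proof. by apply: le_trans (nrm_triangle _ _); rewrite addrA subrK. Qed.
Lemma nrm_le_dist x y : nrm x <= nrm y + nrm (x - y).
Proof. by have := nrm_triangle y (x - y); rewrite addrC subrK. Qed.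
Lemma nrm_dist_abs x y : `|nrm x - nrm y| <= nrm (x - y).
Proof.
rewrite ler_norml; have := nrm_le_dist x y; have := nrm_le_dist y x.
by rewrite (nrm_distC y); lra.
Qed.

Definition tends (u : nat -> V) l := nrm (u n - l) @[n --> \oo] --> (0 : R).

Lemma tendsP u l : tends u l <-> forall e, 0 < e -> exists n0, forall n,
  (n0 <= n)%N -> nrm (u n - l) <= e.
Proof. by apply: cvg0P => n; exact: nrm_ge0. Qed.

Lemma tends_le (u : nat -> V) l (g : nat -> R) :
  (forall n, nrm (u n - l) <= g n) -> g @ \oo --> (0 : R) -> tends u l.
Proof. by move=> ug; apply: cvg0_le; near=> n; rewrite nrm_ge0 ug.
Unshelve. all: by end_near. Qed.

Lemma tends_unique u l l' : tends u l -> tends u l' -> l = l'.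
Proof.
move=> h h'; apply/eqP; rewrite -subr_eq0; apply/eqP/nrm_eq0.
have h2 : (nrm (u n - l) + nrm (u n - l')) @[n --> \oo] --> (0 : R).
  exact: cvg0D.
have : (fun _ : nat => nrm (l - l')) @ \oo --> (0 : R).
  apply: cvg0_le h2; near=> n.
  by rewrite nrm_ge0 (nrm_distC (u n) l) nrm_dist_triangle.
by move/(cvg_lim (@Rhausdorff R)); rewrite lim_cst.
Unshelve. all: by end_near. Qed.

Lemma tendsD u v l l' : tends u l -> tends v l' ->
  tends (fun n => u n + v n) (l + l').
Proof.
move=> h h'; apply: (@tends_le _ _ (fun n => nrm (u n - l) + nrm (v n - l'))).
  by move=> n; rewrite opprD addrACA nrm_triangle.
exact: cvg0D.
Qed.

Lemma tends_bounded (S : V -> V) c u l : (forall x y, S (x - y) = S x - S y) ->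
  (forall x, nrm (S x) <= c * nrm x) -> tends u l ->
  tends (fun n => S (u n)) (S l).
Proof.
move=> SB Sc ul; apply: (@tends_le _ _ (fun n => c * nrm (u n - l))).
  by move=> n; rewrite -SB.
exact: cvg0_mull.
Qed.

Lemma tendsZ a u l : tends u l -> tends (fun n => a *: u n) (a *: l).
Proof.
move=> h; apply: (tends_bounded _ _ h (S := fun x => a *: x)).
  by move=> x y; rewrite scalerBr.
by move=> x; rewrite nrmZC.
Qed.

Lemma tends_cst l : tends (fun _ => l) l.
Proof.
by apply: (@tends_le _ _ (fun _ => 0)); [move=> n; rewrite subrr nrm0|exact: cvg_cst].
Qed.

Lemma tends_nrm u l : tends u l -> nrm (u n) @[n --> \oo] --> nrm l.
Proof.
move=> h; apply/cvgrPdist_le => e e0; have [n0 hn] := (tendsP u l).1 h _ e0.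
exists n0 => // n /hn /=; apply: le_trans; rewrite distrC; exact: nrm_dist_abs.
Qed.

Lemma tends_nrm_le u l c : tends u l -> (forall n, nrm (u n) <= c) -> nrm l <= c.
Proof.
move=> /tends_nrm h uc; rewrite -(cvg_lim (@Rhausdorff R) h).
by apply: limr_le; [apply/cvg_ex; exists (nrm l)|near=> n].
Unshelve. all: by end_near. Qed.

(** Rate of the Picard iteration and of the dyadic Euler scheme: both converge
    because their increments are dominated by a geometric sequence. *)
Lemma geometric_cauchy (u : nat -> V) (c q : R) : 0 <= q < 1 ->
  (forall n, nrm (u n.+1 - u n) <= c * q ^+ n) -> exists l, tends u l.
Proof.
move=> /andP[q0 q1] hu; apply: (form_complete hr).
have c0 : 0 <= c by have := le_trans (nrm_ge0 _) (hu 0); rewrite expr0 mulr1.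
have H n k : nrm (u (n + k)%N - u n) <= c / (1 - q) * q ^+ n.
  have q1' : 0 < 1 - q by lra.
  suff : nrm (u (n + k)%N - u n) <= c / (1 - q) * (q ^+ n - q ^+ (n + k)).
    move=> /le_trans; apply; apply: ler_wpM2l; last first.
      by rewrite gerBl exprn_ge0.
    by rewrite divr_ge0 // ltW.
  elim: k => [|k IH]; first by rewrite addn0 !subrr mulr0 nrm0.
  rewrite addnS; apply: (le_trans (nrm_dist_triangle (u (n + k)%N) _ _)).
  apply: (le_trans (lerD (hu _) IH)).
  rewrite exprS le_eqVlt; apply/orP; left; apply/eqP.
  by field; rewrite lt0r_neq0.
have := @cvg_geo R (c / (1 - q)) q; rewrite q0 q1 => /(_ isT).
have g0 n : 0 <= c / (1 - q) * q ^+ n.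
  by rewrite mulr_ge0 ?divr_ge0 ?exprn_ge0 //; lra.
move/(cvg0P g0) => hg e e0; have [n0 hn] := hg (e / 2) ltac:(lra).
exists n0 => m n hm hn'.
rewrite -(subnKC hm) -(subnKC hn').
apply: (le_trans (nrm_dist_triangle (u n0) _ _)).
rewrite (nrm_distC (u n0)).
apply: (le_trans (lerD (H _ _) (H _ _))).
by have := hn n0 (leqnn _); lra.
Qed.

Lemma contraction_fixpoint (S : V -> V) (q : R) (f : V) : q < 1 ->
  (forall x y, S (x - y) = S x - S y) ->
  (forall x, nrm (S x) <= q * nrm x) -> exists x, x = f + S x.
Proof.
move=> q1 SB Sq.
pose q' := Num.max q 0.
have q'01 : 0 <= q' < 1 by rewrite /q' le_max lexx orbT /= gt_max q1 ltr01.
have Sq' x : nrm (S x) <= q' * nrm x.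
  by apply: (le_trans (Sq x)); rewrite ler_wpM2r ?nrm_ge0 // le_max lexx.
pose u n := iter n (fun x => f + S x) 0.
have hu n : nrm (u n.+1 - u n) <= nrm (u 1%N - u 0%N) * q' ^+ n.
  elim: n => [|n IH]; first by rewrite expr0 mulr1.
  rewrite {1}/u !iterS -/(u n) -/(u n.+1) opprD addrACA subrr add0r -SB.
  apply: (le_trans (Sq' _)); rewrite exprS mulrCA ler_wpM2l //.
  by case/andP: q'01.
have [l ul] := geometric_cauchy q'01 hu.
exists l; apply: (tends_unique (u := fun n => u n.+1)).
  move/tendsP: ul => h; apply/tendsP => e /h [n0 hn]; exists n0 => n n0n.
  by apply: hn; rewrite (leq_trans n0n).
rewrite /u /=; apply: tendsD; first exact: tends_cst.
exact: tends_bounded ul.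
Qed.

(** The real Lax-Milgram lemma: for rho = m / (c^2 + m^2) the map
    x |-> x - rho (B x - f) is a contraction, since
    |x - rho B x|^2 <= (1 - 2 rho m + rho^2 (c^2 + m^2)) |x|^2. *)
Lemma coercive_surjective (B : V -> V) (m c : R) : 0 < m ->
  (forall x y, B (x - y) = B x - B y) ->
  (forall x, nrm (B x) <= c * nrm x) ->
  (forall x, m * nrm x ^+ 2 <= r (B x) x) -> forall f, exists x, B x = f.
Proof.
move=> m0 BB Bc Bm f.
pose k := c ^+ 2 + m ^+ 2.
have k0 : 0 < k by rewrite /k ltr_wpDl ?sqr_ge0 // exprn_gt0.
pose rho := m / k.
have rho0 : 0 < rho by rewrite divr_gt0.
pose q := Num.sqrt (1 - m ^+ 2 / k).
have hk : 0 <= 1 - m ^+ 2 / k.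
  by rewrite subr_ge0 ler_pdivrMr // mul1r /k lerDr sqr_ge0.
have [] := @contraction_fixpoint (fun x => x - rho%:C *: B x) q (rho%:C *: f).
- rewrite /q -[ltRHS]sqrtr1 ltr_sqrt // gtrBl divr_gt0 // exprn_gt0 //.
- by move=> x y; rewrite BB scalerBr !opprD !opprK addrACA.
- move=> x; apply: nrm_le; first by rewrite mulr_ge0 ?sqrtr_ge0 ?nrm_ge0.
  rewrite exprMn sqr_sqrtr //.
  rewrite !formE (formC hr x) -!nrm_sqr.
  have h1 : nrm (B x) ^+ 2 <= c ^+ 2 * nrm x ^+ 2.
    by rewrite -exprMn ler_sqr ?nnegrE ?nrm_ge0 // (le_trans (nrm_ge0 _) (Bc x)).
  have h2 := Bm x.
  have -> : 1 - m ^+ 2 / k = 1 - 2 * rho * m + rho ^+ 2 * k.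
    by rewrite /rho; field; rewrite lt0r_neq0.
  have : rho * (m * nrm x ^+ 2) <= rho * r (B x) x by rewrite ler_wpM2l // ltW.
  have : rho ^+ 2 * nrm (B x) ^+ 2 <= rho ^+ 2 * (c ^+ 2 * nrm x ^+ 2).
    by rewrite ler_wpM2l // sqr_ge0.
  have : 0 <= rho ^+ 2 * (m ^+ 2 * nrm x ^+ 2) by rewrite -!exprMn sqr_ge0.
  rewrite /k; nra.
- move=> x hx; exists x.
  have : rho%:C *: (B x - f) = 0.
    rewrite scalerBr; apply/eqP; rewrite subr_eq0; apply/eqP.
    apply: (addIr (x - rho%:C *: B x)); rewrite -hx addrC subrK //.
  move/eqP; rewrite scaler_eq0 => /orP[|].
    by rewrite eq_complex /= gt_eqF.
  by rewrite subr_eq0 => /eqP.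
Qed.
End hilbert.

(** * Contraction semigroup generated by the inverse of a dissipative operator *)

Section contractions.
Context (R : realType) (V : lmodType R[i]).
Context (r : V -> V -> R) (hr : hilbert_form r).
Local Notation nrm := (form_norm r).

Definition contraction (a : V -> V) : Prop :=
  (forall x y, a (x - y) = a x - a y) /\ (forall x, nrm (a x) <= nrm x).

Lemma contraction_id : contraction id. Proof. by []. Qed.
Lemma contraction_comp a b : contraction a -> contraction b -> contraction (a \o b).
Proof.
move=> [aB ac] [bB bc]; split=> [x y|x] /=; first by rewrite bB aB.
by apply: (le_trans (ac _)).
Qed.
Lemma contraction_iter a m : contraction a -> contraction (iter m a).
Proof.
move=> ha; elim: m => [|m IH]; first exact: contraction_id.
exact: (contraction_comp ha IH).
Qed.
Lemma contraction0 a : contraction a -> a 0 = 0.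
Proof. by move=> [aB _]; rewrite -[in LHS](subrr (0 : V)) aB subrr. Qed.
Lemma contractionN a x : contraction a -> a (- x) = - a x.
Proof. by move=> ha; rewrite -sub0r ha.1 (contraction0 ha) sub0r. Qed.
Lemma contractionD a x y : contraction a -> a (x + y) = a x + a y.
Proof. by move=> ha; rewrite -{1}(opprK y) ha.1 (contractionN _ ha) opprK. Qed.

Lemma iter_comm (T : Type) (a b : T -> T) m x : (forall y, a (b y) = b (a y)) ->
  a (iter m b x) = iter m b (a x).
Proof. by move=> ab; elim: m => //= m IH; rewrite ab IH. Qed.

Lemma iter_comp (T : Type) (a b : T -> T) m x : (forall y, a (b y) = b (a y)) ->
  iter m (a \o b) x = iter m a (iter m b x).
Proof.
move=> ab; elim: m => //= m ->; congr a.
by rewrite -(@iter_comm _ b a m (iter m b x)).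
Qed.

(** Telescoping: replacing the factors of [iter m a] by [b] one at a time costs
    |a x - b x| each time, because everything commutes and contracts. *)
Lemma iter_diff a b m x : contraction a -> contraction b ->
  (forall y, a (b y) = b (a y)) ->
  nrm (iter m a x - iter m b x) <= m%:R * nrm (a x - b x).
Proof.
move=> ha hb ab; elim: m => [|m IH] /=; first by rewrite subrr mul0r nrm0.
apply: (le_trans (nrm_dist_triangle hr (a (iter m b x)) _ _)).
rewrite -ha.1 mulrSr mulrDl mul1r; apply: lerD.
  exact: (le_trans (ha.2 _)).
rewrite (iter_comm m x ab) -iterS iterSr -(contraction_iter m hb).1.
exact: (contraction_iter m hb).2.
Qed.

Lemma contraction_dist a x y : contraction a -> nrm (a x - a y) <= nrm (x - y).
Proof. by move=> ha; rewrite -ha.1 ha.2. Qed.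

Lemma contraction_eq_dense (D : set V) a b : contraction a -> contraction b ->
  (forall x e, 0 < e -> exists2 y, D y & nrm (x - y) <= e) ->
  (forall y, D y -> a y = b y) -> forall x, a x = b x.
Proof.
move=> ha hb hD hab x; apply/eqP; rewrite -subr_eq0; apply/eqP/(nrm_eq0 hr).
apply/eqP; rewrite eq_le nrm_ge0 andbT; apply/ler_addgt0Pr => e e0; rewrite add0r.
have [y Dy xy] := hD x (e / 2) ltac:(lra).
apply: (le_trans (nrm_dist_triangle hr (a y) _ _)).
have := contraction_dist x y ha; have := contraction_dist y x hb.
rewrite (nrm_distC hr y) -hab //; lra.
Qed.

Lemma contraction_cvg_dense (D : set V) (S : nat -> V -> V) :
  (forall n, contraction (S n)) ->
  (forall x e, 0 < e -> exists2 y, D y & nrm (x - y) <= e) ->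
  (forall y, D y -> exists l, tends r (S^~ y) l) ->
  forall x, exists l, tends r (S^~ x) l.
Proof.
move=> hS hD hl x; apply: (form_complete hr) => e e0.
have [y Dy xy] := hD x (e / 4) ltac:(lra).
have [l /tendsP yl] := hl y Dy.
have [n0 hn] := yl (e / 4) ltac:(lra).
exists n0 => m n hm hn'.
apply: (le_trans (nrm_dist_triangle hr (S m y) _ _)).
have h1 := contraction_dist x y (hS m).
have h2 := nrm_dist_triangle hr l (S m y) (S n x).
have h3 := nrm_dist_triangle hr (S n y) l (S n x).
have h4 := contraction_dist y x (hS n).
have := hn _ hm; have := hn _ hn'; rewrite !(nrm_distC hr _ l) => h5 h6.
move: h4 h2 xy; rewrite (nrm_distC hr y) (nrm_distC hr _ l); lra.
Qed.
End contractions.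

Section generation.
Context (R : realType) (V : lmodType R[i]).
Context (r : V -> V -> R) (hr : hilbert_form r).
Local Notation nrm := (form_norm r).
(** [K] plays the role of the inverse of the generator A, so that the whole
    construction uses bounded operators only. *)
Context (K : {linear V -> V}) (c : R).
Hypothesis Kc : forall x, nrm (K x) <= c * nrm x.
Hypothesis Kdiss : forall x, r (K x) x <= 0.
Hypothesis Kinj : forall x, K x = 0 -> x = 0.

Let Kc' x : nrm (K x) <= `|c| * nrm x.
Proof. by apply: (le_trans (Kc x)); rewrite ler_wpM2r ?nrm_ge0 ?ler_norm. Qed.

Let D (h : R) (g : V) : V := K g - h%:C *: g.

Let DB h x y : D h (x - y) = D h x - D h y.
Proof.
by rewrite /D linearB scalerBr !opprD !opprK addrACA.
Qed.
Let DZ h a x : D h (a *: x) = a *: D h x.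
Proof.
by rewrite /D linearZ /= scalerBr !scalerA mulrC.
Qed.

Let D_le h g : h * nrm g <= nrm (D h g).
Proof.
have [->|gn0] := eqVneq (nrm g) 0; first by rewrite mulr0 nrm_ge0.
have g0 : 0 < nrm g by rewrite lt_neqAle eq_sym gn0 nrm_ge0.
rewrite -(ler_pM2r g0) -mulrA -expr2 nrm_sqr //.
have := form_ge hr (D h g) g.
rewrite {2}/D !(formE hr); have := Kdiss g; lra.
Qed.

Let D_inj h x y : 0 < h -> D h x = D h y -> x = y.
Proof.
move=> h0 e; apply/eqP; rewrite -subr_eq0; apply/eqP/(nrm_eq0 hr)/eqP.
rewrite eq_le nrm_ge0 andbT -(ler_pM2l h0) mulr0.
by apply: (le_trans (D_le _ _)); rewrite DB e subrr nrm0.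
Qed.

(** Lax-Milgram for h - K, which is coercive by dissipativity. *)
Lemma D_surj h f : 0 < h -> exists g, D h g = f.
Proof.
move=> h0.
have [|||g hg] := @coercive_surjective R V r hr (fun g => - D h g) h (`|c| + h) h0 _ _ _ (- f).
- by move=> x y; rewrite DB opprD.
- move=> x; rewrite (nrmN hr) /D; apply: (le_trans (nrm_triangleB hr _ _)).
  by rewrite (nrmZ_ge0 hr _ (ltW h0)) mulrDl lerD.
- move=> x; rewrite nrm_sqr // /D !(formE hr); have := Kdiss x; lra.
by exists g; apply: oppr_inj.
Qed.

(** K (K - h)^-1, that is (1 - h A)^-1 for A the inverse of K. *)
Definition resolvent (h : R) (f : V) : V :=
  if 0 < h then K (xget 0 [set g | D h g = f]) else f.
Local Notation J := resolvent.

Lemma JD h g : 0 <= h -> J h (D h g) = K g.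
Proof.
rewrite /J le_eqVlt => /orP[/eqP<-|h0].
  by rewrite ltxx /D scale0r subr0.
rewrite h0; case: xgetP => [y _ /= /(D_inj h0) -> //|/(_ g) /=].
by move=> /(_ erefl).
Qed.

Lemma J0 f : J 0 f = f. Proof. by rewrite /J ltxx. Qed.

Lemma JB h x y : 0 <= h -> J h (x - y) = J h x - J h y.
Proof.
rewrite le_eqVlt => /orP[/eqP<-|h0]; first by rewrite !J0.
have [f <-] := D_surj x h0; have [g <-] := D_surj y h0.
by rewrite -DB !(JD _ (ltW h0)) linearB.
Qed.
Lemma JZ h a x : 0 <= h -> J h (a *: x) = a *: J h x.
Proof.
rewrite le_eqVlt => /orP[/eqP<-|h0]; first by rewrite !J0.
have [f <-] := D_surj x h0.
by rewrite -DZ !(JD _ (ltW h0)) linearZ.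
Qed.
Lemma Jc h x : 0 <= h -> nrm (J h x) <= nrm x.
Proof.
rewrite le_eqVlt => /orP[/eqP<-|h0]; first by rewrite !J0.
have [g <-] := D_surj x h0; rewrite (JD _ (ltW h0)).
have [->|gn0] := eqVneq (nrm (K g)) 0; first exact: nrm_ge0.
have g0 : 0 < nrm (K g) by rewrite lt_neqAle eq_sym gn0 nrm_ge0.
rewrite -(ler_pM2r g0) -expr2 nrm_sqr //.
have := form_le hr (D h g) (K g).
rewrite {1}/D !(formE hr) (formC hr g); have := Kdiss g.
by move=> /(ler_wpM2l (ltW h0)); lra.
Qed.
Lemma J_contraction h : 0 <= h -> contraction r (J h).
Proof. by move=> h0; split => [x y|x]; [exact: JB|exact: Jc]. Qed.

Lemma JK h x : 0 <= h -> J h (K x) = K (J h x).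
Proof.
rewrite le_eqVlt => /orP[/eqP<-|h0]; first by rewrite !J0.
have [g <-] := D_surj x h0; rewrite (JD _ (ltW h0)).
rewrite (_ : K (D h g) = D h (K g)); last by rewrite /D linearB linearZ.
by rewrite (JD _ (ltW h0)).
Qed.

Lemma JDcomm h k g : 0 <= k -> J k (D h g) = D h (J k g).
Proof. by move=> k0; rewrite /D JB // JZ // JK. Qed.

Lemma J_comm h k x : 0 <= h -> 0 <= k -> J h (J k x) = J k (J h x).
Proof.
rewrite le_eqVlt => /orP[/eqP<-|h0] k0; first by rewrite !J0.
have [g <-] := D_surj x h0.
by rewrite JDcomm // !(JD _ (ltW h0)) JK.
Qed.

(** On D(A^2) = range of K^2 this is the identity
    (1 - h A)(1 - k A) = 1 - (h + k) A + h k A^2 divided by its factors: one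
    Euler step of length h + k agrees with two steps up to second order. *)
Lemma J_add h k w : 0 <= h -> 0 <= k ->
  J (h + k) (K (K w)) - J h (J k (K (K w))) =
  (h * k)%:C *: J (h + k) (J h (J k w)).
Proof.
move=> h0 k0; have hk0 : 0 <= h + k by rewrite addr_ge0.
have e1 : K (K w) = J h (J k (D k (D h w))).
  by rewrite JD // JK // JD.
have e2 : K (K w) = J (h + k) (D (h + k) (K w)) by rewrite JD.
rewrite {1}e1 {1}e2 (J_comm (D (h + k) (K w)) k0 hk0) (J_comm (J k _) h0 hk0).
rewrite -!JB // -!JZ //; congr (J _ (J _ (J _ _))).
rewrite /D (linearB K) (linearZ_LR K) /= scalerBr scalerA -rmorphM /= (mulrC k h).
have e (A a b z : V) : A - a - (b - z) - (A - (a + b)) = z.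
  rewrite (_ : A - a - (b - z) = A - (a + b) + z); first by rewrite addrAC subrr add0r.
  by rewrite opprB [- (a + b)]opprD !addrA addrAC.
by rewrite (rmorphD (real_complex R)) scalerDl e.
Qed.

Lemma J_add_le h k w : 0 <= h -> 0 <= k ->
  nrm (J (h + k) (K (K w)) - J h (J k (K (K w)))) <= h * k * nrm w.
Proof.
move=> h0 k0; have hk0 : 0 <= h + k by rewrite addr_ge0.
rewrite J_add // nrmZ_ge0 ?mulr_ge0 // ler_wpM2l ?mulr_ge0 //.
by rewrite !(le_trans (Jc _ _)).
Qed.

Lemma JK_sub h g : 0 <= h -> J h (K g) - K g = h%:C *: J h g.
Proof.
move=> h0; apply/eqP; rewrite subr_eq addrC -subr_eq -JZ // -JB //.
by apply/eqP; rewrite -/(D h g) JD.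
Qed.
Lemma JK_sub_le h g : 0 <= h -> nrm (J h (K g) - K g) <= h * nrm g.
Proof. by move=> h0; rewrite JK_sub // nrmZ_ge0 // ler_wpM2l // Jc. Qed.

(** Solve K g_n - h_n g_n = x with h_n -> 0. Dissipativity applied to g_m - g_n
    shows that u_n = h_n g_n has nonincreasing norm and is Cauchy; its limit is
    killed by K since K u_n = h_n (J_(h_n) x) -> 0, so it is 0 by injectivity,
    and K g_n = x + u_n -> x. *)
Lemma range_dense x e : 0 < e -> exists g, nrm (x - K g) <= e.
Proof.
move=> e0.
pose h (n : nat) : R := n.+1%:R^-1.
have h0 n : 0 < h n by rewrite invr_gt0.
have /choice [g hg] : forall n, exists g, D (h n) g = x by move=> n; exact: D_surj.
have [u uD] : exists u : nat -> V, forall n, u n = (h n)%:C *: g n by eexists.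
have uE n : u n = K (g n) - x by rewrite uD -(hg n) /D opprB addrC subrK.
have gE n : g n = n.+1%:R%:C *: u n.
  by rewrite uD scalerA -rmorphM /= divff ?pnatr_eq0 // scale1r.
have key m n : (m <= n)%N -> nrm (u m - u n) ^+ 2 <= nrm (u m) ^+ 2 - nrm (u n) ^+ 2.
  move=> mn.
  have := Kdiss (g m - g n).
  rewrite linearB /= (_ : K (g m) - K (g n) = u m - u n); last first.
    by rewrite !uE opprB addrA subrK.
  rewrite !gE !nrm_sqr // !(formE hr) (formC hr (u n) (u m)).
  have : (m.+1%:R : R) <= n.+1%:R by rewrite ler_nat.
  have : (0 : R) < m.+1%:R by rewrite ltr0n.
  have := form_ge0 hr (u m - u n).
  rewrite !(formE hr) (formC hr (u n) (u m)).
  set a := m.+1%:R; set b := n.+1%:R; set p := r (u m) (u m).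
  set q := r (u n) (u n); set s := r (u m) (u n) => hd a0 ab h1.
  (* |u_m - u_n|^2 = p - 2 s + q, and [hd] says a p - (a + b) s + b q <= 0, with the
     weights a = 1 / h_m <= b = 1 / h_n *)
  have h2 : (a + b) * (p - s - (s - q)) <= (b - a) * (p - q) by nra.
  have h3 : 0 <= (b - a) * (p - q) by apply: le_trans h2; rewrite mulr_ge0 //; nra.
  rewrite -(ler_pM2l (_ : 0 < a + b)); last by lra.
  have [ba|/eqP ba] := boolP (b - a == 0); last first.
    have : 0 <= p - q.
      by rewrite -(pmulr_rge0 _ (_ : 0 < b - a)) //; move/eqP: ba => ba; rewrite lt_neqAle eq_sym ba subr_ge0.
    nra.
  have e1 : b = a by move: ba; rewrite subr_eq0 => /eqP.
  have : m = n by apply/eqP; rewrite eqn_leq mn /= -ltnS -(ler_nat R) -/a -/b e1.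
  by move=> mE; rewrite /p /q /s mE; lra.
have [l ul] : exists l, tends r u l.
  apply: (form_complete hr) => d d0.
  have cvga : cvgn (fun n => nrm (u n) ^+ 2).
    apply: nonincreasing_is_cvgn.
      by apply/nonincreasing_seqP => n; have := key _ _ (leqnSn n); have := sqr_ge0 (nrm (u n - u n.+1)); lra.
    by exists 0 => _ [n _ <-]; rewrite sqr_ge0.
  have [n0 _ hn] := ((cvgrPdist_le _ _).1 cvga) (d ^+ 2 / 2) ltac:(nra).
  have H m n : (n0 <= m)%N -> (m <= n)%N -> nrm (u m - u n) <= d.
    move=> hm mn; rewrite -(@ler_pXn2r R 2 isT) ?nnegrE ?nrm_ge0 ?(ltW d0) //.
    apply: (le_trans (key _ _ mn)).
    have := hn m hm; have := hn n (leq_trans hm mn) => /=.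
    by rewrite !ler_norml => /andP[a1 a2] /andP[a3 a4]; lra.
  exists n0 => m n hm hn'; have [mn|/ltnW nm] := leqP m n; first exact: H.
  by rewrite nrm_distC // H.
have l0 : l = 0.
  apply: Kinj; apply: (tends_unique hr (u := fun n => K (u n))).
    by apply: tends_bounded ul => // a b; rewrite linearB.
  apply: (@tends_le _ _ r _ _ (fun n => h n * nrm x)).
    move=> n; rewrite subr0 uD linearZ (nrmZ_ge0 hr _ (ltW (h0 n))); apply: (ler_wpM2l (ltW (h0 n))).
    by rewrite -(JD (g n) (ltW (h0 n))) hg; apply: Jc; apply: ltW.
  rewrite (_ : (fun n => _) = (fun n => nrm x * h n)); last first.
    by apply/funext => n; rewrite mulrC.
  apply: cvg0_mull; exact: cvg_harmonic.
have [n0 hn] := (tendsP _ _ _).1 ul _ e0.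
exists (g n0); have := hn n0 (leqnn _); rewrite l0 subr0 uE.
by rewrite nrm_distC.
Qed.

Lemma range_dense_comp (f : V -> V) :
  (forall x e, 0 < e -> exists w, nrm (x - f w) <= e) ->
  forall x e, 0 < e -> exists w, nrm (x - K (f w)) <= e.
Proof.
move=> hf x e e0; have [g hg] := @range_dense x (e / 2) ltac:(lra).
have c1 : 0 < `|c| + 1 by apply: ltr_wpDl.
have [w hw] := hf g (e / (2 * (`|c| + 1))) ltac:(by apply: divr_gt0; lra).
exists w; apply: (le_trans (nrm_dist_triangle hr (K g) _ _)).
rewrite -linearB.
have : nrm (K (g - f w)) <= (`|c| + 1) * (e / (2 * (`|c| + 1))).
  by apply: (le_trans (Kc' _)); apply: ler_pM; rewrite ?nrm_ge0 // lerDl.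
rewrite (_ : (`|c| + 1) * _ = e / 2); first by lra.
by field; rewrite gt_eqF.
Qed.
Lemma range2_dense x e : 0 < e -> exists w, nrm (x - K (K w)) <= e.
Proof. exact: range_dense_comp range_dense x e. Qed.

(** The implicit Euler scheme with step t / 2^n. Dyadic refinement keeps the
    comparison of consecutive schemes to a single application of [J_add]. *)
Definition dyadic (n : nat) (t : R) (x : V) : V := iter (2 ^ n) (J (t / 2 ^+ n)) x.

Let step_ge0 n (t : R) : 0 <= t -> 0 <= t / 2 ^+ n.
Proof. by move=> t0; rewrite divr_ge0 // exprn_ge0. Qed.

Let step_mul n (t : R) : (2 ^ n)%:R * (t / 2 ^+ n) = t.
Proof. by rewrite natrX mulrC divfK // expf_neq0. Qed.

Lemma dyadic_contraction n t : 0 <= t -> contraction r (dyadic n t).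
Proof. by move=> t0; apply/contraction_iter/J_contraction/step_ge0. Qed.

Lemma iter_mul2 (T : Type) (f : T -> T) m x : iter (m * 2) f x = iter m (f \o f) x.
Proof. by elim: m => //= m ->. Qed.

Lemma dyadic_step n t w : 0 <= t ->
  nrm (dyadic n.+1 t (K (K w)) - dyadic n t (K (K w))) <=
  t ^+ 2 / 4 * nrm w * 2^-1 ^+ n.
Proof.
move=> t0; rewrite /dyadic expnSr iter_mul2.
set k := t / 2 ^+ n.+1; have k0 : 0 <= k by exact: step_ge0.
have -> : t / 2 ^+ n = k + k.
  by rewrite /k exprS; field; rewrite expf_neq0.
have kk0 : 0 <= k + k by rewrite addr_ge0.
apply: (le_trans (iter_diff hr _ _ _ _ _)).
- exact: (contraction_comp (J_contraction k0) (J_contraction k0)).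
- exact: J_contraction.
- by move=> y /=; rewrite !(J_comm _ k0 kk0).
rewrite nrm_distC //=.
apply: (le_trans (ler_wpM2l (ler0n _ _) (J_add_le w k0 k0))).
rewrite le_eqVlt; apply/orP; left; apply/eqP.
by rewrite /k natrX exprS exprVn; field; rewrite expf_neq0.
Qed.

(** Outside t >= 0 the value is arbitrary. *)
Definition semigroup (t : R) (x : V) : V :=
  if 0 <= t then xget 0 [set l | tends r (fun n => dyadic n t x) l] else x.
Local Notation T := semigroup.

Lemma dyadic_tends t x : 0 <= t -> tends r (fun n => dyadic n t x) (T t x).
Proof.
move=> t0; rewrite /T t0.
have [l hl] : exists l, tends r (fun n => dyadic n t x) l.
  apply: (contraction_cvg_dense hr (D := [set y | exists w, y = K (K w)]) (S := fun n => dyadic n t)).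
  - by move=> n; exact: dyadic_contraction.
  - by move=> y e /(range2_dense y) [w hw]; exists (K (K w)) => //; exists w.
  - move=> _ [w ->]; apply: (geometric_cauchy hr (q := 2^-1) (c := t ^+ 2 / 4 * nrm w)); first lra.
    by move=> n; exact: dyadic_step.
by case: xgetP => [y _ //|/(_ l)].
Qed.

Let eq_on_range2 a b : contraction r a -> contraction r b ->
  (forall w, a (K (K w)) = b (K (K w))) -> forall x, a x = b x.
Proof.
move=> ha hb hab; apply: (contraction_eq_dense hr (D := [set y | exists w, y = K (K w)]) ha hb).
- by move=> y e /(range2_dense y) [w hw]; exists (K (K w)) => //; exists w.
- by move=> _ [w ->].
Qed.

Lemma T_linear t a x y : 0 <= t -> T t (a *: x + y) = a *: T t x + T t y.
Proof.
move=> t0; apply: (tends_unique hr (dyadic_tends _ t0)).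
have E n : dyadic n t (a *: x + y) = a *: dyadic n t x + dyadic n t y.
  have h0 := step_ge0 n t0; rewrite /dyadic.
  elim: (2 ^ n)%N => //= m ->.
  by rewrite (contractionD _ _ (J_contraction h0)) JZ.
rewrite (_ : (fun n => _) = (fun n => a *: dyadic n t x + dyadic n t y)); last exact/funext.
apply: tendsD => //; last exact: dyadic_tends.
by apply: tendsZ => //; exact: dyadic_tends.
Qed.

Lemma T_contraction t : 0 <= t -> contraction r (T t).
Proof.
move=> t0; split=> [x y|x].
  by rewrite -scaleN1r addrC T_linear // scaleN1r addrC.
apply: (tends_nrm_le hr (dyadic_tends x t0)) => n.
exact: (dyadic_contraction n t0).2.
Qed.

Lemma T0 x : T 0 x = x.
Proof.
apply: (tends_unique hr (dyadic_tends x (lexx 0))).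
rewrite (_ : (fun n => _) = (fun _ => x)); first exact: tends_cst.
apply/funext => n; rewrite /dyadic mul0r; elim: (2 ^ n)%N => //= m ->.
by rewrite J0.
Qed.

Lemma TK t x : 0 <= t -> T t (K x) = K (T t x).
Proof.
move=> t0; apply: (tends_unique hr (dyadic_tends _ t0)).
rewrite (_ : (fun n => _) = (fun n => K (dyadic n t x))); last first.
  apply/funext => n; rewrite /dyadic; elim: (2 ^ n)%N => //= m ->.
  by rewrite JK // step_ge0.
by apply: tends_bounded (dyadic_tends _ t0) => // a b; rewrite linearB.
Qed.

Lemma T_add s t x : 0 <= s -> 0 <= t -> T (s + t) x = T s (T t x).
Proof.
move=> s0 t0; have st0 : 0 <= s + t by rewrite addr_ge0.
apply: (eq_on_range2 (a := T (s + t)) (b := T s \o T t)).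
- exact: T_contraction.
- exact: contraction_comp (T_contraction s0) (T_contraction t0).
move=> w; set z := K (K w).
have h1 : tends r (fun n => dyadic n (s + t) z - dyadic n s (dyadic n t z)) 0.
  apply: (@tends_le _ _ r _ _ (fun n => s * t * nrm w * 2^-1 ^+ n)); last first.
    by apply: cvg_geo; lra.
  move=> n; rewrite subr0 /dyadic -iter_comp; last first.
    by move=> y; rewrite J_comm ?step_ge0.
  have hs := step_ge0 n s0; have ht := step_ge0 n t0.
  have hst := step_ge0 n st0.
  apply: (le_trans (iter_diff hr _ _ _ _ _)).
  - exact: J_contraction.
  - exact: (contraction_comp (J_contraction hs) (J_contraction ht)).
  - by move=> y /=; rewrite (J_comm _ hst hs) (J_comm _ hst ht).
  rewrite mulrDl /=.
  apply: (le_trans (ler_wpM2l (ler0n _ _) (J_add_le w hs ht))).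
  rewrite le_eqVlt; apply/orP; left; apply/eqP.
  by rewrite natrX exprVn; field; rewrite expf_neq0.
have h2 : tends r (fun n => dyadic n s (dyadic n t z)) (T s (T t z)).
  apply: (@tends_le _ _ r _ _ (fun n => nrm (dyadic n t z - T t z)
      + nrm (dyadic n s (T t z) - T s (T t z)))).
    move=> n; apply: (le_trans (nrm_dist_triangle hr (dyadic n s (T t z)) _ _)).
    by rewrite lerD2r; apply/contraction_dist/dyadic_contraction.
  by apply: cvg0D; exact: dyadic_tends.
have := tendsD hr h1 h2; rewrite add0r.
rewrite (_ : (fun n => _) = (fun n => dyadic n (s + t) z)); last first.
  by apply/funext => n; rewrite subrK.
by move=> h; apply: (tends_unique hr _ h); exact: dyadic_tends.
Qed.

Lemma iterJ_sub_le h m g : 0 <= h -> nrm (iter m (J h) (K g) - K g) <= m%:R * h * nrm g.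
Proof.
move=> h0; elim: m => [|m IH] /=; first by rewrite subrr !mul0r nrm0.
apply: (le_trans (nrm_dist_triangle hr (J h (K g)) _ _)).
rewrite mulrSr !mulrDl mul1r; apply: lerD; last exact: JK_sub_le.
exact: (le_trans (contraction_dist _ _ (J_contraction h0))).
Qed.

Lemma T_sub_le t g : 0 <= t -> nrm (T t (K g) - K g) <= t * nrm g.
Proof.
move=> t0.
have := tendsD hr (dyadic_tends (K g) t0) (tends_cst hr (- K g)).
move/(tends_nrm_le hr); apply => n.
by apply: (le_trans (iterJ_sub_le _ _ (step_ge0 n t0))); rewrite step_mul.
Qed.

(** The Euler iterates satisfy this bound with t replaced by the elapsed time
    m h, uniformly in the step, by induction on the number of steps. *)
Lemma T_taylor t w : 0 <= t ->
  nrm (T t (K (K w)) - K (K w) - t%:C *: K w) <= t ^+ 2 * nrm w.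
Proof.
move=> t0; rewrite -addrA.
have := tendsD hr (dyadic_tends (K (K w)) t0)
  (tends_cst hr (- K (K w) - t%:C *: K w)).
move/(tends_nrm_le hr); apply => n.
rewrite -{2}(step_mul n t) -{3}(step_mul n t) /dyadic addrA.
have := step_ge0 n t0; move: (t / _) (2 ^ n)%N => h m h0.
elim: m => [|m IH]; first by rewrite /= subrr mul0r scale0r subrr nrm0 // expr0n /= mul0r.
rewrite iterS; set z := iter m (J h) (K (K w)).
set x := K (K w).
have -> : J h z - x - (m.+1%:R * h)%:C *: K w =
    J h (z - x - (m%:R * h)%:C *: K w) + (J h x - x - h%:C *: K w)
    + (m%:R * h)%:C *: (J h (K w) - K w).
  rewrite !JB // JZ // -addn1 natrD mulrDl mul1r (rmorphD (real_complex R)) scalerDl scalerBr.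
  move: (J h z) (J h x) (_ *: J h (K w)) (_ *: K w) (_ *: K w) => a b e f g.
  rewrite [RHS]addrAC (addrA _ e) subrK opprD !addrA.
  by rewrite [a - b - _ + b]addrAC subrK [_ - x - _ in LHS]addrAC.
apply: (le_trans (nrm_triangle hr _ _)).
apply: (le_trans (lerD (nrm_triangle hr _ _) (lexx _))).
rewrite nrmZ_ge0 ?mulr_ge0 //.
have h1 := le_trans (Jc (z - x - (m%:R * h)%:C *: K w) h0) IH.
have h2 : nrm (J h x - x - h%:C *: K w) <= h * (h * nrm w).
  by rewrite JK_sub // -scalerBr nrmZ_ge0 // ler_wpM2l // JK_sub_le.
have h3 : m%:R * h * nrm (J h (K w) - K w) <= m%:R * h * (h * nrm w).
  by rewrite ler_wpM2l ?mulr_ge0 // JK_sub_le.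
apply: (le_trans (lerD (lerD h1 h2) h3)).
rewrite -natr1; have := nrm_ge0 r w; have := ler0n R m.
move: (m%:R) (nrm w) => M W M0 W0.
rewrite -subr_ge0.
have -> : ((M + 1) * h) ^+ 2 * W - ((M * h) ^+ 2 * W + h * (h * W) + M * h * (h * W)) = M * (h ^+ 2 * W) by ring.
by rewrite !mulr_ge0 // sqr_ge0.
Qed.

Definition diff_quotient_tends (x y : V) : Prop :=
  nrm ((t^-1)%:C *: (T t x - x) - y) @[t --> 0^'+] --> (0 : R).

Lemma T_continuous0 x : nrm (T t x - x) @[t --> 0^'+] --> (0 : R).
Proof.
apply/cvgrPdist_le => e e0.
have [g hg] := @range_dense x (e / 4) ltac:(lra).
have g1 : 0 < nrm g + 1 by rewrite ltr_wpDl ?nrm_ge0.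
near=> t; rewrite sub0r normrN ger0_norm ?nrm_ge0 //.
have t0 : 0 < t by near: t; exact: nbhs_right_gt.
have tg : t * (nrm g + 1) <= e / 2.
  rewrite -ler_pdivlMr //; near: t; apply: nbhs_right_le.
  by rewrite divr_gt0 //; lra.
apply: (le_trans (nrm_dist_triangle hr (T t (K g)) _ _)).
have h1 := contraction_dist x (K g) (T_contraction (ltW t0)).
have h2 := nrm_dist_triangle hr (K g) (T t (K g)) x.
have h3 := T_sub_le g (ltW t0).
move: h2; rewrite (nrm_distC hr (K g) x); lra.
Unshelve. all: by end_near. Qed.

Lemma T_generator g : diff_quotient_tends (K g) g.
Proof.
apply/cvgrPdist_le => e e0.
have [w hw] := @range_dense g (e / 4) ltac:(lra).
have w1 : 0 < nrm w + 1 by rewrite ltr_wpDl ?nrm_ge0.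
near=> t; rewrite sub0r normrN ger0_norm ?nrm_ge0 //.
have t0 : 0 < t by near: t; exact: nbhs_right_gt.
have tw : t * (nrm w + 1) <= e / 2.
  rewrite -ler_pdivlMr //; near: t; apply: nbhs_right_le.
  by rewrite divr_gt0 //; lra.
have -> : (t^-1)%:C *: (T t (K g) - K g) - g = (t^-1)%:C *: (T t (K g) - K g - t%:C *: g).
  by rewrite [in RHS]scalerBr scalerA -rmorphM /= mulVf ?gt_eqF // scale1r.
rewrite nrmZ_ge0 ?invr_ge0 ?(ltW t0) // mulrC ler_pdivrMr //.
have -> : T t (K g) - K g - t%:C *: g = (T t (K (K w)) - K (K w) - t%:C *: K w)
    + (T t (K (g - K w)) - K (g - K w)) - t%:C *: (g - K w).
  rewrite (linearB K) (T_contraction (ltW t0)).1 scalerBr.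
  have E (a b x z p q : V) : a - x - p = b - z - q + (a - b - (x - z)) - (p - q).
    rewrite (_ : a - b - (x - z) = (a - x) - (b - z)); last by rewrite !opprD addrACA.
    by rewrite [b - z - q + _]addrC addrA subrK opprB addrA subrK.
  exact: E.
apply: (le_trans (nrm_triangleB hr _ _)).
apply: (le_trans (lerD (nrm_triangle hr _ _) (lexx _))).
have := T_taylor w (ltW t0); have := T_sub_le (g - K w) (ltW t0).
rewrite (nrmZ_ge0 hr _ (ltW t0)).
have : t * nrm (g - K w) <= t * (e / 4) by rewrite ler_pM2l.
have : t * (t * (nrm w + 1)) <= t * (e / 2) by rewrite ler_pM2l.
have : 0 <= t ^+ 2 by rewrite sqr_ge0.
have := nrm_ge0 r w; lra.
Unshelve. all: by end_near. Qed.

Lemma diff_quotient_tendsB x y x' y' : diff_quotient_tends x y ->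
  diff_quotient_tends x' y' -> diff_quotient_tends (x - x') (y - y').
Proof.
move=> h h'; apply: cvg0_le (cvg0D h h'); near=> t.
have t0 : 0 < t by near: t; exact: nbhs_right_gt.
rewrite nrm_ge0 /= (_ : _ *: _ - (y - y') = ((t^-1)%:C *: (T t x - x) - y)
  - ((t^-1)%:C *: (T t x' - x') - y')) ?nrm_triangleB //.
rewrite (_ : T t (x - x') - (x - x') = (T t x - x) - (T t x' - x')).
  by rewrite scalerBr !opprD !opprK addrACA.
by rewrite (T_contraction (ltW t0)).1 !opprD !opprK addrACA.
Unshelve. all: by end_near. Qed.

Lemma diff_quotient_dissipative x y : diff_quotient_tends x y -> r y x <= 0.
Proof.
move=> /cvgrPdist_le h; apply/ler_addgt0Pr => e e0; rewrite add0r.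
have x1 : 0 < nrm x + 1 by rewrite ltr_wpDl ?nrm_ge0.
have e1 : 0 < e / (nrm x + 1) by rewrite divr_gt0.
suff : \forall t \near (0 : R)^'+, r y x <= e.
  by move=> /filter_ex [].
near=> t.
have t0 : 0 < t by near: t; exact: nbhs_right_gt.
have : `|0 - nrm ((t^-1)%:C *: (T t x - x) - y)| <= e / (nrm x + 1).
  by near: t; exact: h.
rewrite sub0r normrN ger0_norm ?nrm_ge0 // ler_pdivlMr // => h1.
set q := (t^-1)%:C *: (T t x - x) in h1.
have h2 : r q x <= 0.
  rewrite /q (formE hr) pmulr_rle0 ?invr_gt0 // (formE hr) (formE hr) -(nrm_sqr hr x).
  rewrite subr_le0; apply: (le_trans (form_le hr _ _)).
  by rewrite expr2 ler_wpM2r ?nrm_ge0 // (T_contraction (ltW t0)).2.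
clearbody q; have := form_ge hr (q - y) x; rewrite !(formE hr).
have := nrm_ge0 r (q - y); lra.
Unshelve. all: by end_near. Qed.

(** The generator extends A by [T_generator] and is dissipative like that of every
    contraction semigroup. It cannot be larger: K - 1 is onto, hence so is
    1 - A, and a dissipative operator B has 1 - B injective. *)
Lemma T_generates (Dom : set V) (A : V -> V) :
  (forall x y, (Dom x /\ A x = y) <-> x = K y) -> generates nrm Dom A T.
Proof.
move=> DA x y; rewrite DA; split=> [->|h]; first exact: T_generator.
(* K g - g = y - x, so that x and -K g have the same image under 1 - B, where B is
   the generator, B x = y and B (-K g) = -g *)
have [g hg] := @D_surj 1 (y - x) ltr01.
have := diff_quotient_dissipative (diff_quotient_tendsB h (T_generator (- g))).
have e : y - - g = x - K (- g).
  have e0 : K g = y - x + g by rewrite -hg /D scale1r subrK.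
  by rewrite (linearN K) !opprK e0 addrA [x + _]addrC subrK.
rewrite e -(nrm_sqr hr) => h1.
have h2 : x - K (- g) = 0.
  by apply: (nrm_eq0 hr); apply/eqP; rewrite -sqrf_eq0 eq_le h1 sqr_ge0.
have -> : y = - g by apply/eqP; rewrite -subr_eq0 e h2.
by apply/eqP; rewrite -subr_eq0 h2.
Qed.

Lemma T_C0 : C0_semigroup nrm T.
Proof.
split.
- move=> t t0; split; first by move=> a x y; exact: T_linear.
  by exists 1 => x; rewrite mul1r; exact: (T_contraction t0).2.
- exact: T0.
- by move=> s t x; exact: T_add.
- exact: T_continuous0.
Qed.
End generation.

(** * Asymptotic stability from boundary dissipation *)

(** If b_1 > 0, log-convexity propagates the ratio q = b_1 / b_0, so that
    b_m >= b_0 q^m; decay at the rate q / 2 contradicts this. *)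
Lemma logconvex_superexp_decay (R : realType) (b : nat -> R) :
  (forall m, 0 <= b m) -> (forall m, b m.+1 ^+ 2 <= b m * b m.+2) ->
  (forall e, 0 < e -> exists C, forall m, b m <= C * e ^+ m) -> b 1%N = 0.
Proof.
move=> b0 bc bd; apply/eqP; apply/negPn/negP => b1n.
have b1 : 0 < b 1%N by rewrite lt_neqAle eq_sym b1n b0.
have b00 : 0 < b 0%N.
  rewrite lt_neqAle eq_sym b0 andbT; apply/eqP => b00.
  have := bc 0%N; rewrite b00 mul0r leNgt => /negP; apply.
  by rewrite exprn_gt0.
pose q := b 1%N / b 0%N.
have q0 : 0 < q by rewrite divr_gt0.
have bq m : 0 < b m /\ q * b m <= b m.+1.
  elim: m => [|m [bm IH]]; first by split=> //; rewrite /q divfK // gt_eqF.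
  have bm1 : 0 < b m.+1 by apply: lt_le_trans IH; rewrite mulr_gt0.
  split=> //; rewrite -(ler_pM2l bm) (le_trans _ (bc m)) //.
  by rewrite expr2 mulrA ler_pM2r // mulrC.
have bqm m : b 0%N * q ^+ m <= b m.
  elim: m => [|m IH]; first by rewrite expr0 mulr1.
  apply: le_trans (bq m).2; rewrite exprS mulrCA ler_pM2l //.
clearbody q; have [C hC] := bd (q / 2) ltac:(lra).
have C2 m : b 0%N * 2 ^+ m <= C.
  have := le_trans (bqm m) (hC m).
  rewrite expr_div_n mulrA ler_pdivlMr ?exprn_gt0 // mulrAC ler_pM2r //.
  by rewrite exprn_gt0.
have C0 : 0 < C by apply: lt_le_trans (C2 0%N); rewrite expr0 mulr1.
have [m hm] : exists m : nat, C / b 0%N < m%:R.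
  by exists (Num.truncn (C / b 0%N)).+1; rewrite truncnS_gt.
have := C2 m; rewrite mulrC -ler_pdivlMr // => h.
have := lt_le_trans hm (_ : (m%:R : R) <= 2 ^+ m).
rewrite -natrX ler_nat (ltnW (ltn_expl _ _)) // => /(_ isT) h2.
by rewrite natrX in h2; have := lt_le_trans h2 h; rewrite ltxx.
Qed.

Section stability.
Context (R : realType) (V : lmodType R[i]).
Context (r : V -> V -> R) (hr : hilbert_form r).
Local Notation nrm := (form_norm r).
Context (K : {linear V -> V}) (c : R).
Hypothesis Kc : forall x, nrm (K x) <= c * nrm x.
Hypothesis Kinj : forall x, K x = 0 -> x = 0.
(** [beta f] measures the boundary values of K f, and [G] is a quasinilpotent
    operator that agrees with K when they vanish. *)
Context (kappa : R) (beta : V -> R) (G : V -> V) (c2 : R).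
Hypothesis kappa0 : 0 < kappa.
Hypothesis beta0 : forall f, 0 <= beta f.
Hypothesis Kdiss2 : forall f, r (K f) f <= - kappa * beta f ^+ 2.
Hypothesis GB : forall x y, G (x - y) = G x - G y.
Hypothesis KG : forall f, nrm (K f - G f) <= c2 * beta f.
Hypothesis Gquasi : forall e, 0 < e -> exists C, forall m f,
  nrm (iter m G f) <= C * e ^+ m * nrm f.

Let Kdiss f : r (K f) f <= 0.
Proof. by apply: (le_trans (Kdiss2 f)); rewrite mulNr oppr_le0 mulr_ge0 ?sqr_ge0 ?ltW. Qed.

Let T := semigroup r K.
Let Tc t : 0 <= t -> contraction r (T t).
Proof. exact: (T_contraction hr Kc Kdiss Kinj). Qed.
Let TKc t x : 0 <= t -> T t (K x) = K (T t x).
Proof. exact: (TK hr Kc Kdiss Kinj). Qed.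
Let TnB n x y : T n%:R (x - y) = T n%:R x - T n%:R y.
Proof. by rewrite (Tc _).1. Qed.
Let TnD n x y : T n%:R (x + y) = T n%:R x + T n%:R y.
Proof. by rewrite (contractionD _ _ (Tc _)). Qed.
Let Tnc n x : nrm (T n%:R x) <= nrm x.
Proof. by rewrite (Tc _).2. Qed.
Let TnZ n (a : R) x : T n%:R (a%:C *: x) = a%:C *: T n%:R x.
Proof.
have := T_linear hr Kc Kdiss Kinj (a%:C) x 0 (ler0n R n).
by rewrite -/T addr0 (contraction0 (Tc (ler0n R n))) addr0.
Qed.
Let TnK n x : T n%:R (K x) = K (T n%:R x).
Proof. by rewrite TKc. Qed.
Let T_addn (n : nat) (h : R) x : 0 <= h -> T (n%:R + h) x = T n%:R (T h x).
Proof. by move=> h0; rewrite /T (T_add hr Kc Kdiss Kinj). Qed.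
Let T_mono s t x : 0 <= s <= t -> nrm (T t x) <= nrm (T s x).
Proof.
move=> /andP[s0 st]; rewrite -(subrK s t) /T (T_add hr Kc Kdiss Kinj) ?subr_ge0 //.
by rewrite (Tc _).2 // subr_ge0.
Qed.

Lemma nrm_T_cvg x : cvgn (fun n : nat => nrm (T n%:R x)).
Proof.
apply: nonincreasing_is_cvgn; last by exists 0 => _ [n _ <-]; exact: nrm_ge0.
by apply/nonincreasing_seqP => n; apply: T_mono; rewrite ler0n ler_nat leqnSn.
Qed.

Definition limit_norm x := limn (fun n : nat => nrm (T n%:R x)).
Lemma limit_normP x : nrm (T n%:R x) @[n --> \oo] --> limit_norm x.
Proof. exact: nrm_T_cvg. Qed.
Arguments limit_normP : clear implicits.

(** With A K w = w, the quantity 2 <T(n) K w, T(n) K^2 w> is the derivative of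
    |T(t) K^2 w|^2 at t = n. It is not positive and, up to an error
    O(h) coming from [T_taylor], at least -(1/h) times the energy lost between
    n and n + 1, which tends to 0. *)
Lemma dissipation_vanishes w :
  r (T n%:R (K w)) (T n%:R (K (K w))) @[n --> \oo] --> (0 : R).
Proof.
set x := K (K w).
pose del (n : nat) := nrm (T n%:R x) ^+ 2 - nrm (T n.+1%:R x) ^+ 2.
have del0 : del n @[n --> \oo] --> (0 : R).
  have h := limit_normP x.
  have h2 : (nrm (T n%:R x) ^+ 2) @[n --> \oo] --> limit_norm x ^+ 2.
    by rewrite expr2; under eq_fun do rewrite expr2; exact: cvgM.
  have h3 : (nrm (T n.+1%:R x) ^+ 2) @[n --> \oo] --> limit_norm x ^+ 2.
    by rewrite (cvg_shiftS (fun n : nat => nrm (T n%:R x) ^+ 2)).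
  have h4 := cvgB h2 h3; rewrite (subrr (limit_norm x ^+ 2)) in h4; exact: h4.
pose a := nrm (K w); pose b := nrm x; pose d := nrm w.
have a0 : 0 <= a by exact: nrm_ge0.
have b0 : 0 <= b by exact: nrm_ge0.
have d0 : 0 <= d by exact: nrm_ge0.
(* h^2 C dominates the terms of second order of |y + h z + e|^2, where
   |y| <= b, |z| <= a and |e| <= h^2 d *)
pose C := a ^+ 2 + 2 * b * d + 2 * a * d + d ^+ 2.
have C0 : 0 <= C by rewrite /C !addr_ge0 ?sqr_ge0 ?mulr_ge0.
have key (n : nat) (h : R) : 0 < h <= 1 ->
    - (2 * h * r (T n%:R (K w)) (T n%:R x)) <= del n + h ^+ 2 * C.
  move=> /andP[h0 h1].
  set z := T n%:R (K w); set y := T n%:R x.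
  pose e := T (n%:R + h) x - y - h%:C *: z.
  have ee : nrm e <= h ^+ 2 * d.
    rewrite /e (T_addn n x (ltW h0)) /y /z -(TnZ n h) -(TnB n (T h x) x) -(TnB n).
    by apply: (le_trans (Tnc _ _)); apply: (T_taylor hr Kc Kdiss Kinj); exact: ltW.
  have e1 : T (n%:R + h) x = y + h%:C *: z + e by rewrite /e -addrA [h%:C *: z + _]addrC subrK addrC subrK.
  have m1 : nrm (T n.+1%:R x) <= nrm (T (n%:R + h) x).
    by apply: T_mono; rewrite addr_ge0 ?(ltW h0) //= -natr1 lerD2l.
  have m2 : nrm (T n.+1%:R x) ^+ 2 <= nrm (T (n%:R + h) x) ^+ 2.
    by rewrite ler_sqr ?nnegrE ?nrm_ge0.
  have z1 : nrm z <= a by exact: Tnc.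
  have y1 : nrm y <= b by exact: Tnc.
  move: m2; rewrite e1 /del -/y; clearbody e y z; clear e1 m1.
  rewrite (nrm_sqr hr (y + _ + e)) !(formE hr) (formC hr z y) (formC hr e y) (formC hr e z).
  rewrite -!(nrm_sqr hr).
  have h3 := form_le hr y e; have h4 := form_le hr z e.
  have y0 := nrm_ge0 r y; have z0 := nrm_ge0 r z; have e0 := nrm_ge0 r e.
  have f1 : nrm y * nrm e <= b * (h ^+ 2 * d) by apply: ler_pM.
  have f2 : nrm z * nrm e <= a * (h ^+ 2 * d) by apply: ler_pM.
  have f3 : nrm z ^+ 2 <= a ^+ 2 by rewrite ler_sqr ?nnegrE.
  have f4 : nrm e ^+ 2 <= (h ^+ 2 * d) ^+ 2.
    by rewrite ler_sqr ?nnegrE // mulr_ge0 ?sqr_ge0.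
  have h20 : 0 <= h ^+ 2 by exact: sqr_ge0.
  have f5 : h * r z e <= a * (h ^+ 2 * d).
    apply: (@le_trans _ _ (h * (a * (h ^+ 2 * d)))).
      by rewrite ler_pM2l // (le_trans h4).
    by rewrite -[leRHS]mul1r; apply: ler_wpM2r => //; apply: mulr_ge0 => //; exact: mulr_ge0.
  have f6 : (h ^+ 2 * d) ^+ 2 <= h ^+ 2 * d ^+ 2.
    rewrite exprMn ler_wpM2r ?sqr_ge0 // [leLHS]expr2 ler_piMl //.
    by apply: exprn_ile1 => //; exact: ltW.
  have f7 : h ^+ 2 * nrm z ^+ 2 <= h ^+ 2 * a ^+ 2 by rewrite ler_wpM2l.
  rewrite /C (formC hr y z); lra.
have neg n : 0 <= - r (T n%:R (K w)) (T n%:R x).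
  by rewrite oppr_ge0 /x [T _ (K (K w))]TnK formC.
rewrite -[0 in X in _ --> X]oppr0 -[X in X @ _](_ : \- (fun n : nat => - r (T n%:R (K w)) (T n%:R x)) = _); last first.
  by apply/funext => n /=; rewrite opprK.
apply: cvgN; apply/cvg0P => // e e0.
pose h := Num.min 1 (e / (C + 1)).
have C1 : 0 < C + 1 by rewrite ltr_wpDl.
have h01 : 0 < h <= 1 by rewrite /h ge_min lexx andbT lt_min ltr01 divr_gt0.
have hC : h * C <= e.
  apply: (@le_trans _ _ (h * (C + 1))).
    by rewrite ler_wpM2l ?lerDl //; case/andP: h01 => /ltW.
  by rewrite -ler_pdivlMr // /h ge_min lexx orbT.
have /andP[h0 h1] := h01.
have dn0 n : 0 <= del n.
  by rewrite /del subr_ge0 ler_sqr ?nnegrE ?nrm_ge0 //; apply: T_mono; rewrite ler0n ler_nat leqnSn.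
have [n0 hn] := (cvg0P dn0).1 del0 (h * e) (mulr_gt0 h0 e0).
exists n0 => n /hn hd.
have k1 := key n h h01.
have k2 : h * (h * C) <= h * e by rewrite ler_pM2l.
by rewrite -(ler_pM2l h0) /=; lra.
Qed.
Arguments dissipation_vanishes : clear implicits.

(** Polarization of [dissipation_vanishes]. *)
Lemma skew_vanishes w w' :
  r (T n%:R (K w)) (T n%:R (K (K w'))) + r (T n%:R (K w')) (T n%:R (K (K w)))
    @[n --> \oo] --> (0 : R).
Proof.
have h := cvg0D (dissipation_vanishes (w + w'))
  (cvg0D (cvg0_mull (-1) (dissipation_vanishes w)) (cvg0_mull (-1) (dissipation_vanishes w'))).
pose f u (n : nat) := r (T n%:R (K u)) (T n%:R (K (K u))).
rewrite [X in X @ _](_ : _ = (fun n => f (w + w') n + (-1 * f w n + -1 * f w' n))).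
  exact: h.
by apply/funext => n; rewrite /f /= !(linearD K) !TnD !(formE hr); ring.
Qed.
Arguments skew_vanishes : clear implicits.

Lemma beta_vanishes w : beta (T n%:R (K w)) @[n --> \oo] --> (0 : R).
Proof.
apply/cvg0P => // e e0.
have hd : -1 * r (T n%:R (K w)) (T n%:R (K (K w))) @[n --> \oo] --> (0 : R).
  by apply: cvg0_mull; exact: dissipation_vanishes.
have h0 (n : nat) : kappa * beta (T n%:R (K w)) ^+ 2 <= -1 * r (T n%:R (K w)) (T n%:R (K (K w))).
  by rewrite mulN1r lerNr -mulNr [T _ (K (K w))]TnK (formC hr (T _ _)) Kdiss2.
have h1 (n : nat) : 0 <= -1 * r (T n%:R (K w)) (T n%:R (K (K w))).
  by apply: le_trans (h0 n); apply: mulr_ge0; [exact: ltW|exact: sqr_ge0].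
have [n0 hn] := (cvg0P h1).1 hd (kappa * e ^+ 2) (mulr_gt0 kappa0 (exprn_gt0 2 e0)).
exists n0 => n /hn /(le_trans (h0 n)).
by rewrite ler_pM2l // ler_sqr ?nnegrE ?(ltW e0).
Qed.
Arguments beta_vanishes : clear implicits.

(** Along an orbit the boundary values tend to 0, so K may be replaced by G one
    factor at a time. *)
Lemma K_iter_G m u :
  nrm (T n%:R (iter m K (K u)) - iter m G (T n%:R (K u))) @[n --> \oo] --> (0 : R).
Proof.
have [C hC] := Gquasi ltr01.
have Gc f : nrm (G f) <= C * nrm f.
  by have := hC 1%N f; rewrite /= expr1 mulr1.
elim: m => [|m IH] /=.
  by under eq_fun do rewrite subrr nrm0 //; exact: cvg_cst.
have h : c2 * beta (T n%:R (K (iter m K u))) + C * nrm (T n%:R (iter m K (K u))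
    - iter m G (T n%:R (K u))) @[n --> \oo] --> (0 : R).
  by apply: cvg0D; apply: cvg0_mull => //; exact: beta_vanishes.
apply: cvg0_le h; near=> n.
rewrite nrm_ge0 /= TnK.
rewrite (_ : K (iter m K u) = iter m K (K u)); last by rewrite -iterS iterSr.
apply: (le_trans (nrm_dist_triangle hr (G (T n%:R (iter m K (K u)))) _ _)).
by apply: lerD; [exact: KG|rewrite -GB; exact: Gc].
Unshelve. all: by end_near. Qed.
Arguments K_iter_G : clear implicits.

Lemma limit_norm_range2 u : limit_norm (K (K u)) = 0.
Proof.
pose b m := limit_norm (iter m K (K u)).
apply: (@logconvex_superexp_decay _ b).
- move=> m; apply: limr_ge; first exact: nrm_T_cvg.
  by near=> n; exact: nrm_ge0.
- move=> m.
  have hs := skew_vanishes (iter m K (K u)) (iter m K u).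
  have h1 := limit_normP (iter m.+1 K (K u)).
  have h2 := limit_normP (iter m K (K u)).
  have h3 := limit_normP (iter m.+2 K (K u)).
  (* subtracting the vanishing term of [skew_vanishes] turns |K v|^2 into
     - <v, K^2 v>, to which Cauchy-Schwarz applies *)
  rewrite expr2 -[leLHS]subr0; apply: ler_cvg_to (cvgB (cvgM h1 h1) hs) (cvgM h2 h3) _.
  near=> n => /=.
  rewrite (_ : K (K (iter m K u)) = K (iter m K (K u))); last by rewrite -[in RHS]iterSr.
  rewrite (_ : K (iter m K u) = iter m K (K u)); last by rewrite -iterS iterSr.
  set a := T n%:R (K (iter m K (K u))); set b1 := T _ _; set b2 := T _ (K (K _)).
  change (nrm a * nrm a - (r a a + r b1 b2) <= nrm b1 * nrm b2).
  rewrite -expr2 nrm_sqr // opprD addrA subrr add0r.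
  by rewrite -(nrmN hr b2) -(formNr hr); exact: form_le.
- move=> e e0; have [C hC] := Gquasi e0.
  exists (`|C| * nrm (K u)) => m.
  rewrite /b -[leLHS]subr0.
  apply: ler_cvg_to (cvgB (limit_normP (iter m K (K u))) (K_iter_G m u)) (cvg_cst _) _.
  near=> n => /=.
  rewrite lerBlDr; apply: (le_trans (nrm_le_dist hr _ (iter m G (T n%:R (K u))))).
  rewrite lerD2r; apply: (le_trans (hC m _)).
  rewrite mulrAC; apply: ler_wpM2r; first by rewrite exprn_ge0 // ltW.
  apply: (le_trans (ler_wpM2r (nrm_ge0 _ _) (ler_norm C))).
  by apply: ler_wpM2l => //; exact: Tnc.
Unshelve. all: by end_near. Qed.

Theorem semigroup_stable : asymptotically_stable nrm T.
Proof.
move=> x; apply/cvgrPdist_le => e e0.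
have [w hw] := range2_dense hr Kc Kdiss Kinj x (e := e / 2) ltac:(lra).
have h : nrm (T n%:R (K (K w))) @[n --> \oo] --> (0 : R).
  by rewrite -(limit_norm_range2 w); exact: limit_normP.
have [n0 hn] := (cvg0P (fun n : nat => nrm_ge0 r (T n%:R (K (K w))))).1 h (e / 2) ltac:(lra).
near=> t; rewrite sub0r normrN ger0_norm ?nrm_ge0 //.
have tn : n0%:R <= t by near: t; exact: nbhs_pinfty_ge.
apply: (le_trans (nrm_le_dist hr _ (T t (K (K w))))).
have t0 : 0 <= t by apply: le_trans tn; exact: ler0n.
have := contraction_dist x (K (K w)) (Tc t0).
have := @T_mono n0%:R t (K (K w)); rewrite tn ler0n => /(_ isT).
have := hn n0 (leqnn _); lra.
Unshelve. all: by end_near. Qed.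
End stability.

(** * Integration on the unit interval *)

Section unit_interval.
Context (R : realType).
Local Notation mu := (@lebesgue_measure R).
Local Notation I := (unit_itv R).
Implicit Types f g u v : R -> R.

Definition integrable01 f : Prop := mu.-integrable I (EFin \o f).
Definition integral01 f : R := \int[mu]_(z in I) f z.

Lemma measurable_I : measurable I. Proof. exact: measurable_itv. Qed.

Lemma mu_I : mu I = 1%:E.
Proof. by rewrite /unit_itv lebesgue_measure_itv /= lte_fin ltr01 sube0. Qed.

Lemma integrable01_measurable f : integrable01 f -> measurable_fun I f.
Proof. by move=> /measurable_int /measurable_EFinP. Qed.

Lemma integrable01_le f g : measurable_fun I f ->
  (forall z, I z -> `|f z| <= g z) -> integrable01 g -> integrable01 f.
Proof.
move=> mf fg ig; apply: le_integrable ig => //; first exact/measurable_EFinP.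
by move=> z Iz /=; rewrite lee_fin (le_trans (fg z Iz)) // ler_norm.
Qed.

Lemma integrable01_cst (c : R) : integrable01 (fun=> c).
Proof.
apply/integrableP; split; first by apply/measurable_EFinP.
rewrite integral_cst //= mu_I mule1; exact: ltry.
Qed.

Lemma integrable01D f g : integrable01 f -> integrable01 g ->
  integrable01 (fun z => f z + g z).
Proof. by move=> hf hg; exact: (integrableD _ hf hg). Qed.
Lemma integrable01Z c f : integrable01 f -> integrable01 (fun z => c * f z).
Proof. by move=> hf; exact: (integrableZl _ c hf). Qed.
Lemma integrable01B f g : integrable01 f -> integrable01 g ->
  integrable01 (fun z => f z - g z).
Proof. by move=> hf hg; exact: (integrableB _ hf hg). Qed.
Lemma integrable01_sum (J : Type) (s : seq J) (F : J -> R -> R) :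
  (forall j, integrable01 (F j)) -> integrable01 (fun z => \sum_(j <- s) F j z).
Proof.
move=> hF; elim: s => [|j s IH].
  by under eq_fun do rewrite big_nil; exact: integrable01_cst.
by under eq_fun do rewrite big_cons; exact: integrable01D.
Qed.

Lemma integral01_cst c : integral01 (fun=> c) = c.
Proof. by rewrite /integral01 /Rintegral integral_cst //= mu_I mule1. Qed.
Lemma integral01D f g : integrable01 f -> integrable01 g ->
  integral01 (fun z => f z + g z) = integral01 f + integral01 g.
Proof. by move=> hf hg; exact: RintegralD. Qed.
Lemma integral01B f g : integrable01 f -> integrable01 g ->
  integral01 (fun z => f z - g z) = integral01 f - integral01 g.
Proof. by move=> hf hg; exact: RintegralB. Qed.
Lemma integral01Z c f : integrable01 f ->
  integral01 (fun z => c * f z) = c * integral01 f.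
Proof. by move=> hf; exact: RintegralZl. Qed.
Lemma integral01N f : integrable01 f ->
  integral01 (fun z => - f z) = - integral01 f.
Proof.
move=> hf; rewrite -mulN1r -integral01Z //.
by congr integral01; apply/funext => z; rewrite mulN1r.
Qed.
Lemma integral01_sum (J : Type) (s : seq J) (F : J -> R -> R) :
  (forall j, integrable01 (F j)) ->
  integral01 (fun z => \sum_(j <- s) F j z) = \sum_(j <- s) integral01 (F j).
Proof.
move=> hF; elim: s => [|j s IH].
  by rewrite big_nil; under eq_fun do rewrite big_nil; exact: integral01_cst.
rewrite big_cons -IH -integral01D //; last exact: integrable01_sum.
by under eq_fun do rewrite big_cons.
Qed.
Lemma integral01_ge0 f : (forall z, I z -> 0 <= f z) -> 0 <= integral01 f.
Proof. by move=> h; apply: Rintegral_ge0. Qed.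
Lemma integral01_le f g : integrable01 f -> integrable01 g ->
  (forall z, I z -> f z <= g z) -> integral01 f <= integral01 g.
Proof. by move=> hf hg fg; apply: le_Rintegral. Qed.
Lemma eq_integral01 f g : (forall z, I z -> f z = g z) -> integral01 f = integral01 g.
Proof. by move=> fg; apply: eq_Rintegral => z /set_mem; exact: fg. Qed.

Lemma ae01W (P : R -> Prop) : (forall z, I z -> P z) -> ae01 P.
Proof. by move=> h; apply: aeW => z; exact: h. Qed.
Lemma ae01S (P Q : R -> Prop) : (forall z, I z -> P z -> Q z) -> ae01 P -> ae01 Q.
Proof.
by move=> PQ hP; apply: (ae01S2 _ (ae01W (fun z Iz => Iz)) hP) => z; exact: PQ.
Qed.
Lemma ae01_all (n : nat) (P : 'I_n -> R -> Prop) :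
  (forall i, ae01 (P i)) -> ae01 (fun z => forall i, P i z).
Proof.
move=> h; have : forall s : seq 'I_n, ae01 (fun z => forall i, i \in s -> P i z).
  elim=> [|i s IH]; first by apply: ae01W.
  apply: (ae01S2 _ (h i) IH) => z Pi Ps j; rewrite inE => /orP[/eqP->//|]; exact: Ps.
move=> /(_ (enum 'I_n)); apply: ae01S => z _ hz i; apply: hz.
by rewrite mem_enum.
Qed.

Lemma integrable01_ae f g : measurable_fun I g -> ae01 (fun z => f z = g z) ->
  integrable01 f -> integrable01 g.
Proof.
move=> mg fg /[dup] /integrable01_measurable mf /integrableP[_ hf].
apply/integrableP; split; first exact/measurable_EFinP.
rewrite (@ae_eq_integral _ _ _ mu I (fun x => `|(EFin \o f) x|%E) (fun x => `|(EFin \o g) x|%E)) //.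
- by apply: measurableT_comp => //; exact/measurable_EFinP.
- by apply: measurableT_comp => //; exact/measurable_EFinP.
- apply: (ae01S _ fg) => z _ /= -> //.
Qed.

Lemma integral01_ae f g : measurable_fun I f -> measurable_fun I g ->
  ae01 (fun z => f z = g z) -> integral01 f = integral01 g.
Proof.
move=> mf mg fg; rewrite /integral01 /Rintegral; congr fine.
apply: ae_eq_integral => //; try exact/measurable_EFinP.
by apply: (ae01S _ fg) => z _ /= ->.
Qed.

Lemma integral01_eq0 f : integrable01 f -> (forall z, I z -> 0 <= f z) ->
  integral01 f = 0 -> ae01 (fun z => f z = 0).
Proof.
move=> hf f0 If.
have [h _] := ae_eq_integral_abs mu measurable_I (measurable_int _ hf).
apply: (ae01S (P := fun z => (EFin \o f) z = 0%E)); first by move=> z _ [].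
apply: h; have fn : (\int[mu]_(z in I) (f z)%:E)%E \is a fin_num.
  exact: integrable_fin_num.
transitivity (\int[mu]_(z in I) (f z)%:E)%E.
  by apply: eq_integral => z /set_mem Iz /=; rewrite ger0_norm // f0.
by rewrite -(fineK fn) -[RHS]/(0%:E) -If.
Qed.

Lemma integral01_le_ae f g : integrable01 f -> integrable01 g ->
  ae01 (fun z => f z <= g z) -> integral01 f <= integral01 g.
Proof.
move=> hf hg fg.
have mm : measurable_fun I (fun z => Num.max (f z) (g z)).
  by apply: measurable_maxr; exact: integrable01_measurable.
have hm : ae01 (fun z => g z = Num.max (f z) (g z)).
  by apply: (ae01S _ fg) => z _ h; apply/esym/max_idPr.
rewrite (integral01_ae (integrable01_measurable hg) mm hm).
apply: integral01_le => //; first exact: (integrable01_ae mm hm hg).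
by move=> z _; rewrite le_max lexx.
Qed.

Definition L2r u : Prop := measurable_fun I u /\ integrable01 (fun z => u z ^+ 2).

Lemma L2r_mul u v : L2r u -> L2r v -> integrable01 (fun z => u z * v z).
Proof.
move=> [mu' hu] [mv hv].
apply: (integrable01_le _ _ (integrable01D hu hv)); first exact: measurable_funM.
move=> z _; rewrite ler_norml.
have := sqr_ge0 (u z - v z); have := sqr_ge0 (u z + v z).
have := sqr_ge0 (u z); have := sqr_ge0 (v z).
by rewrite !expr2; lra.
Qed.
Lemma L2r_cst c : L2r (fun=> c).
Proof. by split=> //; exact: integrable01_cst. Qed.
Lemma L2r_integrable u : L2r u -> integrable01 u.
Proof.
move=> hu; have := L2r_mul (L2r_cst 1) hu.
by under eq_fun do rewrite mul1r.
Qed.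
Lemma L2rZ c u : L2r u -> L2r (fun z => c * u z).
Proof.
move=> [mu' hu]; split; first exact: measurable_funM.
by under eq_fun do rewrite exprMn; exact: integrable01Z.
Qed.
Lemma L2rD u v : L2r u -> L2r v -> L2r (fun z => u z + v z).
Proof.
move=> hu hv; have huv := L2r_mul hu hv; have [mu' hu2] := hu; have [mv hv2] := hv.
split; first exact: measurable_funD.
under eq_fun do rewrite sqrrD -mulr_natl.
by apply: integrable01D => //; apply: integrable01D => //; exact: integrable01Z.
Qed.
Lemma L2rB u v : L2r u -> L2r v -> L2r (fun z => u z - v z).
Proof.
move=> hu hv; have := L2rD hu (L2rZ (-1) hv).
by under eq_fun do rewrite mulN1r.
Qed.
Lemma L2r_le u v : measurable_fun I u -> (forall z, I z -> `|u z| <= `|v z|) ->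
  L2r v -> L2r u.
Proof.
move=> mu' uv [mv hv]; split=> //.
apply: (integrable01_le _ _ hv); first by apply: measurable_funX.
move=> z Iz; rewrite normrX -real_normK ?num_real //.
by rewrite -[leRHS]real_normK ?num_real // ler_sqr ?nnegrE // normr_id uv.
Qed.

Lemma half_pow_cvg0 (c : R) : c * 2^-1 ^+ n @[n --> \oo] --> (0 : R).
Proof. by apply: cvg_geo; lra. Qed.

(** The root s of the bound is kept apart so that |x_(k+1) - x_k| <= s 2^-k. *)
Lemma fast_cauchy_real (x : nat -> R) (s : R) : 0 <= s ->
  (forall k, (x k.+1 - x k) ^+ 2 <= s ^+ 2 * 4^-1 ^+ k) ->
  exists l, x n @[n --> \oo] --> l /\ forall k, (l - x k) ^+ 2 <= 4 * s ^+ 2 * 4^-1 ^+ k.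
Proof.
move=> s0 hx.
have e4 k : (4 : R)^-1 ^+ k = (2^-1 ^+ k) ^+ 2.
  by rewrite -exprM mulnC exprM; congr (_ ^+ k); field.
have p2 k : (0 : R) <= 2^-1 ^+ k by rewrite exprn_ge0.
have d k : `|x k.+1 - x k| <= s * 2^-1 ^+ k.
  rewrite -ler_sqr ?nnegrE ?mulr_ge0 // exprMn -e4 real_normK ?num_real //.
have dd k n : `|x (k + n)%N - x k| <= 2 * s * (2^-1 ^+ k - 2^-1 ^+ (k + n)).
  elim: n => [|n IH]; first by rewrite addn0 !subrr mulr0 normr0.
  rewrite addnS; apply: (le_trans (ler_distD (x (k + n)%N) _ _)).
  apply: (le_trans (lerD (d _) IH)); rewrite exprS; lra.
have dd' k n : `|x (k + n)%N - x k| <= 2 * s * 2^-1 ^+ k.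
  apply: (le_trans (dd k n)); rewrite ler_wpM2l ?mulr_ge0 //.
  by rewrite gerBl.
have cx : cvgn x.
  apply/cauchy_cvgP/cauchyP => e e0.
  have [n0 _ hn] := (cvgrPdist_lt _ _).1 (half_pow_cvg0 (2 * s)) e e0.
  exists (x n0), n0 => // n n0n /=; rewrite /ball /=.
  rewrite distrC -(subnKC n0n) (le_lt_trans (dd' _ _)) //.
  by have := hn n0 (leqnn _); rewrite sub0r normrN ger0_norm // mulr_ge0 // mulr_ge0.
exists (limn x); split=> // k.
have : `|limn x - x k| <= 2 * s * 2^-1 ^+ k.
  have h : `|x n - x k| @[n --> \oo] --> `|limn x - x k|.
    by apply: cvg_norm; apply: cvgB => //; exact: cvg_cst.
  rewrite -(cvg_lim (@Rhausdorff R) h); apply: limr_le; first by apply/cvg_ex; eexists; exact: h.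
  near=> n; have kn : (k <= n)%N by near: n; exact: nbhs_infty_ge.
  by rewrite -(subnKC kn).
rewrite -ler_sqr ?nnegrE ?mulr_ge0 // real_normK ?num_real //.
by rewrite !exprMn -e4 -natrX.
Unshelve. all: by end_near. Qed.

Lemma integrable01_le_ae f g : measurable_fun I f ->
  ae01 (fun z => `|f z| <= g z) -> integrable01 g -> integrable01 f.
Proof.
move=> mf fg hg.
have mm : measurable_fun I (fun z => Num.max `|f z| (g z)).
  by apply: measurable_maxr; [exact: measurableT_comp|exact: integrable01_measurable].
have hm : ae01 (fun z => g z = Num.max `|f z| (g z)).
  by apply: (ae01S _ fg) => z _ h; apply/esym/max_idPr.
apply: integrable01_le mf _ (integrable01_ae mm hm hg).
by move=> z _; rewrite le_max lexx.
Qed.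

(** Riesz-Fischer for sequences that converge fast enough. The function
    g = sum_k 4^k (u_(k+1) - u_k)^2 has integral at most sum_k 4^k 8^-k = 2, so
    it is finite almost everywhere, and there [fast_cauchy_real] applies. *)
Lemma fast_cauchy_L2 (u : nat -> R -> R) : (forall n, L2r (u n)) ->
  (forall k, integral01 (fun z => (u k.+1 z - u k z) ^+ 2) <= 8^-1 ^+ k) ->
  exists v C, L2r v /\ forall k, integral01 (fun z => (v z - u k z) ^+ 2) <= C * 4^-1 ^+ k.
Proof.
move=> hu hd.
pose d k z := 4 ^+ k * (u k.+1 z - u k z) ^+ 2.
have d0 k z : 0 <= d k z by apply: mulr_ge0; [exact: exprn_ge0|exact: sqr_ge0].
have id k : integrable01 (d k).
  by apply: integrable01Z; have [] := L2rB (hu k.+1) (hu k).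
pose g z : \bar R := (\sum_(0 <= k <oo) (d k z)%:E)%E.
have g0 z : (0 <= g z)%E by apply: nneseries_ge0 => k _ _; rewrite lee_fin ?d0.
have md k : measurable_fun I (EFin \o d k).
  apply/measurable_EFinP; exact: integrable01_measurable.
have mg : measurable_fun I g.
  apply: ge0_emeasurable_sum; [by move=> k z *; rewrite lee_fin d0|by move=> k _; exact: md].
have ig : (\int[mu]_(z in I) g z <= 2%:E)%E.
  rewrite integral_nneseries //; last by move=> k z _; rewrite lee_fin d0.
  apply: lime_le; first by apply: is_cvg_nneseries => k _ _; apply: integral_ge0 => z _; rewrite lee_fin ?d0.
  near=> n.
  have h2 k : (\int[mu]_(z in I) (d k z)%:E <= (2^-1 ^+ k)%:E)%E.
    rewrite -[leLHS]fineK; last exact: integrable_fin_num (id k).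
    have hk : integrable01 (fun z => (u k.+1 z - u k z) ^+ 2).
      by have [] := L2rB (hu k.+1) (hu k).
    have -> : fine (\int[mu]_(z in I) (d k z)%:E) =
        4 ^+ k * integral01 (fun z => (u k.+1 z - u k z) ^+ 2).
      by rewrite -integral01Z.
    rewrite lee_fin.
    apply: (le_trans (ler_wpM2l _ (hd k))); first by rewrite exprn_ge0.
    by rewrite -exprMn (_ : 4 * 8^-1 = 2^-1 :> R) //; field.
  have h3 : (\sum_(0 <= k < n) (\int[mu]_(z in I) (d k z)%:E) <= \sum_(0 <= k < n) (2^-1 ^+ k)%:E)%E.
    by apply: lee_sum => k _.
  apply: (le_trans h3); rewrite sumEFin lee_fin.
  suff -> : \sum_(0 <= k < n) (2^-1 ^+ k : R) = 2 - 2 * 2^-1 ^+ n.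
    by rewrite gerBl mulr_ge0 // exprn_ge0.
  elim: (n) => [|m IH]; first by rewrite big_nil; ring.
  by rewrite big_nat_recr //= IH exprS; field.
have ing : mu.-integrable I g.
  apply/integrableP; split=> //; apply: (le_lt_trans _ (ltry 2)).
  apply: le_trans ig; rewrite le_eqVlt; apply/orP; left; apply/eqP.
  by apply: eq_integral => z _; rewrite gee0_abs.
pose G z := fine (g z).
have gfin : ae01 (fun z => g z \is a fin_num) by exact: (@integrable_ae _ _ _ mu I measurable_I g ing).
have mG : measurable_fun I G.
  by apply: measurableT_comp mg; exact: fine_measurable.
have iG : integrable01 G.
  apply/integrableP; split; first exact/measurable_EFinP.
  move/integrableP: ing => [_]; apply: le_lt_trans.
  apply: ge0_le_integral => //.
  - by apply: measurableT_comp => //; exact/measurable_EFinP.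
  - exact: measurableT_comp.
  - move=> z _ /=; rewrite /G; have := g0 z.
    by case: (g z) => //=; rewrite ?normr0 ?leey.
(* the upper limit is measurable everywhere, and it is the limit wherever g is
   finite *)
pose v z := fine (limn_esup (fun k => (u k z)%:E)).
have mv : measurable_fun I v.
  apply: measurableT_comp; first exact: fine_measurable.
  apply: measurable_fun_limn_esup => n; apply/measurable_EFinP.
  by have [] := hu n.
have key : ae01 (fun z => forall k, (v z - u k z) ^+ 2 <= 4 * G z * 4^-1 ^+ k).
  apply: (ae01S _ gfin) => z _ gz.
  have G0 : 0 <= G z by rewrite /G fine_ge0.
  have [k|l [ul hl]] := @fast_cauchy_real (u^~ z) (Num.sqrt (G z)) (sqrtr_ge0 _).
    rewrite sqr_sqrtr // exprVn ler_pdivlMr ?exprn_gt0 // mulrC -/(d k z).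
    rewrite -lee_fin /G fineK //.
    have := @nneseries_lim_ge R (fun k => (d k z)%:E) xpredT 0 k.+1.
    move=> /(_ (fun _ _ _ => _)) h.
    apply: le_trans (h _); last by move=> *; rewrite lee_fin ?d0.
    by rewrite big_nat_recr //= leeDr // sume_ge0 // => *; rewrite lee_fin ?d0.
  have vl : v z = l.
    have ul' : (u k z)%:E @[k --> \oo] --> l%:E by apply: cvg_EFin => //; near=> n.
    by rewrite /v; have [_ ->] := cvg_limn_einf_sup ul'.
  by move=> k; rewrite vl; have := hl k; rewrite sqr_sqrtr.
have key2 k : ae01 (fun z => (v z - u k z) ^+ 2 <= 4 * 4^-1 ^+ k * G z).
  by apply: (ae01S _ key) => z _ /(_ k); rewrite mulrAC.
have mvu k : measurable_fun I (fun z => v z - u k z).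
  by apply: measurable_funB => //; have [] := hu k.
have L2vu k : L2r (fun z => v z - u k z).
  split=> //; apply: (@integrable01_le_ae _ (fun z => 4 * 4^-1 ^+ k * G z)).
  - exact: measurable_funX.
  - by apply: (ae01S _ (key2 k)) => z _; rewrite ger0_norm ?sqr_ge0.
  - exact: integrable01Z.
exists v, (4 * integral01 G); split.
  have := L2rD (L2vu 0%N) (hu 0%N).
  by under eq_fun do rewrite subrK.
move=> k; rewrite mulrAC -integral01Z //.
apply: integral01_le_ae; [by have [] := L2vu k|exact: integrable01Z|exact: key2].
Unshelve. all: by end_near. Qed.
End unit_interval.

(** * Classes of square integrable functions *)

Section complex_vectors.
Context (R : realType).
Local Notation I := (unit_itv R).

Definition hdot n (A : 'M[R[i]]_n) (u v : 'cV[R[i]]_n) : R :=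
  complex.Re ((u ^t* *m A *m v) 0 0).

Lemma ReD (a b : R[i]) : complex.Re (a + b) = complex.Re a + complex.Re b.
Proof. by case: a b => ? ? [? ?]. Qed.

Lemma col_eqP n (u v : 'cV[R[i]]_n) : (forall i, complex.Re (u i 0) = complex.Re (v i 0)
   /\ complex.Im (u i 0) = complex.Im (v i 0)) -> u = v.
Proof.
move=> h; apply/matrixP => i j; rewrite (ord1 j); have [] := h i.
by case: (u i 0) (v i 0) => a b [a' b'] /= -> ->.
Qed.

Lemma sqnorm_eq0 n (v : 'cV[R[i]]_n) : sqnorm v = 0 -> v = 0.
Proof.
rewrite sqnormE => /eqP; rewrite psumr_eq0 => [/allP h|i _]; last first.
  by rewrite addr_ge0 ?sqr_ge0.
apply: col_eqP => i; have := h i (mem_index_enum _).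
rewrite paddr_eq0 ?sqr_ge0 // !sqrf_eq0 => /andP[/eqP -> /eqP ->].
by rewrite mxE.
Qed.

Lemma sqnorm0 n : sqnorm (0 : 'cV[R[i]]_n) = 0.
Proof. by rewrite sqnormE big1 // => i _; rewrite mxE /= expr0n addr0. Qed.

Lemma adjmxZ m n (a : R[i]) (A : 'M[R[i]]_(m, n)) : (a *: A) ^t* = Num.conj a *: A ^t*.
Proof. by apply/matrixP => i j; rewrite !mxE rmorphM. Qed.

Lemma adjmxM m n p (A : 'M[R[i]]_(m, n)) (B : 'M[R[i]]_(n, p)) :
  (A *m B) ^t* = B ^t* *m A ^t*.
Proof. by rewrite trmx_mul map_mxM. Qed.
Lemma adjmxK m n (A : 'M[R[i]]_(m, n)) : (A ^t*) ^t* = A.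
Proof. by apply/matrixP => i j; rewrite !mxE conjCK. Qed.

Section dot.
Context (n : nat) (A : 'M[R[i]]_n).
Implicit Types u v w : 'cV[R[i]]_n.

Lemma hdotDl u v w : hdot A (u + v) w = hdot A u w + hdot A v w.
Proof. by rewrite /hdot linearD /= map_mxD !mulmxDl mxE ReD. Qed.
Lemma hdotDr u v w : hdot A u (v + w) = hdot A u v + hdot A u w.
Proof. by rewrite /hdot mulmxDr mxE ReD. Qed.
Lemma hdotZl (a : R) u v : hdot A (a%:C *: u) v = a * hdot A u v.
Proof.
rewrite /hdot adjmxZ -!scalemxAl mxE.
by case: ((_ *m v) 0 0) => x y /=; rewrite oppr0 mul0r subr0.
Qed.
Lemma hdotZr (a : R) u v : hdot A u (a%:C *: v) = a * hdot A u v.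
Proof.
rewrite /hdot -!scalemxAr mxE.
by case: ((_ *m v) 0 0) => x y /=; rewrite mul0r subr0.
Qed.
Lemma hdotNl u v : hdot A (- u) v = - hdot A u v.
Proof.
have -> : - u = (-1 : R)%:C *: u by rewrite rmorphN1 scaleN1r.
by rewrite hdotZl mulN1r.
Qed.
Lemma hdotNr u v : hdot A u (- v) = - hdot A u v.
Proof.
have -> : - v = (-1 : R)%:C *: v by rewrite rmorphN1 scaleN1r.
by rewrite hdotZr mulN1r.
Qed.
Lemma hdotZZ a u : hdot A (a *: u) (a *: u) =
  (complex.Re a ^+ 2 + complex.Im a ^+ 2) * hdot A u u.
Proof.
rewrite /hdot adjmxZ -!scalemxAl -!scalemxAr scalerA mxE.
move: ((_ *m u) 0 0) => [x y]; case: a => a b /=; ring.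
Qed.
Lemma hdotC u v : A ^t* = A -> hdot A u v = hdot A v u.
Proof.
move=> hA; rewrite /hdot.
have -> : (v ^t* *m A *m u) 0 0 = ((u ^t* *m A *m v) ^t*) 0 0.
  by rewrite !adjmxM hA adjmxK mulmxA.
by rewrite !mxE; case: (\sum_j _).
Qed.
End dot.

Lemma sqnorm_hdot n (u : 'cV[R[i]]_n) : sqnorm u = hdot 1%:M u u.
Proof. by rewrite /hdot mulmx1. Qed.

Definition herm_bounds n (m M : R) (A : 'M[R[i]]_n) : Prop :=
  (forall u v, hdot A u v = hdot A v u) /\
  (forall u, m * sqnorm u <= hdot A u u <= M * sqnorm u).

Lemma herm_boundsP n (m M : R) (A : 'M[R[i]]_n) : A ^t* = A ->
  (forall xi : 'cV[R[i]]_n, m%:C * (sqnorm xi)%:C <= (xi ^t* *m A *m xi) 0 0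
                              <= M%:C * (sqnorm xi)%:C) ->
  herm_bounds m M A.
Proof.
move=> hA hb; split=> [u v|u]; first exact: hdotC.
have := hb u; rewrite -!rmorphM /= !lecE /=.
by move=> /andP[/andP[_ ->] /andP[_ ->]].
Qed.

Definition hdotE n := (@hdotDl n, @hdotDr n, @hdotNl n, @hdotNr n).

(** Expand the nonnegative values of the form at u + v and at u - v. *)
Lemma hdot_abs_le n m M (A : 'M[R[i]]_n) u v : 0 <= m -> herm_bounds m M A ->
  `|hdot A u v| <= M * (sqnorm u + sqnorm v).
Proof.
move=> m0 [hC hb].
have hp w : 0 <= hdot A w w.
  by have /andP[h _] := hb w; apply: le_trans h; rewrite mulr_ge0 // sqnorm_ge0.
have := hp (u + v); have := hp (u - v); rewrite !hdotE (hC v u).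
have /andP[_ h1] := hb u; have /andP[_ h2] := hb v.
have := hp u; have := hp v; rewrite ler_norml mulrDr; move: h1 h2.
move: (hdot A u u) (hdot A v v) (hdot A u v) (M * sqnorm u) (M * sqnorm v).
by move=> a b e p q; lra.
Qed.

Lemma herm_bounds1 n : herm_bounds 1 1 (1%:M : 'M[R[i]]_n).
Proof.
split=> [u v|u]; last by rewrite -sqnorm_hdot mul1r lexx.
apply: hdotC; apply/matrixP => i j; rewrite !mxE eq_sym.
by case: (_ == _); rewrite ?rmorph1 ?rmorph0.
Qed.

Definition cmeasurable (h : R -> R[i]) : Prop :=
  measurable_fun I (fun z => complex.Re (h z)) /\
  measurable_fun I (fun z => complex.Im (h z)).

Lemma cmeasurableD f g : cmeasurable f -> cmeasurable g -> cmeasurable (fun z => f z + g z).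
Proof.
move=> [f1 f2] [g1 g2]; split.
  rewrite (_ : (fun z => _) = (fun z => complex.Re (f z) + complex.Re (g z))).
    exact: measurable_funD.
  by apply/funext => z; case: (f z) (g z) => ? ? [? ?].
rewrite (_ : (fun z => _) = (fun z => complex.Im (f z) + complex.Im (g z))).
  exact: measurable_funD.
by apply/funext => z; case: (f z) (g z) => ? ? [? ?].
Qed.
Lemma cmeasurableM f g : cmeasurable f -> cmeasurable g -> cmeasurable (fun z => f z * g z).
Proof.
move=> [f1 f2] [g1 g2]; split.
  rewrite (_ : (fun z => _) = (fun z => complex.Re (f z) * complex.Re (g z)
    - complex.Im (f z) * complex.Im (g z))).
    by apply: measurable_funB; exact: measurable_funM.
  by apply/funext => z; case: (f z) (g z) => ? ? [? ?].
rewrite (_ : (fun z => _) = (fun z => complex.Re (f z) * complex.Im (g z)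
    + complex.Im (f z) * complex.Re (g z))).
  by apply: measurable_funD; exact: measurable_funM.
by apply/funext => z; case: (f z) (g z) => ? ? [? ?].
Qed.
Lemma cmeasurable_cst c : cmeasurable (fun=> c).
Proof. by split. Qed.
Lemma cmeasurable_conj f : cmeasurable f -> cmeasurable (fun z => Num.conj (f z)).
Proof.
move=> [f1 f2]; split.
  rewrite (_ : (fun z => _) = (fun z => complex.Re (f z))) //.
  by apply/funext => z; case: (f z).
rewrite (_ : (fun z => _) = (fun z => - complex.Im (f z))).
  by apply: measurableT_comp => //.
by apply/funext => z; case: (f z).
Qed.
Lemma cmeasurable_sum (J : Type) (s : seq J) (F : J -> R -> R[i]) :
  (forall j, cmeasurable (F j)) -> cmeasurable (fun z => \sum_(j <- s) F j z).
Proof.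
move=> hF; elim: s => [|j s IH].
  by under eq_fun do rewrite big_nil; exact: cmeasurable_cst.
by under eq_fun do rewrite big_cons; exact: cmeasurableD.
Qed.
Lemma entrywise_mulmx m n p (F : R -> 'M[R[i]]_(m, n)) (G : R -> 'M[R[i]]_(n, p)) :
  entrywise (measurable_fun I) F -> entrywise (measurable_fun I) G ->
  entrywise (measurable_fun I) (fun z => F z *m G z).
Proof.
move=> hF hG i j; rewrite -/(cmeasurable (fun z => (F z *m G z) i j)).
under eq_fun do rewrite mxE.
by apply: cmeasurable_sum => k; apply: cmeasurableM; [exact: hF|exact: hG].
Qed.
Lemma entrywise_adj m n (F : R -> 'M[R[i]]_(m, n)) :
  entrywise (measurable_fun I) F -> entrywise (measurable_fun I) (fun z => (F z) ^t*).
Proof.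
move=> hF i j; rewrite -/(cmeasurable (fun z => ((F z) ^t*) i j)).
by under eq_fun do rewrite !mxE; apply: cmeasurable_conj; exact: hF.
Qed.
Lemma entrywise_cst m n (A : 'M[R[i]]_(m, n)) :
  entrywise (measurable_fun I) (fun=> A).
Proof. by move=> i j; exact: cmeasurable_cst. Qed.
Lemma measurable_hdot n (F : R -> 'M[R[i]]_n) (f g : R -> 'cV[R[i]]_n) :
  entrywise (measurable_fun I) F -> entrywise (measurable_fun I) f ->
  entrywise (measurable_fun I) g -> measurable_fun I (fun z => hdot (F z) (f z) (g z)).
Proof.
move=> hF hf hg.
have [] // := entrywise_mulmx (entrywise_mulmx (entrywise_adj hf) hF) hg 0 0.
Qed.
Lemma measurable_sqnorm01 n (f : R -> 'cV[R[i]]_n) :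
  entrywise (measurable_fun I) f -> measurable_fun I (fun z => sqnorm (f z)).
Proof. by move=> /measurable_sqnorm /measurable_EFinP. Qed.

Lemma isL2P d (f : R -> 'cV[R[i]]_d) : isL2 f <->
  entrywise (measurable_fun I) f /\ integrable01 (fun z => sqnorm (f z)).
Proof.
split=> -[mf hf]; split=> //.
  apply/integrableP; split; first exact: measurable_sqnorm.
  apply: le_lt_trans hf; rewrite le_eqVlt; apply/orP; left; apply/eqP.
  by apply: eq_integral => z _; rewrite gee0_abs // lee_fin sqnorm_ge0.
move/integrableP: hf => [_]; apply: le_lt_trans.
rewrite le_eqVlt; apply/orP; left; apply/eqP.
by apply: eq_integral => z _; rewrite gee0_abs // lee_fin sqnorm_ge0.
Qed.

Lemma isL2_entries d (f : R -> 'cV[R[i]]_d) : isL2 f <->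
  forall i, L2r (fun z => complex.Re (f z i 0)) /\ L2r (fun z => complex.Im (f z i 0)).
Proof.
split=> [/isL2P[mf hf] i|hf].
  have le1 z : complex.Re (f z i 0) ^+ 2 + complex.Im (f z i 0) ^+ 2 <= sqnorm (f z).
    by rewrite sqnormE (bigD1 i) //= lerDl sumr_ge0 // => j _; rewrite addr_ge0 ?sqr_ge0.
  have [m1 m2] := mf i 0.
  split; split=> //; apply: integrable01_le hf; try exact: measurable_funX.
    move=> z _; rewrite ger0_norm ?sqr_ge0 //; apply: le_trans (le1 z).
    by rewrite lerDl sqr_ge0.
  move=> z _; rewrite ger0_norm ?sqr_ge0 //; apply: le_trans (le1 z).
  by rewrite lerDr sqr_ge0.
apply/isL2P; split.
  by move=> i j; rewrite (ord1 j); have [[? _] [? _]] := hf i.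
under eq_fun do rewrite sqnormE.
apply: integrable01_sum => i; have [[_ h1] [_ h2]] := hf i.
exact: integrable01D.
Qed.

Lemma isL2_lin d (a : R[i]) (f g : R -> 'cV[R[i]]_d) : isL2 f -> isL2 g ->
  isL2 (fun z => a *: f z + g z).
Proof.
move=> hf hg; have [_ h] := L2pred_submod R d.
by have := h a f g (asboolT hf) (asboolT hg) => /asboolP.
Qed.
Lemma isL2_0 d : isL2 (fun _ : R => 0 : 'cV[R[i]]_d).
Proof. by have [h _] := L2pred_submod R d; move: h => /asboolP. Qed.
Lemma isL2D d (f g : R -> 'cV[R[i]]_d) : isL2 f -> isL2 g ->
  isL2 (fun z => f z + g z).
Proof.
by move=> hf hg; have := isL2_lin 1 hf hg; under eq_fun do rewrite scale1r.
Qed.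
Lemma isL2Z d a (f : R -> 'cV[R[i]]_d) : isL2 f -> isL2 (fun z => a *: f z).
Proof.
move=> hf; have := isL2_lin a hf (isL2_0 d).
by under eq_fun do rewrite addr0.
Qed.
Lemma isL2B d (f g : R -> 'cV[R[i]]_d) : isL2 f -> isL2 g ->
  isL2 (fun z => f z - g z).
Proof.
move=> hf hg; have := isL2_lin (-1) hg hf.
by under eq_fun do rewrite scaleN1r addrC.
Qed.
Lemma isL2_sum d (J : Type) (s : seq J) (F : J -> R -> 'cV[R[i]]_d) :
  (forall j, isL2 (F j)) -> isL2 (fun z => \sum_(j <- s) F j z).
Proof.
move=> hF; elim: s => [|j s IH].
  by under eq_fun do rewrite big_nil; exact: isL2_0.
by under eq_fun do rewrite big_cons; exact: isL2D.
Qed.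
End complex_vectors.

Section L2_classes.
Context (R : realType) (d : nat).
Local Notation I := (unit_itv R).
Local Notation X := (L2space R d).
Local Notation fT := (R -> 'cV[R[i]]_d).
Implicit Types (x y : X) (f g : fT).
Local Open Scope quotient_scope.

Lemma L2val_isL2 (f : L2fun R d) : isL2 (L2val f).
Proof. by case: f => f hf; apply/asboolP. Qed.
Lemma L2repr_isL2 x : isL2 (L2repr x). Proof. exact: L2val_isL2. Qed.

Lemma L2pi_eq (f g : L2fun R d) :
  (\pi_(L2space R d) f = \pi_(L2space R d) g) <-> ae01 (fun z => f z = g z).
Proof.
split=> [/eqP|fg].
  rewrite -ring_quotient.Quotient.idealrBE => /asboolP; apply: ae01S => z _ h.
  by apply/eqP; rewrite -subr_eq0; apply/eqP.
apply/eqP; rewrite -ring_quotient.Quotient.idealrBE; apply/asboolP.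
apply: (ae01S _ fg) => z _ h.
by transitivity (f z - g z) => //; rewrite h subrr.
Qed.

Lemma L2reprK x : \pi_(L2space R d) (repr x : L2fun R d) = x.
Proof. exact: reprK. Qed.

Lemma L2eqP x y : x = y <-> ae01 (fun z => L2repr x z = L2repr y z).
Proof.
split=> [->|h]; first by apply: ae01W.
by rewrite -(L2reprK x) -(L2reprK y); apply/L2pi_eq.
Qed.

Lemma L2classE f : isL2 f -> ae01 (fun z => L2repr (L2class f) z = f z).
Proof.
move=> hf; rewrite /L2repr /L2class.
set g := insubd _ f; have gf : L2val g = f by rewrite insubdK //; exact/asboolP.
have := L2reprK (\pi_(L2space R d) g); move/L2pi_eq; apply: ae01S => z _ ->.
by rewrite gf.
Qed.

Lemma L2class_eq x f : isL2 f -> ae01 (fun z => L2repr x z = f z) -> L2class f = x.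
Proof.
move=> hf h; apply/L2eqP; apply: (ae01S2 _ (L2classE hf) h) => z h1 h2.
by rewrite h1 h2.
Qed.
Lemma L2class_repr x : L2class (L2repr x) = x.
Proof. by apply: L2class_eq; [exact: L2repr_isL2|apply: ae01W]. Qed.
Lemma L2class_ae f g : isL2 f -> isL2 g -> ae01 (fun z => f z = g z) ->
  L2class f = L2class g.
Proof.
move=> hf hg fg; apply: L2class_eq => //.
by apply: (ae01S2 _ (L2classE hg) fg) => z -> ->.
Qed.

Lemma L2reprD x y : ae01 (fun z => L2repr (x + y) z = L2repr x z + L2repr y z).
Proof.
have : x + y = \pi_(L2space R d) ((repr x : L2fun R d) + (repr y : L2fun R d)).
  rewrite -[in LHS](L2reprK x) -[in LHS](L2reprK y).
  have piD := @ring_quotient.Quotient.pi_add _ (@L2null R d).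
  by rewrite -[LHS]/(ring_quotient.Quotient.add _ _) -piD.
by rewrite -{1}(L2reprK (x + y)) => /L2pi_eq; apply: ae01S => z _ h; rewrite /L2repr h.
Qed.
Lemma L2reprZ a x : ae01 (fun z => L2repr (a *: x) z = a *: L2repr x z).
Proof.
have : a *: x = \pi_(L2space R d) (a *: (repr x : L2fun R d)).
  by rewrite -[in LHS](L2reprK x); exact: pi_L2scale.
by rewrite -{1}(L2reprK (a *: x)) => /L2pi_eq; apply: ae01S => z _ h; rewrite /L2repr h.
Qed.
Lemma L2repr0 : ae01 (fun z => L2repr (0 : X) z = 0).
Proof.
have := L2reprZ 0 0; apply: ae01S => z _; by rewrite !scale0r.
Qed.
Lemma L2reprN x : ae01 (fun z => L2repr (- x) z = - L2repr x z).
Proof. by have := L2reprZ (-1) x; rewrite scaleN1r; apply: ae01S => z _ ->; rewrite scaleN1r. Qed.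
Lemma L2reprB x y : ae01 (fun z => L2repr (x - y) z = L2repr x z - L2repr y z).
Proof. by apply: (ae01S2 _ (L2reprD x (- y)) (L2reprN y)) => z -> ->. Qed.

Lemma L2class_lin a f g : isL2 f -> isL2 g ->
  L2class (fun z => a *: f z + g z) = a *: L2class f + L2class g.
Proof.
move=> hf hg; apply: L2class_eq; first exact: isL2_lin.
have h1 := ae01S2 (fun z p q => conj p q) (L2reprD (a *: L2class f) (L2class g)) (L2reprZ a (L2class f)).
have h2 := ae01S2 (fun z p q => conj p q) (L2classE hf) (L2classE hg).
by apply: (ae01S2 _ h1 h2) => z [-> ->] [-> ->].
Qed.
End L2_classes.

Fact rform_key : unit. Proof. by []. Qed.
(** Locked, as is [sqn], so that two classes are never compared by unfolding
    them to representatives. *)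
Definition rform (R : realType) d (H : R -> 'M[R[i]]_d) : L2space R d -> L2space R d -> R :=
  locked_with rform_key (fun x y => complex.Re (inner_H H x y)).
Definition sqn (R : realType) d : L2space R d -> R :=
  locked_with rform_key (fun x => integral01 (fun z => sqnorm (L2repr x z))).

Lemma rform_inner (R : realType) d (H : R -> 'M[R[i]]_d) (x y : L2space R d) :
  rform H x y = complex.Re (inner_H H x y).
Proof. by rewrite /rform locked_withE. Qed.
Lemma rformE (R : realType) d (H : R -> 'M[R[i]]_d) (x y : L2space R d) :
  rform H x y = integral01 (fun z => hdot (H z) (L2repr x z) (L2repr y z)).
Proof. by rewrite rform_inner. Qed.
Lemma sqnE (R : realType) d (x : L2space R d) :
  sqn x = integral01 (fun z => sqnorm (L2repr x z)).
Proof. by rewrite /sqn locked_withE. Qed.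

Lemma integral_sqnormD_le (R : realType) d (f g : R -> 'cV[R[i]]_d) :
  isL2 f -> isL2 g ->
  integral01 (fun z => sqnorm (f z + g z)) <=
  2 * integral01 (fun z => sqnorm (f z)) + 2 * integral01 (fun z => sqnorm (g z)).
Proof.
move=> hf hg; have /isL2P[_ f2] := hf; have /isL2P[_ g2] := hg.
have h1 := integrable01Z 2 f2; have h2 := integrable01Z 2 g2.
rewrite -(integral01Z 2 f2) -(integral01Z 2 g2) -(integral01D h1 h2).
apply: integral01_le.
- by have /isL2P[] := isL2D hf hg.
- exact: integrable01D.
- move=> z _; have := sqnorm_lin 1 (f z) (g z).
  by rewrite scale1r /= expr1n expr0n addr0.
Qed.

Section weighted_L2.
Context (R : realType) (d : nat).
Local Notation I := (unit_itv R).
Local Notation X := (L2space R d).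
Local Notation fT := (R -> 'cV[R[i]]_d).
Implicit Types (x y : X) (f g : fT).

Definition weight (m M : R) (H : R -> 'M[R[i]]_d) : Prop :=
  [/\ entrywise (measurable_fun I) H, 0 < m & ae01 (fun z => herm_bounds m M (H z))].

Context (m M : R) (H : R -> 'M[R[i]]_d) (hH : weight m M H).

Let mH : entrywise (measurable_fun I) H. Proof. by case: hH. Qed.
Let m0 : 0 < m. Proof. by case: hH. Qed.
Let bH : ae01 (fun z => herm_bounds m M (H z)). Proof. by case: hH. Qed.

Lemma integrable_hdot f g : isL2 f -> isL2 g ->
  integrable01 (fun z => hdot (H z) (f z) (g z)).
Proof.
move=> /isL2P[mf hf] /isL2P[mg hg].
apply: (@integrable01_le_ae _ _ (fun z => M * (sqnorm (f z) + sqnorm (g z)))).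
- exact: measurable_hdot.
- by apply: (ae01S _ bH) => z _ hz; apply: hdot_abs_le hz; exact: ltW.
- by apply: integrable01Z; exact: integrable01D.
Qed.

Lemma rform_ae x y f g : isL2 f -> isL2 g ->
  ae01 (fun z => L2repr x z = f z) -> ae01 (fun z => L2repr y z = g z) ->
  rform H x y = integral01 (fun z => hdot (H z) (f z) (g z)).
Proof.
move=> hf hg xf yg; rewrite rformE; apply: integral01_ae.
- by apply: integrable01_measurable; apply: integrable_hdot; exact: L2repr_isL2.
- by apply: integrable01_measurable; exact: integrable_hdot.
- by apply: (ae01S2 _ xf yg) => z -> ->.
Qed.
Lemma rform_class f g : isL2 f -> isL2 g ->
  rform H (L2class f) (L2class g) = integral01 (fun z => hdot (H z) (f z) (g z)).
Proof. by move=> hf hg; apply: rform_ae => //; exact: L2classE. Qed.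

Lemma sqn_ae x f : isL2 f -> ae01 (fun z => L2repr x z = f z) ->
  sqn x = integral01 (fun z => sqnorm (f z)).
Proof.
move=> hf xf; rewrite sqnE; apply: integral01_ae.
- by apply: measurable_sqnorm01; have /isL2P[] := L2repr_isL2 x.
- by apply: measurable_sqnorm01; have /isL2P[] := hf.
- by apply: (ae01S _ xf) => z _ ->.
Qed.

Lemma integrable_sqn x : integrable01 (fun z => sqnorm (L2repr x z)).
Proof. by have /isL2P[] := L2repr_isL2 x. Qed.

Lemma sqn_ge0 x : 0 <= sqn x.
Proof. by rewrite sqnE; apply: integral01_ge0 => z _; exact: sqnorm_ge0. Qed.

Lemma rform_bounds x : m * sqn x <= rform H x x <= M * sqn x.
Proof.
have h1 := integrable_hdot (L2repr_isL2 x) (L2repr_isL2 x).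
have h2 := integrable_sqn x; rewrite rformE.
rewrite sqnE -(integral01Z m h2) -(integral01Z M h2).
have h3 := integrable01Z m h2; have h4 := integrable01Z M h2.
apply/andP; split; apply: integral01_le_ae => //.
- by apply: (ae01S _ bH) => z _ [_ /(_ (L2repr x z)) /andP[]].
- by apply: (ae01S _ bH) => z _ [_ /(_ (L2repr x z)) /andP[]].
Qed.

Lemma sqnD_le x y : sqn (x + y) <= 2 * sqn x + 2 * sqn y.
Proof.
have hx := L2repr_isL2 x; have hy := L2repr_isL2 y.
by rewrite (sqn_ae (isL2D hx hy) (L2reprD x y)) !sqnE; exact: integral_sqnormD_le.
Qed.

Lemma sqn_eq0 x : sqn x = 0 -> x = 0.
Proof.
rewrite sqnE => h; apply/L2eqP.
have := integral01_eq0 (integrable_sqn x) (fun z _ => sqnorm_ge0 _) h.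
by apply: (ae01S2 _ (L2repr0 R d)) => z -> /sqnorm_eq0.
Qed.

Lemma rformDl x y z : rform H (x + y) z = rform H x z + rform H y z.
Proof.
have hx := L2repr_isL2 x; have hy := L2repr_isL2 y; have hz := L2repr_isL2 z.
rewrite (rform_ae (isL2D hx hy) hz (L2reprD x y) (ae01W (fun _ _ => erefl))).
under eq_integral01 do rewrite hdotDl.
by rewrite (integral01D (integrable_hdot hx hz) (integrable_hdot hy hz)) (rformE H x z) (rformE H y z).
Qed.
Lemma rformC x y : rform H x y = rform H y x.
Proof.
rewrite !rformE; apply: integral01_ae; try by apply: integrable01_measurable; apply: integrable_hdot; exact: L2repr_isL2.
by apply: (ae01S _ bH) => z _ [hC _]; rewrite -/(hdot _ _ _) hC.
Qed.
Lemma rformZl (a : R) x y : rform H (a%:C *: x) y = a * rform H x y.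
Proof.
have hx := L2repr_isL2 x; have hy := L2repr_isL2 y.
rewrite (rform_ae (isL2Z _ hx) hy (L2reprZ _ x) (ae01W (fun _ _ => erefl))).
under eq_integral01 do rewrite hdotZl.
by rewrite (integral01Z _ (integrable_hdot hx hy)) -rformE.
Qed.
Lemma rformZZ a x : rform H (a *: x) (a *: x) =
  (complex.Re a ^+ 2 + complex.Im a ^+ 2) * rform H x x.
Proof.
have hx := L2repr_isL2 x.
rewrite (rform_ae (isL2Z _ hx) (isL2Z _ hx) (L2reprZ _ x) (L2reprZ _ x)).
under eq_integral01 do rewrite hdotZZ.
by rewrite (integral01Z _ (integrable_hdot hx hx)) -rformE.
Qed.
Lemma rform_ge0 x : 0 <= rform H x x.
Proof.
have /andP[h _] := rform_bounds x; apply: le_trans h.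
by rewrite mulr_ge0 ?sqn_ge0 // ltW.
Qed.
Lemma rform_eq0 x : rform H x x = 0 -> x = 0.
Proof.
move=> h; apply: sqn_eq0; apply/eqP; rewrite eq_le sqn_ge0 andbT.
have /andP[h1 _] := rform_bounds x.
by rewrite -(ler_pM2l m0) mulr0 -h.
Qed.

Lemma sqn_entries x f : isL2 f ->
  sqn (x - L2class f) = \sum_i
    (integral01 (fun z => (complex.Re (f z i 0) - complex.Re (L2repr x z i 0)) ^+ 2)
    + integral01 (fun z => (complex.Im (f z i 0) - complex.Im (L2repr x z i 0)) ^+ 2)).
Proof.
move=> hf; have hx := L2repr_isL2 x.
have hxf := isL2B hx hf.
rewrite (sqn_ae hxf); last first.
  by apply: (ae01S2 _ (L2reprB x (L2class f)) (L2classE hf)) => z -> ->.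
have hi i : integrable01 (fun z => (complex.Re (f z i 0) - complex.Re (L2repr x z i 0)) ^+ 2)
    /\ integrable01 (fun z => (complex.Im (f z i 0) - complex.Im (L2repr x z i 0)) ^+ 2).
  have [h1 h2] := (isL2_entries f).1 hf i.
  have [h3 h4] := (isL2_entries _).1 hx i.
  by have [_ ?] := L2rB h1 h3; have [_ ?] := L2rB h2 h4.
under eq_bigr => i _ do rewrite -(integral01D (hi i).1 (hi i).2).
rewrite -integral01_sum; last by move=> i; apply: integrable01D; have [] := hi i.
apply: eq_integral01 => z _; rewrite sqnormE; apply: eq_bigr => i _.
rewrite !mxE; case: (L2repr x z i 0) (f z i 0) => a b [p q] /=.
by rewrite -(sqrrN (a - p)) -(sqrrN (b - q)) !opprB.
Qed.

Lemma sqn_entry_le x y i :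
  integral01 (fun z => (complex.Re (L2repr x z i 0) - complex.Re (L2repr y z i 0)) ^+ 2)
    <= sqn (y - x) /\
  integral01 (fun z => (complex.Im (L2repr x z i 0) - complex.Im (L2repr y z i 0)) ^+ 2)
    <= sqn (y - x).
Proof.
have := sqn_entries y (L2repr_isL2 x); rewrite L2class_repr => ->.
rewrite (bigD1 i) //=; set a := integral01 _; set b := integral01 _.
have a0 : 0 <= a by apply: integral01_ge0 => z _; exact: sqr_ge0.
have b0 : 0 <= b by apply: integral01_ge0 => z _; exact: sqr_ge0.
set s := \sum_(_ | _) _.
have s0 : 0 <= s.
  by apply: sumr_ge0 => j _; apply: addr_ge0; apply: integral01_ge0 => z _; exact: sqr_ge0.
by lra.
Qed.

(** Extract a subsequence whose increments are at most 8^-k, take limits entry by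
    entry with [fast_cauchy_L2], and return to the full sequence by the Cauchy
    property. *)
Lemma rform_complete (u : nat -> X) :
  (forall e, 0 < e -> exists n0, forall n k, (n0 <= n)%N -> (n0 <= k)%N ->
      form_norm (rform H) (u n - u k) <= e) ->
  exists l, form_norm (rform H) (u n - l) @[n --> \oo] --> (0 : R).
Proof.
move=> hu.
have hs e : 0 < e -> exists n0, forall n k, (n0 <= n)%N -> (n0 <= k)%N -> sqn (u n - u k) <= e.
  move=> e0; have me : 0 < Num.sqrt (m * e) by rewrite sqrtr_gt0 mulr_gt0.
  have [n0 hn] := hu _ me; exists n0 => n k n0n n0k.
  have := hn n k n0n n0k; rewrite ler_sqrt ?mulr_ge0 ?(ltW m0) ?(ltW e0) //.
  have /andP[h _] := rform_bounds (u n - u k).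
  by move=> /(le_trans h); rewrite ler_pM2l.
have e8 k : (0 : R) < 8^-1 ^+ k by rewrite exprn_gt0.
have /choice [phi0 hphi0] := fun k => hs _ (e8 k).
(* the maximum makes [phi] nondecreasing, the summand [k] makes it unbounded *)
pose phi k := (\max_(j < k.+1) phi0 j + k)%N.
have phi_ge k : (phi0 k <= phi k)%N.
  apply: leq_trans (leq_addr _ _).
  exact: (leq_bigmax_cond (F := fun j : 'I_k.+1 => phi0 j) (ord_max : 'I_k.+1)).
have phi_mono k : (phi k <= phi k.+1)%N.
  by rewrite /phi (big_ord_recr k.+1) /= leq_add ?leq_maxl.
have fast k : sqn (u (phi k) - u (phi k.+1)) <= 8^-1 ^+ k.
  by apply: hphi0; rewrite ?phi_ge // (leq_trans (phi_ge k)).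
have hL i : (forall k, L2r (fun z => complex.Re (L2repr (u (phi k)) z i 0))) /\
            (forall k, L2r (fun z => complex.Im (L2repr (u (phi k)) z i 0))).
  by split=> k; have [] := (isL2_entries _).1 (L2repr_isL2 (u (phi k))) i.
have hr i := fast_cauchy_L2 (hL i).1 (fun k => le_trans (sqn_entry_le _ _ i).1 (fast k)).
have hi i := fast_cauchy_L2 (hL i).2 (fun k => le_trans (sqn_entry_le _ _ i).2 (fast k)).
have [vr hvr] := choice hr; have [vi hvi] := choice hi.
have [Cr hCr] := choice hvr; have [Ci hCi] := choice hvi.
pose f z : 'cV[R[i]]_d := \col_i (vr i z +i* vi i z).
have hf : isL2 f.
  apply/isL2_entries => i; split.
    have [h _] := hCr i; rewrite (_ : (fun z => _) = vr i) //.
    by apply/funext => z; rewrite mxE.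
  have [h _] := hCi i; rewrite (_ : (fun z => _) = vi i) //.
  by apply/funext => z; rewrite mxE.
pose C := \sum_i (Cr i + Ci i).
have hC k : sqn (u (phi k) - L2class f) <= C * 4^-1 ^+ k.
  rewrite sqn_entries // /C mulr_suml; apply: ler_sum => i _; rewrite mulrDl.
  apply: lerD.
    have [_ /(_ k)] := hCr i; apply: le_trans; rewrite le_eqVlt; apply/orP; left.
    by apply/eqP/eq_integral01 => z _; rewrite mxE.
  have [_ /(_ k)] := hCi i; apply: le_trans; rewrite le_eqVlt; apply/orP; left.
  by apply/eqP/eq_integral01 => z _; rewrite mxE.
exists (L2class f); apply/cvg0P; first by move=> n; exact: sqrtr_ge0.
move=> e e0.
have M1 : 0 < `|M| + 1 by apply: ltr_wpDl.
pose e1 := e ^+ 2 / (4 * (`|M| + 1)).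
have e10 : 0 < e1 by rewrite divr_gt0 ?exprn_gt0 // mulr_gt0.
have c4 : C * 4^-1 ^+ k @[k --> \oo] --> (0 : R) by apply: cvg_geo; lra.
have p4 k : 0 <= C * 4^-1 ^+ k by apply: le_trans (hC k); exact: sqn_ge0.
have [k0 hk0] := (cvg0P p4).1 c4 e1 e10.
have [n0 hn0] := hs e1 e10.
pose k := maxn k0 n0.
have hk : sqn (u (phi k) - L2class f) <= e1.
  by apply: (le_trans (hC k)); apply: hk0; exact: leq_maxl.
exists n0 => n n0n.
have n0k : (n0 <= phi k)%N by rewrite (leq_trans (leq_maxr k0 n0)) // leq_addl.
have h1 := sqnD_le (u n - u (phi k)) (u (phi k) - L2class f).
rewrite addrA subrK in h1; have h2 := hn0 _ _ n0n n0k.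
have h3 : sqn (u n - L2class f) <= 4 * e1 by lra.
rewrite -(ger0_norm (ltW e0)) -sqrtr_sqr ler_sqrt ?sqr_ge0 //.
have /andP[_ h4] := rform_bounds (u n - L2class f).
apply: (le_trans h4); apply: (@le_trans _ _ ((`|M| + 1) * sqn (u n - L2class f))).
  by apply: ler_wpM2r; [exact: sqn_ge0|rewrite ler_wpDr // ler_norm].
have -> : e ^+ 2 = (`|M| + 1) * (4 * e1) by rewrite /e1; field; rewrite gt_eqF.
by rewrite ler_pM2l.
Qed.

Theorem rform_hilbert : hilbert_form (rform H).
Proof.
split; [exact: rformDl|exact: rformC|exact: rformZl|exact: rformZZ|exact: rform_ge0
  |exact: rform_eq0|exact: rform_complete].
Qed.
End weighted_L2.

(** * Primitives and the weighted Volterra estimate *)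

Section primitive.
Context (R : realType).
Local Notation mu := (@lebesgue_measure R).
Local Notation I := (unit_itv R).
Implicit Types (u v a b : R -> R) (z s : R).

(** Written over the whole interval, so that the domain of integration does not
    depend on z. *)
Definition prim u z : R := integral01 (fun s => if s < z then u s else 0).

Lemma measurable_if (f : R -> bool) u : measurable_fun I f -> measurable_fun I u ->
  measurable_fun I (fun s => if f s then u s else 0).
Proof.
move=> mf mu'; apply: measurable_fun_if => //.
by apply: (@measurable_funS _ _ _ _ I) => // s [].
Qed.
Lemma measurable_below u z : measurable_fun I u ->
  measurable_fun I (fun s => if s < z then u s else 0).
Proof.
by move=> mu'; apply: measurable_if => //; apply: measurable_fun_ltr.
Qed.
Lemma integrable_below u z : integrable01 u ->
  integrable01 (fun s => if s < z then u s else 0).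
Proof.
move=> hu; have mu' := integrable01_measurable hu.
apply: (@integrable01_le _ _ (fun s => `|u s|)); first exact: measurable_below.
  by move=> s _; case: ifP; rewrite ?normr0.
exact: (integrable_norm hu).
Qed.
Lemma integrable_above a s : integrable01 a ->
  integrable01 (fun z => if s < z then a z else 0).
Proof.
move=> ha; have ma := integrable01_measurable ha.
apply: (@integrable01_le _ _ (fun s => `|a s|)).
- by apply: measurable_if => //; apply: measurable_fun_ltr.
- by move=> z _; case: ifP; rewrite ?normr0.
- exact: (integrable_norm ha).
Qed.

Lemma prim_lin (c : R) u v z : integrable01 u -> integrable01 v ->
  prim (fun s => c * u s + v s) z = c * prim u z + prim v z.
Proof.
move=> hu hv; rewrite /prim -integral01Z; last exact: integrable_below.
rewrite -integral01D; [|exact/integrable01Z/integrable_below|exact: integrable_below].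
by apply: eq_integral01 => s _; case: ifP; rewrite ?mulr0 ?addr0.
Qed.
Lemma prim_ae u v z : measurable_fun I u -> measurable_fun I v ->
  ae01 (fun s => u s = v s) -> prim u z = prim v z.
Proof.
move=> mu' mv uv; apply: integral01_ae; try exact: measurable_below.
by apply: (ae01S _ uv) => s _ ->.
Qed.
Lemma eq_prim u v z : (forall s, I s -> u s = v s) -> prim u z = prim v z.
Proof. by move=> uv; apply: eq_integral01 => s /uv ->. Qed.
Lemma prim_at0 u : prim u 0 = 0.
Proof.
rewrite -[RHS](integral01_cst (R := R)); apply: eq_integral01 => s.
by rewrite /unit_itv /= in_itv /= => /andP[s0 _]; rewrite ltNge ltW.
Qed.
Lemma prim_abs_le u z : integrable01 u -> `|prim u z| <= integral01 (fun s => `|u s|).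
Proof.
move=> hu; have hn : integrable01 (fun s => `|u s|) by exact: (integrable_norm hu).
apply: (@le_trans _ _ (integral01 (fun s => `|if s < z then u s else 0|))).
  apply: le_normr_Rintegral; [exact: measurable_itv|exact: integrable_below].
apply: integral01_le => //; first exact: (integrable_norm (integrable_below z hu)).
by move=> s _; case: ifP; rewrite ?normr0.
Qed.

Lemma prim_restrict u z : prim (u \_ I) z = prim u z.
Proof. by apply: eq_prim => s Is; rewrite patchE mem_set. Qed.
Lemma integrable_restrict u : integrable01 u -> mu.-integrable setT (EFin \o (u \_ I)).
Proof.
move=> hu; rewrite -restrict_EFin; by have [h _] := @integrable_mkcond _ _ _ mu I (EFin \o u) (measurable_itv _); exact: h.
Qed.

Lemma prim_parameterized u z : integrable01 u -> 0 <= z <= 1 ->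
  prim u z = parameterized_integral mu 0 z (u \_ I).
Proof.
move=> hu /andP[z0 z1]; have hr := integrable_restrict hu.
have hS (A : set R) : measurable A -> mu.-integrable A (EFin \o (u \_ I)).
  by move=> mA; apply: integrableS hr => //.
rewrite -prim_restrict /parameterized_integral /prim /integral01.
transitivity (\int[mu]_(s in `]0, z[) (u \_ I) s).
  rewrite (_ : `]0, z[%classic = I `&` `]-oo, z[%classic); last first.
    apply/seteqP; split=> s /=; rewrite /unit_itv /= !in_itv /=.
      by move=> /andP[-> sz]; rewrite sz (lt_le_trans sz).
    by move=> [/andP[-> _] ->].
  rewrite Rintegral_mkcondr; apply: eq_Rintegral => s _.
  by rewrite [RHS]patchE; case: (ltP s z) => sz;
    [rewrite mem_set // ; rewrite /= in_itv|rewrite memNset //= in_itv /= ltNge sz].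
rewrite Rintegral_itv_bndo_bndc; last exact: hS.
by rewrite Rintegral_itv_obnd_cbnd //; exact: hS.
Qed.

Lemma prim_continuous u : integrable01 u -> {within `[0, 1], continuous (prim u)}.
Proof.
move=> hu; have hr := integrable_restrict hu.
have : {within `[0, 1], continuous (fun x => parameterized_integral mu 0 x (u \_ I))}.
  by apply: parameterized_integral_continuous => //; apply: integrableS hr.
apply: subspace_eq_continuous => z /set_mem /=; rewrite in_itv /= => hz.
by apply/esym; exact: prim_parameterized.
Qed.

Lemma within_continuous_measurable u : {within `[0, 1], continuous u} -> measurable_fun I u.
Proof.
move=> hc; have h : measurable_fun (`[(0 : R), 1]%classic : set R) u.
  by apply: subspace_continuous_measurable_fun => //; exact: measurable_itv.
apply: measurable_funS h => //.
by move=> s; rewrite /unit_itv /= !in_itv /= => /andP[s0 s1]; rewrite !ltW.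
Qed.

Lemma prim_L2r u : integrable01 u -> L2r (prim u).
Proof.
move=> hu; apply: (L2r_le _ _ (L2r_cst (integral01 (fun s => `|u s|)))).
  by apply: within_continuous_measurable; exact: prim_continuous.
by move=> z _; apply: (le_trans (prim_abs_le z hu)); exact: ler_norm.
Qed.

(** Cauchy-Schwarz on (0, z), z <= 1: expand int_0^z (u - c)^2 >= 0 with
    c = int_0^z u. *)
Lemma prim_sqr_le u z : L2r u -> prim u z ^+ 2 <= prim (fun s => u s ^+ 2) z.
Proof.
move=> hu; have [mu' hu2] := hu; have hu1 := L2r_integrable hu.
pose c := prim u z.
have h1 := integrable_below z hu1; have h2 := integrable_below z hu2.
have : 0 <= integral01 (fun s => if s < z then (u s - c) ^+ 2 else 0).
  by apply: integral01_ge0 => s _; case: ifP => // _; exact: sqr_ge0.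
have hc2 : integrable01 (fun s => (if s < z then c ^+ 2 else 0)).
  by apply: integrable_below; exact: integrable01_cst.
rewrite (@eq_integral01 _ _ (fun s => ((if s < z then u s ^+ 2 else 0)
    - 2 * c * (if s < z then u s else 0)) + (if s < z then c ^+ 2 else 0))); last first.
  by move=> s _; case: ifP => // _; ring.
have h3 := integrable01Z (2 * c) h1; have h4 := integrable01B h2 h3.
rewrite (integral01D h4 hc2) (integral01B h2 h3) (integral01Z _ h1) -/(prim _ z) -/(prim u z) -/c.
have : integral01 (fun s => (if s < z then c ^+ 2 else 0)) <= c ^+ 2.
  rewrite -[leRHS](integral01_cst (R := R)); apply: integral01_le => //.
    exact: integrable01_cst.
  by move=> s _; case: ifP => // _; exact: sqr_ge0.
by rewrite -/(prim (fun s => u s ^+ 2) z); nra.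
Qed.

(** Fubini on the triangle s < z. *)
Lemma triangle_swap a b : integrable01 a -> integrable01 b ->
  integral01 (fun z => a z * prim b z) =
  integral01 (fun s => b s * integral01 (fun z => if s < z then a z else 0)).
Proof.
move=> ha hb.
pose A := a \_ I; pose B := b \_ I.
have iA := integrable_restrict ha; have iB := integrable_restrict hb.
have mA : measurable_fun setT A by apply/measurable_EFinP; exact: measurable_int iA.
have mB : measurable_fun setT B by apply/measurable_EFinP; exact: measurable_int iB.
pose f (p : R * R) : \bar R := (if p.2 < p.1 then A p.1 * B p.2 else 0)%:E.
have mf : measurable_fun setT f.
  apply/measurable_EFinP; apply: measurable_fun_ifT => //.
    apply: measurable_fun_ltr; [exact: measurable_snd|exact: measurable_fst].
  by apply: measurable_funM; apply: measurableT_comp.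
have intN (g : R -> R) : mu.-integrable setT (EFin \o g) ->
    (\int[mu]_x `|g x|%:E)%E \is a fin_num.
  move=> hg; apply: integrable_fin_num => //.
  exact: (integrable_norm hg).
have jf : (mu \x mu)%E.-integrable setT f.
  have [_ jh] := @integrable12ltyP _ _ _ _ R mu mu f mf; apply: jh.
  pose cB := fine (\int[mu]_x `|B x|%:E)%E.
  apply: (@le_lt_trans _ _ (\int[mu]_x (cB%:E * `|A x|%:E))%E).
    apply: ge0_le_integral => //.
    - by move=> x _; apply: integral_ge0.
    - by apply: (@measurable_fun_fubini_tonelli_F _ _ _ _ R mu (fun p => `|f p|%E)) => //; exact: measurableT_comp.
    - by apply: measurable_funeM; apply/measurable_EFinP; exact: measurableT_comp.
    - move=> x _; rewrite /cB fineK ?intN // muleC -ge0_integralZl //.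
      apply: ge0_le_integral => //.
      + apply: (measurableT_comp (f := abse)) => //.
        exact: (measurableT_comp mf (pair1_measurable x)).
      + by apply: measurable_funeM; apply/measurable_EFinP; exact: measurableT_comp.
      + move=> y _; rewrite /f /= -EFinM lee_fin.
        by case: ifP => _; rewrite ?normrM // normr0 mulr_ge0.
      + by apply/measurable_EFinP; exact: measurableT_comp.
  rewrite ge0_integralZl //; last 2 first.
  - by apply/measurable_EFinP; exact: measurableT_comp.
  - by rewrite lee_fin /cB fine_ge0 // integral_ge0.
  by rewrite -(fineK (intN _ iA)) -EFinM ltry.
have := Fubini jf.
have -> : (\int[mu]_x \int[mu]_y f (x, y) = \int[mu]_(x in I) (a x * prim b x)%:E)%E.
  rewrite [RHS]integral_mkcond; apply: eq_integral => x _.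
  rewrite [RHS]patchE; case: ifPn => [xI|/negP xI]; last first.
    rewrite integral0_eq // => y _; rewrite /f /= /A patchE.
    by case: (x \in I) xI => // _; rewrite mul0r if_same.
  transitivity (\int[mu]_(y in I) (a x * (if y < x then b y else 0))%:E)%E.
    rewrite [RHS]integral_mkcond; apply: eq_integral => y _.
    rewrite [RHS]patchE /f /= /A /B !patchE xI.
    by case: (y \in I); case: ifP; rewrite ?mulr0.
  have hb' := integrable01Z (a x) (integrable_below x hb).
  rewrite -(integral01Z _ (integrable_below x hb)) /integral01 /Rintegral fineK //.
  exact: integrable_fin_num hb'.
have -> : (\int[mu]_y \int[mu]_x f (x, y) =
    \int[mu]_(s in I) (b s * integral01 (fun z => if (s < z)%R then a z else 0%R))%:E)%E.
  rewrite [RHS]integral_mkcond; apply: eq_integral => y _.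
  rewrite [RHS]patchE; case: ifPn => [yI|/negP yI]; last first.
    rewrite integral0_eq // => x _; rewrite /f /= /B patchE.
    by case: (y \in I) yI => // _; rewrite mulr0 if_same.
  transitivity (\int[mu]_(x in I) (b y * (if y < x then a x else 0))%:E)%E.
    rewrite [RHS]integral_mkcond; apply: eq_integral => x _.
    rewrite [RHS]patchE /f /= /A /B !patchE yI.
    by case: (x \in I); case: ifP; rewrite ?mulr0 ?mul0r // mulrC.
  have ha' := integrable01Z (b y) (integrable_above y ha).
  rewrite -(integral01Z _ (integrable_above y ha)) /integral01 /Rintegral fineK //.
  exact: integrable_fin_num ha'.
by move=> h; rewrite /integral01 /Rintegral h.
Qed.
End primitive.

Section weak_derivatives.
Context (R : realType).
Local Notation mu := (@lebesgue_measure R).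
Local Notation I := (unit_itv R).
Implicit Types (u v a b f F phi : R -> R) (z s p : R).

Lemma ae01_exists (P : R -> Prop) (c d : R) : 0 <= c -> c < d -> d <= 1 ->
  ae01 P -> exists2 z, c < z < d & P z.
Proof.
move=> c0 cd d1 hP; apply: contrapT => hn.
have sub : `]c, d[%classic `<=` ~` [set z | I z -> P z].
  move=> z /= zcd hz; apply: hn; exists z; first by move: zcd; rewrite in_itv.
  apply: hz; move: zcd; rewrite /unit_itv /= !in_itv /= => /andP[h1 h2].
  by rewrite (le_lt_trans c0) // (lt_le_trans h2).
have hn2 : mu.-negligible (`]c, d[%classic : set R) by apply: negligibleS hP.
have h0 := (negligibleP mu (measurable_itv `]c, d[)).1 hn2.
have := lebesgue_measure_itv `]c, d[; rewrite h0 /= lte_fin cd -EFinB => /esym/eqP.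
by rewrite eqe subr_eq0 gt_eqF.
Qed.

(** A null set contains no interval, so the two functions agree arbitrarily close
    to every point of [0, 1]. *)
Lemma within_continuous_ae u v : {within `[0, 1], continuous u} ->
  {within `[0, 1], continuous v} -> ae01 (fun z => u z = v z) ->
  forall z, 0 <= z <= 1 -> u z = v z.
Proof.
move=> /subspace_continuousP cu /subspace_continuousP cv uv z z01.
have hz : `[0, 1]%classic z by rewrite /= in_itv.
apply/eqP; rewrite -subr_eq0 -normr_le0; apply/ler_addgt0Pr => e e0; rewrite add0r.
have e2 : 0 < e / 2 by lra.
have /cvgrPdist_le /(_ _ e2) h1 := cu z hz.
have /cvgrPdist_le /(_ _ e2) h2 := cv z hz.
have [d d0 hd] : exists2 d, 0 < d & forall s, 0 <= s <= 1 -> `|z - s| < d ->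
    `|u z - u s| <= e / 2 /\ `|v z - v s| <= e / 2.
  move: h1 h2; rewrite !near_withinE => h1 h2.
  have [d /= d0 hd] := (nbhs_ballP _ _).1 (filterI h1 h2).
  exists d => // s s01 zs; have [//|k1 k2] := hd s.
  by split; [apply: k1|apply: k2]; rewrite /= in_itv.
have z01' := andP z01.
have [s /andP[cs sd] us] := @ae01_exists _ (Num.max 0 (z - d)) (Num.min 1 (z + d))
    ltac:(by rewrite le_max lexx) ltac:(rewrite lt_min !gt_max; lra) ltac:(by rewrite ge_min lexx) uv.
move: cs sd; rewrite gt_max lt_min => /andP[s0 zd] /andP[s1 sz].
have [||h3 h4] := hd s; [lra|by rewrite ltr_norml; lra|].
by move: h3 h4; rewrite us !ler_norml; lra.
Qed.

Lemma integral_above f F s : continuous f -> (forall x : R, is_derive x 1 F (f x)) ->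
  0 <= s < 1 -> integral01 (fun z => if s < z then f z else 0) = F 1 - F s.
Proof.
move=> cf dF /andP[s0 s1].
have cW : {within `[s, 1], continuous f} by apply: continuous_subspaceT.
have intf : mu.-integrable `[s, 1] (EFin \o f).
  by apply: continuous_compact_integrable => //; exact: segment_compact.
have := @continuous_FTC2 R f F s 1 s1 cW.
have dr x : {for x, continuous F}.
  by apply: differentiable_continuous; apply/derivable1_diffP; apply: ex_derive.
move=> /(_ _ _)/wrap[].
  split; first by move=> x _; apply: ex_derive.
    by apply: cvg_at_right_filter; exact: dr.
  by apply: cvg_at_left_filter; exact: dr.
  by move=> x _; rewrite derive1E; apply: derive_val.
move=> h.
transitivity (\int[mu]_(z in `[s, 1]) f z); last by rewrite /Rintegral h.
have sub (A : set R) : measurable A -> A `<=` `[s, 1] -> mu.-integrable A (EFin \o f).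
  by move=> mA sA; apply: integrableS intf.
rewrite -Rintegral_itv_obnd_cbnd; last first.
  apply: sub => // x /=; rewrite !in_itv /= => /andP[h1 ->]; by rewrite ltW.
rewrite -Rintegral_itv_bndo_bndc; last first.
  apply: sub => // x /=; rewrite !in_itv /= => /andP[h1 h2]; by rewrite !ltW.
rewrite (_ : `]s, 1[%classic = I `&` `]s, +oo[%classic); last first.
  apply/seteqP; split=> x /=; rewrite /unit_itv /= !in_itv /= ?andbT.
    by move=> /andP[sx ->]; rewrite sx (le_lt_trans s0).
  by move=> [/andP[_ ->] ->].
rewrite Rintegral_mkcondr; apply: eq_Rintegral => x _.
rewrite [RHS]patchE; case: (ltP s x) => sx.
  by rewrite mem_set //= in_itv /= sx.
by rewrite memNset //= in_itv /= andbT ltNge sx.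
Qed.

Lemma exp_decay_bounds (a z : R) : 0 <= a -> I z -> expR (- a) <= expR (- a * z) <= 1.
Proof.
move=> a0; rewrite /unit_itv /= in_itv /= => /andP[z0 z1].
rewrite -[X in _ && (_ <= X)]expR0 !ler_expR; apply/andP; split; nra.
Qed.

Lemma measurable_exp (a : R) : measurable_fun I (fun z => expR (- a * z)).
Proof.
apply: measurable_funTS; apply: continuous_measurable_fun.
move=> z; apply: continuous_comp; last exact: continuous_expR.
by apply: cvgM; [exact: cvg_cst|exact: cvg_id].
Qed.

Lemma integrable_exp (a : R) (u : R -> R) : 0 <= a -> integrable01 u ->
  integrable01 (fun z => expR (- a * z) * u z).
Proof.
move=> a0 hu; apply: (@integrable01_le _ _ (fun z => `|u z|)).
- apply: measurable_funM; [exact: measurable_exp|exact: integrable01_measurable].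
- move=> z Iz; have /andP[_ h2] := exp_decay_bounds a0 Iz.
  by rewrite normrM ger0_norm ?expR_ge0 // -[leRHS]mul1r ler_wpM2r.
- exact: (integrable_norm hu).
Qed.

(** By Cauchy-Schwarz and Fubini the left side is at most
    int u(s)^2 (int_s^1 exp(-l z) dz) ds, and the inner integral is at most
    exp(-l s) / l. The gain 1 / l makes Volterra operators small. *)
Lemma prim_weighted_le (l : R) u : 0 < l -> L2r u ->
  integral01 (fun z => expR (- l * z) * prim u z ^+ 2) <=
  l^-1 * integral01 (fun z => expR (- l * z) * u z ^+ 2).
Proof.
move=> l0 hu; have [mu' hu2] := hu; have hu1 := L2r_integrable hu.
have cE : continuous (fun z : R => expR (- l * z)).
  move=> z; apply: continuous_comp; last exact: continuous_expR.
  by apply: cvgM; [exact: cvg_cst|exact: cvg_id].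
have E1 z : I z -> 0 <= expR (- l * z) <= 1.
  by move=> Iz; rewrite expR_ge0 /=; have /andP[] := exp_decay_bounds (ltW l0) Iz.
have iM w := @integrable_exp l w (ltW l0).
have iE : integrable01 (fun z => expR (- l * z)).
  by have := iM _ (integrable01_cst 1); under eq_fun do rewrite mulr1.
have [_ iP] := prim_L2r hu1.
have [mP2 _] := prim_L2r hu2.
apply: (@le_trans _ _ (integral01 (fun z => expR (- l * z) * prim (fun s => u s ^+ 2) z))).
  apply: integral01_le; [exact: iM|by apply: iM; apply: L2r_integrable; exact: prim_L2r|].
  by move=> z /E1 /andP[e0 _]; rewrite ler_wpM2l // prim_sqr_le.
rewrite (triangle_swap iE hu2) -integral01Z; last exact: iM.
have EE s : I s -> integral01 (fun z => if s < z then expR (- l * z) else 0) =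
    l^-1 * (expR (- l * s) - expR (- l)).
  rewrite /unit_itv /= in_itv /= => /andP[s0 s1].
  have dF (x : R) : is_derive x 1 (fun z => - l^-1 * expR (- l * z)) (expR (- l * x)).
    have h1 : is_derive x 1 (fun z : R => - l * z) (- l).
      have := is_deriveZ (- l) (is_derive_id x (1 : R)).
      by rewrite /GRing.scale /= mulr1.
    have h2 := is_derive1_comp (is_derive_expR (- l * x)) h1.
    have := is_deriveZ (- l^-1) h2.
    by move/is_derive_eq; apply; rewrite /GRing.scale /=; field; rewrite gt_eqF.
  rewrite (integral_above cE dF) ?(ltW s0) //.
  by rewrite mulr1; ring.
rewrite (@eq_integral01 _ _ (fun s => l^-1 * (u s ^+ 2 * (expR (- l * s) - expR (- l))))); last first.
  by move=> s Is; rewrite EE // mulrCA.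
apply: integral01_le.
- apply: integrable01Z; have h := integrable01B (iM _ hu2) (integrable01Z (expR (- l)) hu2).
  by move: h; congr integrable01; apply/funext => s; ring.
- by apply: integrable01Z; exact: iM.
- move=> s _; rewrite ler_wpM2l ?invr_ge0 ?(ltW l0) // [leRHS]mulrC ler_wpM2l ?sqr_ge0 //.
  by rewrite gerBl expR_ge0.
Qed.

(** * Weak derivatives and primitives *)

Lemma test_function_bounds phi : test_function phi ->
  [/\ continuous phi, forall z : R, is_derive z 1 phi (derive1 phi z), phi 1 = 0
    & phi 0 = 0].
Proof.
move=> [dphi cphi [a [b [a0 b1 hab]]]]; split.
- by move=> z; apply: differentiable_continuous; apply/derivable1_diffP.
- by move=> z; rewrite derive1E; apply: DeriveDef.
- by apply: hab; rewrite negb_and -!ltNge b1 orbT.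
- by apply: hab; rewrite negb_and -!ltNge a0.
Qed.

Lemma integrable_continuousM f u : continuous f -> integrable01 u ->
  integrable01 (fun z => f z * u z).
Proof.
move=> cf hu.
have [M hM] : exists M, forall z, 0 <= z <= 1 -> `|f z| <= M.
  have : compact ((fun z => `|f z|) @` `[0, 1]%classic).
    apply: continuous_compact; last exact: segment_compact.
    by apply: continuous_subspaceT => z; apply: cvg_norm; exact: cf.
  move=> /compact_bounded [M [_ hM]]; exists (M + 1) => z z01.
  rewrite -(normr_id (f z)); apply: (hM (M + 1)); first by rewrite ltrDl.
  by exists z => //=; rewrite in_itv.
apply: (@integrable01_le _ _ (fun z => M * `|u z|)).
- apply: measurable_funM; last exact: integrable01_measurable.
  by apply: measurable_funTS; exact: continuous_measurable_fun.
- move=> z; rewrite /unit_itv /= in_itv /= => /andP[z0 z1].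
  by rewrite normrM ler_wpM2r // hM // !ltW.
- by apply: integrable01Z; exact: (integrable_norm hu).
Qed.

Lemma prim_by_parts phi u : test_function phi -> integrable01 u ->
  integral01 (fun z => derive1 phi z * prim u z) = - integral01 (fun z => phi z * u z).
Proof.
move=> tphi hu; have [cphi dphi p1 p0] := test_function_bounds tphi.
have [_ cd _] := tphi.
have hd : integrable01 (derive1 phi).
  have := integrable_continuousM cd (integrable01_cst 1).
  by under eq_fun do rewrite mulr1.
rewrite (triangle_swap hd hu) -integral01N; last exact: integrable_continuousM.
apply: eq_integral01 => s; rewrite /unit_itv /= in_itv /= => /andP[s0 s1].
by rewrite (integral_above cd dphi) ?ltW // p1 sub0r mulrN mulrC.
Qed.

(** Derivatives of piecewise quadratic splines, without a discussion of their
    knots. *)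
Lemma is_derive_quadratic f (x d C : R) :
  (forall k : R, `|f (k + x) - f x - k * d| <= C * k ^+ 2) -> is_derive x 1 f d.
Proof.
move=> hf.
have hc : h^-1 *: (f (h *: (1 : R) + x) - f x) @[h --> 0^'] --> d.
  apply/cvgrPdist_le => e e0.
  have C1 : 0 < `|C| + 1 by apply: ltr_wpDl.
  near=> h.
  have h0 : h != 0 by near: h; exact: nbhs_dnbhs_neq.
  have hs : `|h| <= e / (`|C| + 1).
    by near: h; apply: dnbhs0_le; rewrite divr_gt0.
  have -> : d - h^-1 *: (f (h *: (1 : R) + x) - f x) = - (h^-1 * (f (h + x) - f x - h * d)).
    by rewrite /GRing.scale /= mulr1; field.
  rewrite normrN normrM normfV mulrC ler_pdivrMr ?normr_gt0 //.
  apply: (le_trans (hf h)); apply: (@le_trans _ _ ((`|C| + 1) * `|h| ^+ 2)).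
    rewrite real_normK ?num_real // ler_wpM2r ?sqr_ge0 //.
    by apply: (le_trans (ler_norm C)); rewrite lerDl.
  rewrite expr2 mulrA ler_wpM2r // mulrC -ler_pdivlMr //.
split; first by apply/cvg_ex; exists d.
exact/cvg_lim.
Unshelve. all: by end_near. Qed.

(** The positive part of z. [tent e p] is the continuous piecewise linear bump of
    integral 1 supported in [p - e, p + e], and [step e p] is its primitive; the
    difference of two steps is a C^1 test function. *)
Definition ramp (z : R) : R := (z + `|z|) / 2.
Definition step (e p z : R) : R :=
  (ramp (z - p + e) ^+ 2 / 2 - 2 * (ramp (z - p) ^+ 2 / 2) + ramp (z - p - e) ^+ 2 / 2) / e ^+ 2.
Definition tent (e p z : R) : R :=
  (ramp (z - p + e) - 2 * ramp (z - p) + ramp (z - p - e)) / e ^+ 2.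

Lemma ramp_pos z : 0 <= z -> ramp z = z.
Proof. by move=> z0; rewrite /ramp ger0_norm //; field. Qed.
Lemma ramp_neg z : z <= 0 -> ramp z = 0.
Proof. by move=> z0; rewrite /ramp ler0_norm // subrr mul0r. Qed.

(** The function ramp^2 / 2 has derivative [ramp], with a quadratic remainder that
    is uniform in z. *)
Lemma ramp_sqr_taylor (z h : R) :
  0 <= ramp (h + z) ^+ 2 / 2 - ramp z ^+ 2 / 2 - h * ramp z <= h ^+ 2 / 2.
Proof.
have [z0|z0] := leP 0 z; have [h0|h0] := leP 0 (h + z).
- by rewrite (ramp_pos z0) (ramp_pos h0); apply/andP; split; nra.
- by rewrite (ramp_pos z0) (ramp_neg (ltW h0)); apply/andP; split; nra.
- by rewrite (ramp_pos h0) (ramp_neg (ltW z0)); apply/andP; split; nra.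
- by rewrite (ramp_neg (ltW z0)) (ramp_neg (ltW h0)); apply/andP; split; nra.
Qed.

Lemma ramp_continuous : continuous ramp.
Proof.
move=> z; rewrite /ramp; apply: cvgM; last exact: cvg_cst.
by apply: cvgD; [exact: cvg_id|apply: cvg_norm; exact: cvg_id].
Qed.

Lemma tent_continuous e p : continuous (tent e p).
Proof.
have hc (c : R) : continuous (fun z => ramp (z + c)).
  move=> z; apply: (@continuous_comp R R R (fun z => z + c) ramp); last exact: ramp_continuous.
  by apply: cvgD; [exact: cvg_id|exact: cvg_cst].
have hc2 (c c' : R) : continuous (fun z => ramp (z + c + c')).
  by under eq_fun do rewrite -addrA; exact: hc.
move=> z; rewrite /tent; apply: cvgM; last exact: cvg_cst.
apply: cvgD; last exact: hc2.
apply: cvgB; first exact: hc2.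
by apply: cvgM; [exact: cvg_cst|exact: hc].
Qed.

Lemma step_derive e p (z : R) : 0 < e -> is_derive z 1 (step e p) (tent e p z).
Proof.
move=> e0; apply: (@is_derive_quadratic _ _ _ (2 / e ^+ 2)) => h.
have e2 : 0 < e ^+ 2 by rewrite exprn_gt0.
have E : step e p (h + z) - step e p z - h * tent e p z =
   ((ramp (h + (z - p + e)) ^+ 2 / 2 - ramp (z - p + e) ^+ 2 / 2 - h * ramp (z - p + e))
   - 2 * (ramp (h + (z - p)) ^+ 2 / 2 - ramp (z - p) ^+ 2 / 2 - h * ramp (z - p))
   + (ramp (h + (z - p - e)) ^+ 2 / 2 - ramp (z - p - e) ^+ 2 / 2 - h * ramp (z - p - e))) / e ^+ 2.
  by rewrite /step /tent !addrA; field; rewrite gt_eqF.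
have e2V : 0 < (e ^+ 2)^-1 by rewrite invr_gt0.
rewrite E normrM (gtr0_norm e2V) [leRHS]mulrAC ler_pM2r //.
have /andP[] := ramp_sqr_taylor (z - p + e) h.
have /andP[] := ramp_sqr_taylor (z - p) h.
have /andP[] := ramp_sqr_taylor (z - p - e) h.
move: (_ - h * ramp (z - p - e)) (_ - h * ramp (z - p)) (_ - h * ramp (z - p + e)) => A B C.
by move=> ? ? ? ? ? ?; rewrite ler_norml; lra.
Qed.

Lemma step_left e p (z : R) : 0 < e -> z <= p - e -> step e p z = 0.
Proof.
by move=> e0 zp; rewrite /step !ramp_neg ?expr0n /=; lra.
Qed.
Lemma step_right e p (z : R) : 0 < e -> p + e <= z -> step e p z = 1.
Proof.
move=> e0 zp; rewrite /step !ramp_pos; try lra.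
by field; rewrite gt_eqF.
Qed.
Lemma tent_bounds e p (z : R) : 0 < e -> 0 <= tent e p z <= e^-1.
Proof.
move=> e0; have e2 : 0 < e ^+ 2 by rewrite exprn_gt0.
rewrite (_ : e^-1 = e / e ^+ 2); last by field; rewrite gt_eqF.
rewrite /tent ler_pM2r ?invr_gt0 // pmulr_lge0 ?invr_gt0 //.
rewrite /ramp; case: (ger0P (z - p + e)); case: (ger0P (z - p)); case: (ger0P (z - p - e)) => *; lra.
Qed.
Lemma tent_out e p (z : R) : 0 < e -> e <= `|z - p| -> tent e p z = 0.
Proof.
move=> e0; rewrite ler_normr => /orP[h|h].
  by rewrite /tent !ramp_pos; try lra; rewrite (_ : _ - _ + _ = 0) ?mul0r //; ring.
by rewrite /tent !ramp_neg; try lra; rewrite (_ : _ - _ + _ = 0) ?mul0r //; ring.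
Qed.
Lemma integral_tent e p : 0 < e -> 0 < p - e -> p + e < 1 -> integral01 (tent e p) = 1.
Proof.
move=> e0 pe1 pe2.
have := @integral_above (tent e p) (step e p) 0 (@tent_continuous e p)
  (fun z => step_derive p z e0).
rewrite lexx ltr01 => /(_ isT); rewrite step_right ?(ltW pe2) // step_left ?(ltW pe1) // subr0 => <-.
by apply: eq_integral01 => z; rewrite /unit_itv /= in_itv /= => /andP[-> _].
Qed.

Lemma tent_test_function e p q : 0 < e -> 0 < p - e -> 0 < q - e -> p + e < 1 -> q + e < 1 ->
  test_function (fun z => step e p z - step e q z) /\
  derive1 (fun z => step e p z - step e q z) = (fun z => tent e p z - tent e q z).
Proof.
move=> e0 p0 q0 p1 q1.
have dd (z : R) : is_derive z 1 (fun z => step e p z - step e q z) (tent e p z - tent e q z).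
  have := is_deriveB (step_derive p z e0) (step_derive q z e0); exact.
have dE : derive1 (fun z => step e p z - step e q z) = (fun z => tent e p z - tent e q z).
  by apply/funext => z; rewrite derive1E; apply: derive_val.
split=> //; split.
- by move=> z; apply: ex_derive.
- rewrite dE => z; apply: cvgB; exact: tent_continuous.
exists (Num.min (p - e) (q - e)), (Num.max (p + e) (q + e)).
rewrite lt_min gt_max p0 q0 p1 q1; split=> // z.
rewrite negb_and -!ltNge lt_min gt_max => /orP[] /andP[h1 h2].
  by rewrite !step_left ?subrr // ltW.
by rewrite !step_right ?subrr // ltW.
Qed.
End weak_derivatives.

(** * The lemma of du Bois-Reymond *)

Section du_bois_reymond.
Context (R : realType).
Local Notation mu := (@lebesgue_measure R).
Local Notation I := (unit_itv R).
Implicit Types (u v a b f F phi : R -> R) (z s p : R).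

Lemma restrict_locally_integrable u : integrable01 u ->
  locally_integrable setT (u \_ I).
Proof.
move=> hu; have hr := integrable_restrict hu; split; [|exact: openT|].
  by apply/measurable_EFinP; exact: measurable_int hr.
move=> A _ cA; have mA : measurable A by exact: compact_measurable.
have /integrableP[_] : mu.-integrable A (EFin \o (u \_ I)) by apply: integrableS hr.
by [].
Qed.

(** The tent is at most 1 / e on a ball of measure 2 e, so averaging against it
    costs at most twice the mean deviation [davg] over that ball. *)
Lemma tent_average e p u : 0 < e -> 0 < p - e -> p + e < 1 -> integrable01 u ->
  (`|integral01 (fun z => tent e p z * u z) - u p|%:E <= 2%:E * davg (u \_ I) p e)%E.
Proof.
move=> e0 pe1 pe2 hu.
have Ip : I p by rewrite /unit_itv /= in_itv /=; lra.
have it := integrable_continuousM (@tent_continuous R e p) hu.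
have itc : integrable01 (tent e p).
  have := integrable_continuousM (@tent_continuous R e p) (integrable01_cst 1).
  by under eq_fun do rewrite mulr1.
have itp := integrable01Z (u p) itc.
pose g z := `|tent e p z * (u z - u p)|.
have hg : integrable01 g.
  apply: integrable_norm; have := integrable01B it itp.
  by congr (mu.-integrable I); apply/funext => z /=; congr EFin; ring.
have h1 : `|integral01 (fun z => tent e p z * u z) - u p| <= integral01 g.
  rewrite [X in _ - X](_ : u p = integral01 (fun z => u p * tent e p z)); last first.
    by rewrite (integral01Z _ itc) (integral_tent e0 pe1 pe2) mulr1.
  rewrite -(integral01B it itp).
  apply: (le_trans (le_normr_Rintegral _ (integrable01B it itp))) => //.
  rewrite le_eqVlt; apply/orP; left; apply/eqP; apply: eq_integral01 => z _.
  by rewrite /g; congr `|_|; ring.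
have h2 : (integral01 g)%:E = (\int[mu]_(z in I) (g z)%:E)%E.
  by rewrite /integral01 /Rintegral fineK //; exact: integrable_fin_num.
apply: (@le_trans _ _ (\int[mu]_(z in I) (g z)%:E)%E); first by rewrite -h2 lee_fin.
have iu := integrable_restrict hu.
have mu' : measurable_fun setT (u \_ I) by apply/measurable_EFinP; exact: measurable_int iu.
pose k z := (e^-1 * `|(u \_ I) z - u p|).
have mk : measurable_fun setT k.
  by apply: measurable_funM => //; apply: measurableT_comp => //; exact: measurable_funB.
apply: (@le_trans _ _ (\int[mu]_(z in ball p e) (k z)%:E)%E).
  rewrite integral_mkcond [leRHS]integral_mkcond; apply: ge0_le_integral => //.
  - by move=> z _; rewrite patchE; case: ifP; rewrite // lee_fin /g.
  - apply/(measurable_restrictT _ _).1 => //; exact: measurable_int hg.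
  - by apply/(measurable_restrictT _ _).1; [exact: measurable_ball|apply/measurable_EFinP; exact: measurable_funTS].
  - move=> z _; rewrite !patchE; case: ifPn => zI; case: ifPn => zB //.
    + rewrite lee_fin /g /k patchE zI normrM ler_wpM2r //.
      by have /andP[t0 t1] := tent_bounds p z e0; rewrite ger0_norm.
    + rewrite lee_fin /g tent_out ?mul0r ?normr0 //.
      by move/negP: zB => zB; rewrite leNgt; apply/negP => h; apply: zB; rewrite inE /ball /= distrC.
    + by rewrite lee_fin /k mulr_ge0 // invr_ge0 ltW.
have uIp : (u \_ I) p = u p by rewrite patchE mem_set.
rewrite /davg /iavg lebesgue_measure_ball ?(ltW e0) //.
have e2 : e *+ 2 != 0 by rewrite mulrn_eq0 /= gt_eqF.
rewrite inver (negbTE e2) muleA -EFinM.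
rewrite (_ : 2 * (e *+ 2)^-1 = e^-1); last by rewrite -mulr_natl; field; rewrite gt_eqF.
rewrite -ge0_integralZl //.
- apply: ge0_le_integral => //.
  + exact: measurable_ball.
  + by move=> z _; rewrite lee_fin /k mulr_ge0 // invr_ge0 ltW.
  + by apply/measurable_EFinP; exact: measurable_funTS.
  + apply: measurable_funeM; apply: measurableT_comp => //; apply/measurable_EFinP.
    by apply: measurable_funTS; exact: measurable_funB.
  + by move=> z _; rewrite /k /= uIp -EFinM.
- exact: measurable_ball.
- apply: measurableT_comp => //; apply/measurable_EFinP.
  by apply: measurable_funTS; exact: measurable_funB.
- by rewrite lee_fin invr_ge0 ltW.
Qed.

(** Test with [step e p - step e q] for two Lebesgue points p and q of u: the
    derivative is the difference of two tents, whose averages tend to u(p) and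
    u(q) as e tends to 0. *)
Theorem du_bois_reymond u : integrable01 u ->
  (forall phi, test_function phi -> integral01 (fun z => derive1 phi z * u z) = 0) ->
  exists c, ae01 (fun z => u z = c).
Proof.
move=> hu ht.
have leb : ae01 (fun z => lebesgue_pt (u \_ I) z).
  have := lebesgue_differentiation (restrict_locally_integrable hu).
  by apply: filterS; first exact: (ae_filter_ringOfSetsType mu).
have key p q : I p -> I q -> lebesgue_pt (u \_ I) p -> lebesgue_pt (u \_ I) q -> u p = u q.
  rewrite /unit_itv /= !in_itv /= => /andP[p0 p1] /andP[q0 q1] lp lq.
  apply/eqP; rewrite -subr_eq0 -normr_le0; apply/ler_addgt0Pr => d d0; rewrite add0r.
  have d4 : 0 < d / 4 by lra.
  have nearD x : lebesgue_pt (u \_ I) x ->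
      \forall e \near (0 : R)^'+, (davg (u \_ I) x e < (d / 4)%:E)%E.
    move=> lx; have : nbhs (0%:E : \bar R) [set y | (y < (d / 4)%:E)%E].
      by apply: open_nbhs_nbhs; split; [exact: open_ereal_lt_ereal|rewrite /= lte_fin].
    exact: lx.
  have [e [e0 [ep [ep1 [eq1 [eq2 [dp dq]]]]]]] : exists e, 0 < e /\ 0 < p - e /\ p + e < 1 /\
      0 < q - e /\ q + e < 1 /\ (davg (u \_ I) p e < (d / 4)%:E)%E /\
      (davg (u \_ I) q e < (d / 4)%:E)%E.
    suff : \forall e \near (0 : R)^'+, 0 < e /\ 0 < p - e /\ p + e < 1 /\
      0 < q - e /\ q + e < 1 /\ (davg (u \_ I) p e < (d / 4)%:E)%E /\
      (davg (u \_ I) q e < (d / 4)%:E)%E by move=> /filter_ex.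
    near=> e; split; last split; last split; last split; last split; last split.
    - by near: e; exact: nbhs_right_gt.
    - by rewrite subr_gt0; near: e; exact: nbhs_right_lt.
    - by rewrite addrC -ltrBrDr; near: e; apply: nbhs_right_lt; rewrite subr_gt0.
    - by rewrite subr_gt0; near: e; exact: nbhs_right_lt.
    - by rewrite addrC -ltrBrDr; near: e; apply: nbhs_right_lt; rewrite subr_gt0.
    - by near: e; exact: nearD.
    - by near: e; exact: nearD.
  have [tf tE] := tent_test_function e0 ep eq1 ep1 eq2.
  have := ht _ tf; rewrite tE.
  have ip := integrable_continuousM (@tent_continuous R e p) hu.
  have iq := integrable_continuousM (@tent_continuous R e q) hu.
  under eq_integral01 do rewrite mulrBl.
  rewrite (integral01B ip iq) => hpq.
  have bound x : 0 < x - e -> x + e < 1 -> (davg (u \_ I) x e < (d / 4)%:E)%E ->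
      `|integral01 (fun z => tent e x z * u z) - u x| <= d / 2.
    move=> x0 x1 hx; rewrite -lee_fin; apply: (le_trans (tent_average e0 x0 x1 hu)).
    rewrite (_ : d / 2 = 2 * (d / 4)); last by field.
    by rewrite EFinM; apply: lee_wpmul2l => //; exact: ltW.
  have := bound p ep ep1 dp; have := bound q eq1 eq2 dq.
  move: hpq; move: (integral01 _) (integral01 _) => A B AB.
  by rewrite !ler_norml; lra.
have [[p [Ip lp]]|no] := pselect (exists p, I p /\ lebesgue_pt (u \_ I) p).
  by exists (u p); apply: (ae01S _ leb) => z Iz lz; exact: key.
exists 0; apply: (ae01S _ leb) => z Iz lz; exfalso; apply: no; by exists z.
Unshelve. all: by end_near. Qed.

Lemma prim_eq0 u : integrable01 u -> (forall z, 0 <= z <= 1 -> prim u z = 0) ->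
  ae01 (fun z => u z = 0).
Proof.
move=> hu h0; have hr := integrable_restrict hu.
have hi (y : R) : mu.-integrable [set` Interval (BLeft 0) (BRight y)] (EFin \o (u \_ I)).
  by apply: integrableS hr.
have := FTC1 hi (restrict_locally_integrable hu).
apply: filterS; first exact: (ae_filter_ringOfSetsType mu).
move=> z hz; rewrite /unit_itv /= in_itv /= => /andP[z0 z1].
have [|_] := hz; first by rewrite /= lte_fin.
rewrite patchE mem_set; last by rewrite /unit_itv /= in_itv /= z0.
move=> <-; rewrite derive1E.
transitivity ('D_1 (cst (0 : R)) z); last exact: derive_cst.
apply: near_eq_derive; near=> x.
have x01 : 0 <= x <= 1.
  have : x \in `]0, 1[ by near: x; apply: near_in_itvoo; rewrite in_itv /= z0.
  by rewrite in_itv /= => /andP[x0 x1]; rewrite !ltW.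
by rewrite -[LHS](prim_parameterized hu x01) h0.
Unshelve. all: by end_near. Qed.

(** By parts, the primitive of u satisfies the hypothesis of [du_bois_reymond], so
    it is constant; it vanishes at 0. *)
Lemma integral_test_eq0 u : integrable01 u ->
  (forall phi, test_function phi -> integral01 (fun z => phi z * u z) = 0) ->
  ae01 (fun z => u z = 0).
Proof.
move=> hu ht; apply: prim_eq0 => //.
have [c hc] : exists c, ae01 (fun z => prim u z = c).
  apply: du_bois_reymond; first exact/L2r_integrable/prim_L2r.
  by move=> phi tphi; rewrite prim_by_parts // ht // oppr0.
have hcc := within_continuous_ae (prim_continuous hu) _ hc.
have h z : 0 <= z <= 1 -> prim u z = c.
  by apply: hcc; apply: continuous_subspaceT => x; exact: cvg_cst.
by move=> z z01; rewrite h // -(h 0) ?prim_at0 // lexx ler01.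
Qed.

Theorem weak_primitive u v : integrable01 u -> integrable01 v ->
  (forall phi, test_function phi -> integral01 (fun z => derive1 phi z * u z)
     = - integral01 (fun z => phi z * v z)) ->
  exists c, ae01 (fun z => u z = c + prim v z).
Proof.
move=> hu hv h.
have hp := L2r_integrable (prim_L2r hv).
have [c hc] : exists c, ae01 (fun z => u z - prim v z = c).
  apply: du_bois_reymond; first exact: integrable01B.
  move=> phi tphi; have [_ cd _] := tphi.
  have i1 := integrable_continuousM cd hu; have i2 := integrable_continuousM cd hp.
  under eq_integral01 do rewrite mulrBr.
  by rewrite (integral01B i1 i2) h // prim_by_parts // opprK addNr.
by exists c; apply: (ae01S _ hc) => z _ <-; rewrite subrK.
Qed.
End du_bois_reymond.

(** * Sobolev functions as chains of primitives *)

Section sobolev_functions.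
Context (R : realType) (d : nat).
Local Notation I := (unit_itv R).
Local Notation fT := (R -> 'cV[R[i]]_d).
Local Notation X := (L2space R d).
Implicit Types (f g : fT) (phi : R -> R) (c : 'cV[R[i]]_d).

Definition primv f : fT := fun z =>
  \col_i (prim (fun s => complex.Re (f s i 0)) z +i* prim (fun s => complex.Im (f s i 0)) z).

Lemma isL2_Re f i : isL2 f -> L2r (fun z => complex.Re (f z i 0)).
Proof. by move=> /isL2_entries /(_ i) []. Qed.
Lemma isL2_Im f i : isL2 f -> L2r (fun z => complex.Im (f z i 0)).
Proof. by move=> /isL2_entries /(_ i) []. Qed.

Lemma primv_Re f z i : complex.Re (primv f z i 0) = prim (fun s => complex.Re (f s i 0)) z.
Proof. by rewrite mxE. Qed.
Lemma primv_Im f z i : complex.Im (primv f z i 0) = prim (fun s => complex.Im (f s i 0)) z.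
Proof. by rewrite mxE. Qed.

Lemma primv_L2 f : isL2 f -> isL2 (primv f).
Proof.
move=> hf; apply/isL2_entries => i; split.
  rewrite (_ : (fun z => _) = prim (fun s => complex.Re (f s i 0))).
    by apply: prim_L2r; apply: L2r_integrable; exact: isL2_Re.
  by apply/funext => z; rewrite primv_Re.
rewrite (_ : (fun z => _) = prim (fun s => complex.Im (f s i 0))).
  by apply: prim_L2r; apply: L2r_integrable; exact: isL2_Im.
by apply/funext => z; rewrite primv_Im.
Qed.

Lemma primv_lin a f g z : isL2 f -> isL2 g ->
  primv (fun s => a *: f s + g s) z = a *: primv f z + primv g z.
Proof.
move=> hf hg; apply: col_eqP => i; rewrite primv_Re primv_Im.
have fr := L2r_integrable (isL2_Re i hf); have fi := L2r_integrable (isL2_Im i hf).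
have gr := L2r_integrable (isL2_Re i hg); have gi := L2r_integrable (isL2_Im i hg).
case: a => a b; split.
  rewrite (@eq_prim _ _ (fun s => a * complex.Re (f s i 0)
      + (- b * complex.Im (f s i 0) + complex.Re (g s i 0)))); last first.
    by move=> s _ /=; rewrite !mxE; case: (f s i 0) (g s i 0) => x y [p q] /=; ring.
  rewrite (prim_lin _ _ fr) ?(prim_lin _ _ fi gr) ?mxE; last first.
    by apply: integrable01D => //; exact: integrable01Z.
  by move=> /=; ring.
rewrite (@eq_prim _ _ (fun s => a * complex.Im (f s i 0)
    + (b * complex.Re (f s i 0) + complex.Im (g s i 0)))); last first.
  by move=> s _ /=; rewrite !mxE; case: (f s i 0) (g s i 0) => x y [p q] /=; ring.
rewrite (prim_lin _ _ fi) ?(prim_lin _ _ fr gi) ?mxE; last first.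
  by apply: integrable01D => //; exact: integrable01Z.
by move=> /=; ring.
Qed.

Lemma primv_ae f g z : isL2 f -> isL2 g -> ae01 (fun s => f s = g s) ->
  primv f z = primv g z.
Proof.
move=> hf hg fg; apply: col_eqP => i; rewrite !primv_Re !primv_Im; split.
  apply: prim_ae; [by have [] := isL2_Re i hf|by have [] := isL2_Re i hg|].
  by apply: (ae01S _ fg) => s _ ->.
apply: prim_ae; [by have [] := isL2_Im i hf|by have [] := isL2_Im i hg|].
by apply: (ae01S _ fg) => s _ ->.
Qed.

Lemma primv_at0 f : primv f 0 = 0.
Proof. by apply: col_eqP => i; rewrite primv_Re primv_Im !prim_at0 mxE. Qed.

Lemma primv_continuous f c : isL2 f ->
  entrywise (fun h => {within `[0, 1], continuous h}) (fun z => c + primv f z).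
Proof.
move=> hf i j; rewrite (ord1 j); split.
  rewrite (_ : (fun z => _) = fun z => complex.Re (c i 0) + prim (fun s => complex.Re (f s i 0)) z).
    move=> z; apply: continuousD; first exact: cvg_cst.
    by apply: prim_continuous; apply: L2r_integrable; exact: isL2_Re.
  by apply/funext => z; rewrite mxE ReD primv_Re.
rewrite (_ : (fun z => _) = fun z => complex.Im (c i 0) + prim (fun s => complex.Im (f s i 0)) z).
  move=> z; apply: continuousD; first exact: cvg_cst.
  by apply: prim_continuous; apply: L2r_integrable; exact: isL2_Im.
apply/funext => z; rewrite mxE -primv_Im.
by case: (c i 0) (primv f z i 0) => ? ? [? ?].
Qed.

Lemma entrywise_continuous_ae f g :
  entrywise (fun h => {within `[0, 1], continuous h}) f ->
  entrywise (fun h => {within `[0, 1], continuous h}) g ->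
  ae01 (fun z => f z = g z) -> forall z, 0 <= z <= 1 -> f z = g z.
Proof.
move=> cf cg fg z z01; apply: col_eqP => i.
have [f1 f2] := cf i 0; have [g1 g2] := cg i 0.
split; [apply: (within_continuous_ae f1 g1 _ z01)|apply: (within_continuous_ae f2 g2 _ z01)];
  by apply: (ae01S _ fg) => s _ ->.
Qed.

Lemma is_weak_derivP f g : is_weak_deriv f g <-> forall phi, test_function phi -> forall i,
  integral01 (fun z => derive1 phi z * complex.Re (f z i 0)) =
    - integral01 (fun z => phi z * complex.Re (g z i 0)) /\
  integral01 (fun z => derive1 phi z * complex.Im (f z i 0)) =
    - integral01 (fun z => phi z * complex.Im (g z i 0)).
Proof.
have E (p : R -> R) (w : R -> R[i]) : int01 (fun z => (p z)%:C * w z) =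
    integral01 (fun z => p z * complex.Re (w z)) +i* integral01 (fun z => p z * complex.Im (w z)).
  rewrite /int01; congr (_ +i* _); apply: eq_integral01 => z _; case: (w z) => x y /=; ring.
split=> h phi tphi i; have := h phi tphi i.
  by rewrite !E => /eqP; rewrite eq_complex /= => /andP[/eqP-> /eqP->].
by rewrite !E => -[-> ->].
Qed.

Lemma is_weak_deriv_unique f g g' : isL2 g -> isL2 g' -> is_weak_deriv f g ->
  is_weak_deriv f g' -> ae01 (fun z => g z = g' z).
Proof.
move=> hg hg' /is_weak_derivP h /is_weak_derivP h'.
have key (u v : R -> R) : integrable01 u -> integrable01 v ->
    (forall phi, test_function phi ->
      integral01 (fun z => phi z * u z) = integral01 (fun z => phi z * v z)) ->
    ae01 (fun z => u z = v z).
  move=> hu hv huv; have h0 : ae01 (fun z => u z - v z = 0).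
    apply: integral_test_eq0; first exact: integrable01B.
    move=> phi tphi; have [cphi _ _ _] := test_function_bounds tphi.
    under eq_integral01 do rewrite mulrBr.
    rewrite integral01B; [|exact: integrable_continuousM|exact: integrable_continuousM].
    by rewrite huv // subrr.
  by apply: (ae01S _ h0) => z _ /eqP; rewrite subr_eq0 => /eqP.
have hr i : ae01 (fun z => complex.Re (g z i 0) = complex.Re (g' z i 0)).
  apply: key; [exact/L2r_integrable/isL2_Re|exact/L2r_integrable/isL2_Re|].
  move=> phi tphi; apply: oppr_inj.
  by rewrite -(h phi tphi i).1 -(h' phi tphi i).1.
have hi i : ae01 (fun z => complex.Im (g z i 0) = complex.Im (g' z i 0)).
  apply: key; [exact/L2r_integrable/isL2_Im|exact/L2r_integrable/isL2_Im|].
  move=> phi tphi; apply: oppr_inj.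
  by rewrite -(h phi tphi i).2 -(h' phi tphi i).2.
apply: (ae01S2 _ (ae01_all hr) (ae01_all hi)) => z h1 h2.
by apply: col_eqP => i; rewrite h1 h2.
Qed.

Lemma weak_deriv_primitive f g : isL2 f -> isL2 g ->
  is_weak_deriv f g <-> exists c, ae01 (fun z => f z = c + primv g z).
Proof.
move=> hf hg; split=> [/is_weak_derivP h|[c hc]].
  have /choice [cr hcr] : forall i, exists c : R, ae01 (fun z =>
      complex.Re (f z i 0) = c + prim (fun s => complex.Re (g s i 0)) z).
    move=> i; apply: weak_primitive; [exact/L2r_integrable/isL2_Re|exact/L2r_integrable/isL2_Re|].
    by move=> phi tphi; exact: (h phi tphi i).1.
  have /choice [ci hci] : forall i, exists c : R, ae01 (fun z =>
      complex.Im (f z i 0) = c + prim (fun s => complex.Im (g s i 0)) z).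
    move=> i; apply: weak_primitive; [exact/L2r_integrable/isL2_Im|exact/L2r_integrable/isL2_Im|].
    by move=> phi tphi; exact: (h phi tphi i).2.
  exists (\col_i (cr i +i* ci i)).
  apply: (ae01S2 _ (ae01_all hcr) (ae01_all hci)) => z h1 h2.
  by apply: col_eqP => i; rewrite h1 h2 !mxE.
apply/is_weak_derivP => phi tphi i.
have [cphi dphi p1 p0] := test_function_bounds tphi; have [_ cd _] := tphi.
have key (u v : R -> R) (b : R) : L2r u -> L2r v -> ae01 (fun z => u z = b + prim v z) ->
    integral01 (fun z => derive1 phi z * u z) = - integral01 (fun z => phi z * v z).
  move=> hu hv uv; have hui := L2r_integrable hu; have hvi := L2r_integrable hv.
  have hp := L2r_integrable (prim_L2r hvi).
  have hb := integrable01_cst b.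
  have hdb := integrable_continuousM cd hb.
  have i1 := integrable_continuousM cd hp.
  rewrite (@integral01_ae _ _ (fun z => derive1 phi z * b + derive1 phi z * prim v z)).
  - rewrite (integral01D hdb i1) prim_by_parts //.
    rewrite (_ : integral01 (fun z => derive1 phi z * b) = 0) ?add0r //.
    under eq_integral01 do rewrite mulrC.
    rewrite integral01Z; last first.
      by have := integrable_continuousM cd (integrable01_cst 1); under eq_fun do rewrite mulr1.
    have := @integral_above _ _ _ 0 cd dphi; rewrite lexx ltr01 p1 p0 subrr => /(_ isT) <-.
    rewrite (_ : integral01 (derive1 phi) = integral01 (fun z => if 0 < z then derive1 phi z else 0)).
      by rewrite (integral_above cd dphi) ?lexx ?ltr01 // p1 p0 subrr mulr0.
    by apply: eq_integral01 => z; rewrite /unit_itv /= in_itv /= => /andP[->].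
  - by apply: integrable01_measurable; exact: integrable_continuousM.
  - by apply: integrable01_measurable; exact: integrable01D.
  - by apply: (ae01S _ uv) => z _ ->; rewrite mulrDr.
split; [apply: (key _ _ (complex.Re (c i 0)))|apply: (key _ _ (complex.Im (c i 0)))].
- exact: isL2_Re.
- exact: isL2_Re.
- by apply: (ae01S _ hc) => z _ ->; rewrite mxE ReD primv_Re.
- exact: isL2_Im.
- exact: isL2_Im.
- apply: (ae01S _ hc) => z _ ->; rewrite mxE -primv_Im.
  by case: (c i 0) (primv g z i 0) => ? ? [? ?].
Qed.

(** The chosen weak derivative may differ from [g] on a null set only. *)
Lemma weak_derivE f g : isL2 f -> isL2 g -> is_weak_deriv f g ->
  isL2 (weak_deriv f) /\ ae01 (fun z => weak_deriv f z = g z).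
Proof.
move=> hf hg fg; rewrite /weak_deriv; case: xgetP => [h _ [hh fh]|/(_ g) h].
  by split=> //; apply: is_weak_deriv_unique fh fg.
by exfalso; apply: h.
Qed.

Lemma cont_repE f g : ae01 (fun z => g z = f z) ->
  entrywise (fun h => {within `[0, 1], continuous h}) g ->
  forall z, 0 <= z <= 1 -> cont_rep f z = g z.
Proof.
move=> gf cg; rewrite /cont_rep; case: xgetP => [h _ [ch hf]|/(_ g) h].
  apply: entrywise_continuous_ae => //.
  by apply: (ae01S2 _ hf gf) => z -> ->.
by exfalso; apply: h.
Qed.

Lemma in_sobolev_L2 n f : in_sobolev n f -> isL2 f.
Proof. by elim: n f => [//|n IH] f [/IH]. Qed.

Definition antideriv (x : X) : X := L2class (primv (L2repr x)).
Definition const_class c : X := L2class (fun=> c).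

Lemma isL2_cst c : isL2 (fun _ : R => c).
Proof. by apply/isL2_entries => i; split; exact: L2r_cst. Qed.

Lemma antideriv_lin a x y : antideriv (a *: x + y) = a *: antideriv x + antideriv y.
Proof.
have hx := L2repr_isL2 x; have hy := L2repr_isL2 y.
rewrite /antideriv -(L2class_lin a (primv_L2 hx) (primv_L2 hy)).
congr L2class; apply/funext => z.
rewrite -(primv_lin a z hx hy); apply: primv_ae; [exact: L2repr_isL2|exact: isL2_lin|].
by apply: (ae01S2 _ (L2reprD (a *: x) y) (L2reprZ a x)) => s -> ->.
Qed.
Lemma const_class_lin a b c : const_class (a *: b + c) = a *: const_class b + const_class c.
Proof. by rewrite /const_class -(L2class_lin a (isL2_cst b) (isL2_cst c)). Qed.

(** [Y k] is the class of the k-th derivative, and [b k] its value at 0. Stating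
    membership in H^n in this way makes it linear and free of choices of
    representatives. *)
Definition primitive_chain n (Y : nat -> X) (b : nat -> 'cV[R[i]]_d) : Prop :=
  forall k, (k < n)%N -> Y k = const_class (b k) + antideriv (Y k.+1).

Lemma chain_repr n Y b k : primitive_chain n Y b -> (k < n)%N ->
  ae01 (fun z => L2repr (Y k) z = b k + primv (L2repr (Y k.+1)) z).
Proof.
move=> hc kn; have hp := primv_L2 (L2repr_isL2 (Y k.+1)).
have h1 := L2reprD (const_class (b k)) (antideriv (Y k.+1)); rewrite -(hc k kn) in h1.
have h2 := ae01S2 (fun z p q => conj p q) (L2classE (isL2_cst (b k))) (L2classE hp).
by apply: (ae01S2 _ h1 h2) => z -> [-> ->].
Qed.

Lemma chain_weak_deriv n Y b k f : primitive_chain n Y b -> (k < n)%N -> isL2 f ->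
  L2class f = Y k -> is_weak_deriv f (L2repr (Y k.+1)).
Proof.
move=> hc kn hf fY; apply/weak_deriv_primitive; [by []|exact: L2repr_isL2|].
exists (b k); have := L2classE hf; rewrite fY => h.
by apply: (ae01S2 _ h (chain_repr hc kn)) => z <- ->.
Qed.

Lemma sobolev_chain n f : in_sobolev n f -> exists Y b, Y 0%N = L2class f /\ primitive_chain n Y b.
Proof.
elim: n f => [|n IH] f /=; first by move=> _; exists (fun=> L2class f), (fun=> 0).
move=> [/in_sobolev_L2 hf [g [fg sg]]]; have hg := in_sobolev_L2 sg.
have [Y [b [Y0 hY]]] := IH g sg.
have [c hc] := (weak_deriv_primitive hf hg).1 fg.
exists (fun k => if k is k'.+1 then Y k' else L2class f), (fun k => if k is k'.+1 then b k' else c).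
split=> // -[_|k kn]; last exact: hY.
rewrite Y0; apply/L2eqP.
have h1 := L2reprD (const_class c) (antideriv (L2class g)).
have hp := primv_L2 (L2repr_isL2 (L2class g)).
have h2 := ae01S2 (fun z p q => conj p q) (L2classE (isL2_cst c)) (L2classE hp).
have h3 := ae01S2 (fun z p q => conj p q) (L2classE hf) hc.
have h4 := ae01S2 (fun z p q => conj p q) h1 h2.
apply: (ae01S2 _ h3 h4) => z [-> ->] [-> [-> ->]]; congr (_ + _).
by apply: primv_ae => //; [exact: L2repr_isL2|apply: ae01S (L2classE hg) => s _ ->].
Qed.

Lemma chain_shift n Y b : primitive_chain n.+1 Y b -> primitive_chain n (fun k => Y k.+1) (fun k => b k.+1).
Proof. by move=> h k kn; exact: h. Qed.
Lemma chain_le n m Y b : (m <= n)%N -> primitive_chain n Y b -> primitive_chain m Y b.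
Proof. by move=> mn h k km; apply: h; rewrite (leq_trans km). Qed.

Lemma chain_sobolev n f Y b : isL2 f -> L2class f = Y 0%N -> primitive_chain n Y b -> in_sobolev n f.
Proof.
elim: n f Y b => [//|n IH] f Y b hf fY hc; split.
  exact: (IH _ _ _ hf fY (chain_le (leqnSn n) hc)).
exists (L2repr (Y 1%N)); split; first exact: (chain_weak_deriv hc).
apply: (IH _ _ _ (L2repr_isL2 _) _ (chain_shift hc)); exact: L2class_repr.
Qed.

Lemma chain_derivn n f Y b k : isL2 f -> L2class f = Y 0%N -> primitive_chain n Y b -> (k <= n)%N ->
  isL2 (weak_derivn k f) /\ L2class (weak_derivn k f) = Y k.
Proof.
move=> hf fY hc; elim: k => [//|k IH] kn.
have [h1 h2] := IH (ltnW kn); rewrite /weak_derivn iterS -/(weak_derivn k f).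
have h3 := chain_weak_deriv hc kn h1 h2.
have [h4 h5] := weak_derivE h1 (L2repr_isL2 _) h3.
by split=> //; exact: L2class_eq (ae01S (fun z _ e => esym e) h5).
Qed.

Lemma chain_trace n f Y b k z : isL2 f -> L2class f = Y 0%N -> primitive_chain n Y b -> (k < n)%N ->
  0 <= z <= 1 -> trace k f z = b k + primv (L2repr (Y k.+1)) z.
Proof.
move=> hf fY hc kn z01; have [h1 h2] := chain_derivn hf fY hc (ltnW kn).
apply: (cont_repE (g := fun z => b k + primv (L2repr (Y k.+1)) z)) z01.
  have h3 := L2classE h1; rewrite h2 in h3.
  by apply: (ae01S2 _ h3 (chain_repr hc kn)) => s -> ->.
by apply: primv_continuous; exact: L2repr_isL2.
Qed.
End sobolev_functions.

(** * Exponentially weighted norms *)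

Section pointwise.
Context (R : realType) (d : nat).
Implicit Types (u v : 'cV[R[i]]_d).

Lemma hdot_scalar (c : R) u v : hdot (c%:C%:M) u v = c * hdot 1%:M u v.
Proof.
rewrite /hdot mulmx1 mul_mx_scalar -scalemxAl [in LHS]mxE.
by case: ((_ *m v) 0 0) => x y /=; rewrite mul0r subr0.
Qed.

Lemma hdot1_mul (A : 'M[R[i]]_d) u v : hdot 1%:M u (A *m v) = hdot A u v.
Proof. by rewrite /hdot mulmx1 mulmxA. Qed.

(* The arithmetic of the next two lemmas, with p = |A u|^2 and q = |u|^2. *)
Lemma sqnorm_le_arith (M p q a b : R) : 0 < M -> a <= M * p -> b <= M * q ->
  0 <= a - M * p + (- (M * p) - - (M * (M * b))) -> p <= M ^+ 2 * q.
Proof.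
move=> M0 h2 h3 h4; have h5 : M * (M * b) <= M * (M * (M * q)) by rewrite !ler_pM2l.
by rewrite -(ler_pM2l M0); lra.
Qed.
Lemma sqnorm_ge_arith (m p q a : R) : 0 <= m -> m * q <= a ->
  0 <= p - m * a + (- (m * a) - - (m * (m * q))) -> m ^+ 2 * q <= p.
Proof.
move=> m0 h2 h4; have h5 : m * (m * q) <= m * a by rewrite ler_wpM2l.
by lra.
Qed.

(** The form at A u - M u is nonnegative; expanding it, with <A(Au), Au> at most
    M |A u|^2, leaves |A u|^2 <= M <A u, u> <= M^2 |u|^2. *)
Lemma herm_sqnorm_le (m M : R) (A : 'M[R[i]]_d) u : 0 <= m -> 0 < M ->
  herm_bounds m M A -> sqnorm (A *m u) <= M ^+ 2 * sqnorm u.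
Proof.
move=> m0 M0 [hC hb]; set v := A *m u.
have hv : sqnorm v = hdot A v u by rewrite -(hdot1_mul A v u) sqnorm_hdot.
have /andP[h0 _] := hb (v - M%:C *: u).
have h1 : 0 <= hdot A (v - M%:C *: u) (v - M%:C *: u).
  by apply: le_trans h0; rewrite mulr_ge0 // sqnorm_ge0.
move: h1; rewrite !hdotE !(hdotZl, hdotZr) (hC u v) -hv.
have /andP[_ h2] := hb v; have /andP[_ h3] := hb u.
move: h2 h3; move: (sqnorm v) (sqnorm u) (hdot A v v) (hdot A u u) => p q a b h2 h3 h4.
by apply: sqnorm_le_arith h2 h3 h4.
Qed.

(** Expand |A u - m u|^2 >= 0. *)
Lemma herm_sqnorm_ge (m M : R) (A : 'M[R[i]]_d) u : 0 <= m ->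
  herm_bounds m M A -> m ^+ 2 * sqnorm u <= sqnorm (A *m u).
Proof.
move=> m0 [hC hb]; set v := A *m u.
have hv : hdot 1%:M u v = hdot A u u by rewrite hdot1_mul.
have := sqnorm_ge0 (v - m%:C *: u); rewrite sqnorm_hdot !hdotE !(hdotZl, hdotZr).
have hC1 : hdot 1%:M v u = hdot 1%:M u v by have [-> _] := herm_bounds1 R d.
rewrite hC1 hv -!sqnorm_hdot; have /andP[h2 _] := hb u.
by move: h2; move: (sqnorm v) (sqnorm u) (hdot A u u) => p q a; exact: sqnorm_ge_arith.
Qed.

Definition cabs2 (w : R[i]) : R := complex.Re w ^+ 2 + complex.Im w ^+ 2.
Lemma cabs2_ge0 w : 0 <= cabs2 w. Proof. by rewrite addr_ge0 ?sqr_ge0. Qed.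
Lemma cabs2M w w' : cabs2 (w * w') = cabs2 w * cabs2 w'.
Proof. by rewrite /cabs2; case: w w' => a b [p q] /=; ring. Qed.
Lemma cabs2D w w' : cabs2 (w + w') <= 2 * cabs2 w + 2 * cabs2 w'.
Proof. by rewrite /cabs2; case: w w' => a b [p q] /=; have := sqr_ge0 (a - p);
  have := sqr_ge0 (b - q); rewrite !expr2; lra. Qed.
Lemma sqnorm_cabs2 n (v : 'cV[R[i]]_n) : sqnorm v = \sum_i cabs2 (v i 0).
Proof. exact: sqnormE. Qed.

Lemma mulmx_sqnorm_le n (A : 'M[R[i]]_(n, d)) : exists2 C, 0 <= C &
  forall u, sqnorm (A *m u) <= C * sqnorm u.
Proof.
have hs (a : 'I_d -> R[i]) (s : seq 'I_d) : exists2 C, 0 <= C & forall u,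
    cabs2 (\sum_(j <- s) a j * u j 0) <= C * sqnorm u.
  elim: s => [|j s [C C0 IH]].
    by exists 0 => // u; rewrite big_nil mul0r /cabs2 /= expr0n addr0.
  exists (2 * cabs2 (a j) + 2 * C).
    by rewrite addr_ge0 // mulr_ge0 ?cabs2_ge0.
  move=> u; rewrite big_cons; apply: (le_trans (cabs2D _ _)).
  rewrite [leRHS]mulrDl; apply: lerD; last by rewrite -mulrA ler_pM2l.
  rewrite -mulrA ler_pM2l // cabs2M ler_wpM2l ?cabs2_ge0 //.
  by rewrite sqnorm_cabs2 (bigD1 j) //= lerDl sumr_ge0 // => *; exact: cabs2_ge0.
have /choice [C hC] : forall i, exists C, 0 <= C /\ forall u,
    cabs2 (\sum_j A i j * u j 0) <= C * sqnorm u.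
  by move=> i; have [C C0 hC] := hs (A i) (index_enum _); exists C.
exists (\sum_i C i); first by apply: sumr_ge0 => i _; have [] := hC i.
move=> u; rewrite sqnorm_cabs2 mulr_suml; apply: ler_sum => i _.
by rewrite mxE; have [_] := hC i.
Qed.
End pointwise.

Section weighted_norms.
Context (R : realType) (d : nat).
Local Notation I := (unit_itv R).
Local Notation fT := (R -> 'cV[R[i]]_d).
Local Notation X := (L2space R d).
Implicit Types (x y : X) (f g : fT) (a : R).

Definition exp_weight a : R -> 'M[R[i]]_d := fun z => (expR (- a * z))%:C%:M.

Lemma hdot_exp_weight a (z : R) u v : hdot (exp_weight a z) u v = expR (- a * z) * hdot 1%:M u v.
Proof. exact: hdot_scalar. Qed.

Lemma weight_exp a : 0 <= a -> weight (expR (- a)) 1 (exp_weight a).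
Proof.
move=> a0; split; [|exact: expR_gt0|].
  move=> i j; rewrite -/(cmeasurable (fun z => exp_weight a z i j)).
  have [->|ij] := eqVneq i j.
    split; under eq_fun do rewrite /exp_weight mxE eqxx /=; [exact: measurable_exp|exact: measurable_cst].
  by under eq_fun do rewrite /exp_weight mxE (negbTE ij) mulr0n; exact: cmeasurable_cst.
apply: ae01W => z Iz; have /andP[h1 h2] := exp_decay_bounds a0 Iz; split=> [u v|u].
  by rewrite !hdot_exp_weight; have [-> _] := herm_bounds1 R d.
rewrite hdot_exp_weight -sqnorm_hdot; apply/andP; split; apply: ler_wpM2r => //;
  exact: sqnorm_ge0.
Qed.

Definition exp_norm a : X -> R := form_norm (rform (exp_weight a)).

Lemma exp_weight_hilbert a : 0 <= a -> hilbert_form (rform (exp_weight a)).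
Proof. by move=> a0; exact: (rform_hilbert (weight_exp a0)). Qed.

Lemma exp_norm_class a f : 0 <= a -> isL2 f ->
  exp_norm a (L2class f) = Num.sqrt (integral01 (fun z => expR (- a * z) * sqnorm (f z))).
Proof.
move=> a0 hf; rewrite /exp_norm /form_norm (rform_class (weight_exp a0) hf hf).
by congr Num.sqrt; apply: eq_integral01 => z _; rewrite hdot_exp_weight -sqnorm_hdot.
Qed.

Lemma exp_norm_le a C f g : 0 <= a -> 0 <= C -> isL2 f -> isL2 g ->
  ae01 (fun z => sqnorm (f z) <= C ^+ 2 * sqnorm (g z)) ->
  exp_norm a (L2class f) <= C * exp_norm a (L2class g).
Proof.
move=> a0 C0 hf hg h; rewrite !exp_norm_class //.
have /isL2P[_ f2] := hf; have /isL2P[_ g2] := hg.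
have fi := integrable_exp a0 f2; have gi := integrable_exp a0 g2.
rewrite -[C in leRHS](ger0_norm C0) -sqrtr_sqr -sqrtrM ?sqr_ge0 // ler_wsqrtr //.
rewrite -(integral01Z _ gi); apply: integral01_le_ae => //; first exact: integrable01Z.
by apply: (ae01S _ h) => z _ hz; rewrite mulrCA ler_wpM2l // expR_ge0.
Qed.

Lemma primv_weighted_le a f : 0 < a -> isL2 f ->
  integral01 (fun z => expR (- a * z) * sqnorm (primv f z)) <=
  a^-1 * integral01 (fun z => expR (- a * z) * sqnorm (f z)).
Proof.
move=> a0 hf; have a0' := ltW a0.
have ir i := (isL2_Re i hf).2; have ii i := (isL2_Im i hf).2.
have pr i := (prim_L2r (L2r_integrable (isL2_Re i hf))).2.
have pi i := (prim_L2r (L2r_integrable (isL2_Im i hf))).2.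
have er i := integrable_exp a0' (ir i); have ei i := integrable_exp a0' (ii i).
have epr i := integrable_exp a0' (pr i); have epi i := integrable_exp a0' (pi i).
have -> : integral01 (fun z => expR (- a * z) * sqnorm (primv f z)) =
  \sum_i (integral01 (fun z => expR (- a * z) * prim (fun s => complex.Re (f s i 0)) z ^+ 2)
        + integral01 (fun z => expR (- a * z) * prim (fun s => complex.Im (f s i 0)) z ^+ 2)).
  under eq_bigr => i _ do rewrite -(integral01D (epr i) (epi i)).
  rewrite -integral01_sum; last by move=> i; apply: integrable01D.
  apply: eq_integral01 => z _; rewrite sqnormE mulr_sumr; apply: eq_bigr => i _.
  by rewrite primv_Re primv_Im mulrDr.
have -> : integral01 (fun z => expR (- a * z) * sqnorm (f z)) =
  \sum_i (integral01 (fun z => expR (- a * z) * complex.Re (f z i 0) ^+ 2)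
        + integral01 (fun z => expR (- a * z) * complex.Im (f z i 0) ^+ 2)).
  under [RHS]eq_bigr => i _ do rewrite -(integral01D (er i) (ei i)).
  rewrite -integral01_sum; last by move=> i; apply: integrable01D.
  apply: eq_integral01 => z _; rewrite sqnormE mulr_sumr; apply: eq_bigr => i _.
  by rewrite mulrDr.
rewrite mulr_sumr; apply: ler_sum => i _; rewrite mulrDr; apply: lerD.
  exact: prim_weighted_le (isL2_Re i hf).
exact: prim_weighted_le (isL2_Im i hf).
Qed.

(** The factor is small for large a; this makes the Volterra equations below
    contractive. *)
Lemma exp_norm_antideriv a x : 0 < a -> exp_norm a (antideriv x) <= (Num.sqrt a)^-1 * exp_norm a x.
Proof.
move=> a0; have hx := L2repr_isL2 x.
rewrite /antideriv -[x in leRHS]L2class_repr !exp_norm_class ?(ltW a0) //; last exact: primv_L2.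
by rewrite -sqrtrV ?(ltW a0) // -sqrtrM ?invr_ge0 ?(ltW a0) // ler_wsqrtr // primv_weighted_le.
Qed.

Lemma exp_norm_const a (b : 'cV[R[i]]_d) : 0 <= a -> exp_norm a (const_class b) <= Num.sqrt (sqnorm b).
Proof.
move=> a0; rewrite exp_norm_class //; last exact: isL2_cst.
have hb : integrable01 (fun _ : R => sqnorm b) by exact: integrable01_cst.
rewrite ler_wsqrtr // -[leRHS](integral01_cst (R := R)); apply: integral01_le => //.
  exact: integrable_exp.
move=> z Iz; have /andP[_ h2] := exp_decay_bounds a0 Iz.
by rewrite -[leRHS]mul1r ler_wpM2r ?sqnorm_ge0.
Qed.

Definition matrix_op (A : 'M[R[i]]_d) x : X := L2class (fun z => A *m L2repr x z).

Lemma isL2_mulmx (A : 'M[R[i]]_d) f : isL2 f -> isL2 (fun z => A *m f z).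
Proof.
move=> /isL2P[mf hf]; apply/isL2P.
have mA : entrywise (measurable_fun I) (fun z => A *m f z).
  by apply: entrywise_mulmx => //; exact: entrywise_cst.
split=> //; have [C C0 hC] := mulmx_sqnorm_le A.
apply: integrable01_le (integrable01Z C hf); first exact: measurable_sqnorm01.
by move=> z _; rewrite ger0_norm ?sqnorm_ge0.
Qed.

Lemma matrix_op_lin A c x y : matrix_op A (c *: x + y) = c *: matrix_op A x + matrix_op A y.
Proof.
have hx := L2repr_isL2 x; have hy := L2repr_isL2 y.
rewrite /matrix_op -(L2class_lin c (isL2_mulmx A hx) (isL2_mulmx A hy)).
apply: L2class_ae; [exact/isL2_mulmx/L2repr_isL2|by apply: isL2_lin; exact: isL2_mulmx|].
apply: (ae01S2 _ (L2reprD (c *: x) y) (L2reprZ c x)) => s -> ->.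
by rewrite mulmxDr scalemxAr.
Qed.

Lemma matrix_op_mul A B x : matrix_op A (matrix_op B x) = matrix_op (A *m B) x.
Proof.
have hx := L2repr_isL2 x; have hB := isL2_mulmx B hx.
apply: L2class_ae; [exact/isL2_mulmx/L2repr_isL2|exact: isL2_mulmx|].
by apply: (ae01S _ (L2classE hB)) => z _ ->; rewrite mulmxA.
Qed.
Lemma matrix_op1 x : matrix_op 1%:M x = x.
Proof. by rewrite /matrix_op -[RHS]L2class_repr; congr L2class; apply/funext => z; rewrite mul1mx. Qed.

Lemma exp_norm_matrix_op A : exists2 C, 0 <= C & forall a x, 0 <= a -> exp_norm a (matrix_op A x) <= C * exp_norm a x.
Proof.
have [C C0 hC] := mulmx_sqnorm_le A.
exists (Num.sqrt C); first exact: sqrtr_ge0.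
move=> a x a0; have hx := L2repr_isL2 x.
rewrite -[x in leRHS]L2class_repr; apply: exp_norm_le => //; first exact: isL2_mulmx.
by apply: ae01W => z _; rewrite sqr_sqrtr.
Qed.

Section hamiltonian.
Context (m M : R) (H : R -> 'M[R[i]]_d) (hH : weight m M H) (M0 : 0 < M).
Let m0 : 0 < m. Proof. by case: hH. Qed.
Let bH : ae01 (fun z => herm_bounds m M (H z)). Proof. by case: hH. Qed.

Lemma isL2_Hmul f : isL2 f -> isL2 (fun z => H z *m f z).
Proof.
move=> /isL2P[mf hf]; apply/isL2P.
have mHf : entrywise (measurable_fun I) (fun z => H z *m f z).
  by apply: entrywise_mulmx => //; case: hH.
split=> //.
apply: integrable01_le_ae (integrable01Z (M ^+ 2) hf); first exact: measurable_sqnorm01.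
apply: (ae01S _ bH) => z _ hz; rewrite ger0_norm ?sqnorm_ge0 //.
by apply: herm_sqnorm_le hz => //; exact: ltW.
Qed.

Definition Hop x : X := L2class (Hmul H x).

Lemma isL2_HmulX x : isL2 (Hmul H x).
Proof. exact/isL2_Hmul/L2repr_isL2. Qed.

Lemma Hop_lin c x y : Hop (c *: x + y) = c *: Hop x + Hop y.
Proof.
rewrite /Hop -(L2class_lin c (isL2_HmulX x) (isL2_HmulX y)).
apply: L2class_ae; [exact: isL2_HmulX|by apply: isL2_lin; exact: isL2_HmulX|].
apply: (ae01S2 _ (L2reprD (c *: x) y) (L2reprZ c x)) => s; rewrite /Hmul => -> ->.
by rewrite mulmxDr scalemxAr.
Qed.
Lemma HopB x y : Hop (x - y) = Hop x - Hop y.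
Proof. by rewrite -scaleN1r addrC Hop_lin scaleN1r addrC. Qed.

Lemma exp_norm_Hop_le a x : 0 <= a -> exp_norm a (Hop x) <= M * exp_norm a x.
Proof.
move=> a0; rewrite -[x in leRHS]L2class_repr; apply: exp_norm_le => //.
- exact: ltW.
- exact: isL2_HmulX.
- exact: L2repr_isL2.
- by apply: (ae01S _ bH) => z _ hz; apply: herm_sqnorm_le hz => //; exact: ltW.
Qed.
Lemma exp_norm_Hop_ge a x : 0 <= a -> exp_norm a x <= m^-1 * exp_norm a (Hop x).
Proof.
move=> a0; rewrite -[x in leLHS]L2class_repr; apply: exp_norm_le => //.
- by rewrite invr_ge0 ltW.
- exact: L2repr_isL2.
- exact: isL2_HmulX.
- apply: (ae01S _ bH) => z _ hz; have := herm_sqnorm_ge (L2repr x z) (ltW m0) hz.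
  move=> h.
  by rewrite exprVn mulrC ler_pdivlMr ?exprn_gt0 // mulrC.
Qed.

(** H is coercive, so Lax-Milgram applies in L2 with the weight exp(-0 z) = 1. *)
Lemma Hop_surjective y : exists x, Hop x = y.
Proof.
have h0 : (0 : R) <= 0 by [].
apply: (coercive_surjective (exp_weight_hilbert h0) m0 HopB (fun x => exp_norm_Hop_le x h0)) => x.
have hx := L2repr_isL2 x.
rewrite (nrm_sqr (exp_weight_hilbert h0)).
rewrite (rform_ae (weight_exp h0) (isL2_HmulX x) hx (L2classE (isL2_HmulX x)) (ae01W (fun _ _ => erefl))).
rewrite rformE.
have E z u v : hdot (exp_weight 0 z) u v = hdot 1%:M u v.
  by rewrite hdot_exp_weight oppr0 mul0r expR0 mul1r.
under eq_integral01 do rewrite E -sqnorm_hdot.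
have h1 := integrable_sqn x; have h2 := integrable_hdot hH hx hx.
under [leRHS]eq_integral01 do rewrite E.
rewrite -(integral01Z m h1); apply: integral01_le_ae.
- exact: integrable01Z.
- have := integrable_hdot (weight_exp h0) (isL2_HmulX x) hx.
  by congr integrable01; apply/funext => z; rewrite E.
- apply: (ae01S _ bH) => z _ [hC hb].
  have [-> _] := herm_bounds1 R d; rewrite /Hmul hdot1_mul.
  by have /andP[] := hb (L2repr x z).
Qed.
End hamiltonian.

Lemma weight_norm_le m M H m' M' H' x : weight m M H -> weight m' M' H' -> 0 <= M ->
  form_norm (rform H) x <= Num.sqrt (M / m') * form_norm (rform H') x.
Proof.
move=> w w' M0; have m'0 : 0 < m' by case: w'.
rewrite /form_norm -sqrtrM ?divr_ge0 ?(ltW m'0) // ler_wsqrtr //.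
have /andP[_ h1] := rform_bounds w x; have /andP[h2 _] := rform_bounds w' x.
apply: (le_trans h1); rewrite -mulrA ler_wpM2l // mulrC ler_pdivlMr // mulrC //.
Qed.
End weighted_norms.

(** * The initial value problem *)

Lemma injective_linear_surjective (F : fieldType) p q (f : 'cV[F]_p -> 'cV[F]_q) :
  p = q -> (forall a u v, f (a *: u + v) = a *: f u + f v) ->
  (forall u, f u = 0 -> u = 0) -> forall w, exists u, f u = w.
Proof.
move=> pq flin finj w.
have f0 : f 0 = 0 by have := flin (-1) 0 0; rewrite scaler0 addr0 scaleN1r addNr.
have fsum (s : seq 'I_p) (c : 'I_p -> F) (u : 'I_p -> 'cV[F]_p) :
    f (\sum_(j <- s) c j *: u j) = \sum_(j <- s) c j *: f (u j).
  by elim: s => [|j s IH]; rewrite ?big_nil // !big_cons flin IH.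
pose A : 'M[F]_(q, p) := \matrix_(i, j) f (delta_mx j 0) i 0.
have fE u : f u = A *m u.
  rewrite {1}(matrix_sum_delta u) (eq_bigr (fun j => u j 0 *: delta_mx j 0)); last first.
    by move=> j _; rewrite big_ord_recl big_ord0 addr0.
  rewrite fsum; apply/matrixP => i k; rewrite (ord1 k) summxE mxE.
  by apply: eq_bigr => j _; rewrite !mxE mulrC.
have free : row_free A^T.
  rewrite -kermx_eq0; apply/eqP/row_matrixP => i; rewrite row0.
  have : (row i (kermx A^T)) *m A^T = 0 by rewrite -row_mul mulmx_ker row0.
  move/(congr1 trmx); rewrite trmx_mul trmxK trmx0 -fE => /finj /(congr1 trmx).
  by rewrite trmxK trmx0.
have full : row_full A^T by rewrite /row_full (eqP free); exact/eqP.
have /submxP [D hD] := submx_full w^T full.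
by exists D^T; rewrite fE -[A]trmxK -trmx_mul -hD trmxK.
Qed.

Section classes.
Context (R : realType) (d : nat).
Local Notation X := (L2space R d).

Lemma L2class_sum (J : Type) (s : seq J) (F : J -> R -> 'cV[R[i]]_d) :
  (forall j, isL2 (F j)) ->
  L2class (fun z => \sum_(j <- s) F j z) = \sum_(j <- s) L2class (F j).
Proof.
move=> hF; elim: s => [|j s IH].
  rewrite big_nil; apply: L2class_eq.
    by under eq_fun do rewrite big_nil; exact: isL2_0.
  by apply: (ae01S _ (L2repr0 R d)) => z _ ->; rewrite big_nil.
rewrite big_cons -IH -[L2class (F j)]scale1r -(L2class_lin 1 (hF j) (isL2_sum _ hF)).
by congr L2class; apply/funext => z; rewrite big_cons scale1r.
Qed.

Lemma matrix_op_class A (f : R -> 'cV[R[i]]_d) : isL2 f ->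
  matrix_op A (L2class f) = L2class (fun z => A *m f z).
Proof.
move=> hf; apply: L2class_ae; [exact/isL2_mulmx/L2repr_isL2|exact: isL2_mulmx|].
by apply: (ae01S _ (L2classE hf)) => z _ ->.
Qed.

Lemma L2class_comb n (A : nat -> 'M[R[i]]_d) (F : nat -> R -> 'cV[R[i]]_d) (Y : nat -> X) :
  (forall k, (k < n)%N -> isL2 (F k) /\ L2class (F k) = Y k) ->
  L2class (fun z => \sum_(k < n) A k *m F k z) = \sum_(k < n) matrix_op (A k) (Y k).
Proof.
move=> h; rewrite (@L2class_sum 'I_n (index_enum 'I_n) (fun k z => A k *m F k z)).
  by apply: eq_bigr => k _; have [h1 <-] := h k (ltn_ord k); rewrite (matrix_op_class (A k) h1).
by move=> k; apply: isL2_mulmx; have [] := h k (ltn_ord k).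
Qed.

Lemma lin_additive (f : X -> X) : (forall a x y, f (a *: x + y) = a *: f x + f y) ->
  [/\ f 0 = 0, forall x y, f (x - y) = f x - f y & forall x y, f (x + y) = f x + f y].
Proof.
move=> h; have h0 : f 0 = 0 by have := h (-1) 0 0; rewrite scaler0 addr0 scaleN1r addNr.
split=> // x y; last by rewrite -{1}(scale1r x) h scale1r.
by rewrite -scaleN1r addrC h scaleN1r addrC.
Qed.
End classes.

Lemma Phi_lin (R : realType) N d (c : R[i]) (y1 y2 y3 : R -> 'cV[R[i]]_d) :
  (forall k z, (k < N)%N -> 0 <= z <= 1 -> trace k y3 z = c *: trace k y1 z + trace k y2 z) ->
  Phi N y3 = c *: Phi N y1 + Phi N y2.
Proof.
move=> h; rewrite /Phi scale_col_mx add_col_mx.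
have e z : 0 <= z <= 1 -> \mxcol_(k < N) trace k y3 z =
    c *: (\mxcol_(k < N) trace k y1 z) + \mxcol_(k < N) trace k y2 z.
  move=> z01; apply/matrixP => i j; rewrite !mxE h // !mxE //.
by rewrite !e ?lexx ?ler01.
Qed.

Lemma scaled_mulmx_lin (F : comPzRingType) p q (A : 'M[F]_(p, q)) (s c : F) (u v : 'cV[F]_q) :
  s *: (A *m (c *: u + v)) = c *: (s *: (A *m u)) + s *: (A *m v).
Proof. by rewrite mulmxDr scalerDr -scalemxAr !scalerA mulrC. Qed.

Section port_hamiltonian_operator.
Context (R : realType) (N d : nat) (hN : (1 <= N)%N).
Context (P : nat -> 'M[R[i]]_d) (hPN : P N \in unitmx).
Context (m M : R) (H : R -> 'M[R[i]]_d) (hH : weight m M H) (M0 : 0 < M).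
Local Notation X := (L2space R d).
Implicit Types (x f : X) (Y : nat -> X) (b : nat -> 'cV[R[i]]_d).
Let m0 : 0 < m. Proof. by case: hH. Qed.

(** The derivatives of H x up to order N, together with their values at 0. *)
Definition jet x Y b : Prop := Y 0%N = Hop H x /\ primitive_chain N Y b.

Lemma dom_jet x : dom_A0 N H x -> exists Y b, jet x Y b.
Proof. by move=> /sobolev_chain [Y [b [Y0 hY]]]; exists Y, b. Qed.

Lemma jet_dom x Y b : jet x Y b -> dom_A0 N H x.
Proof. by move=> [Y0 hY]; apply: chain_sobolev hY => //; exact: isL2_HmulX hH M0 _. Qed.

Lemma jet_trace x Y b k z : jet x Y b -> (k < N)%N -> 0 <= z <= 1 ->
  trace k (Hmul H x) z = b k + primv (L2repr (Y k.+1)) z.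
Proof. by move=> [Y0 hY]; apply: chain_trace hY => //; exact: isL2_HmulX hH M0 _. Qed.

Lemma jet_trace0 x Y b k : jet x Y b -> (k < N)%N -> trace k (Hmul H x) 0 = b k.
Proof. by move=> hs kN; rewrite (jet_trace hs kN) ?lexx ?ler01 // primv_at0 addr0. Qed.

Lemma jet_A0 x Y b : jet x Y b -> A0 N P H x = \sum_(k < N.+1) matrix_op (P k) (Y k).
Proof.
move=> [Y0 hY]; have hL := isL2_HmulX hH M0 x.
apply: (@L2class_comb _ _ N.+1 P (fun k => weak_derivn k (Hmul H x)) Y) => k kN.
exact: (chain_derivn hL (esym Y0) hY kN).
Qed.

Lemma jet_lin c x Y b x' Y' b' : jet x Y b -> jet x' Y' b' ->
  jet (c *: x + x') (fun k => c *: Y k + Y' k) (fun k => c *: b k + b' k).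
Proof.
move=> [Y0 hY] [Y0' hY']; split; first by rewrite Y0 Y0' (Hop_lin hH M0).
move=> k kN; rewrite (hY k kN) (hY' k kN) const_class_lin antideriv_lin scalerDr.
by rewrite addrACA.
Qed.

Lemma A0_lin c x x' : dom_A0 N H x -> dom_A0 N H x' ->
  dom_A0 N H (c *: x + x') /\ A0 N P H (c *: x + x') = c *: A0 N P H x + A0 N P H x'.
Proof.
move=> /dom_jet [Y [b hs]] /dom_jet [Y' [b' hs']]; have h := jet_lin c hs hs'.
split; first exact: jet_dom h.
rewrite (jet_A0 h) (jet_A0 hs) (jet_A0 hs') scaler_sumr -big_split /=.
by apply: eq_bigr => k _; rewrite matrix_op_lin.
Qed.

Lemma trace_lin c x x' k z : dom_A0 N H x -> dom_A0 N H x' -> (k < N)%N -> 0 <= z <= 1 ->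
  trace k (Hmul H (c *: x + x')) z = c *: trace k (Hmul H x) z + trace k (Hmul H x') z.
Proof.
move=> /dom_jet [Y [b hs]] /dom_jet [Y' [b' hs']] kN z01; have h := jet_lin c hs hs'.
rewrite (jet_trace h) // (jet_trace hs) // (jet_trace hs') // scalerDr addrACA; congr (_ + _).
rewrite -(primv_lin c z (L2repr_isL2 _) (L2repr_isL2 _)).
apply: primv_ae; [exact: L2repr_isL2|apply: isL2_lin; exact: L2repr_isL2|].
by apply: (ae01S2 _ (L2reprD (c *: Y k.+1) (Y' k.+1)) (L2reprZ c (Y k.+1))) => s -> ->.
Qed.

Lemma port_lin c x x' : dom_A0 N H x -> dom_A0 N H x' ->
  port_variables N P H (c *: x + x') = c *: port_variables N P H x + port_variables N P H x'.
Proof.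
move=> hx hx'; have hPhi := @Phi_lin _ N _ c (Hmul H x) (Hmul H x') (Hmul H (c *: x + x'))
  (fun k z => @trace_lin c x x' k z hx hx').
rewrite /port_variables hPhi; exact: scaled_mulmx_lin.
Qed.

(** By descending induction on k: each integration gains s = 1 / sqrt a <= 1 and
    adds one initial value. *)
Lemma chain_bound a be Y b : 1 <= a -> primitive_chain N Y b ->
  (forall k, (k < N)%N -> Num.sqrt (sqnorm (b k)) <= be) ->
  forall k, (k < N)%N -> exp_norm a (Y k) <= N%:R * be + (Num.sqrt a)^-1 * exp_norm a (Y N).
Proof.
move=> a1 hY hb; have a0 : 0 < a by apply: lt_le_trans a1.
have hw := exp_weight_hilbert d (ltW a0).
have be0 : 0 <= be by apply: le_trans (hb 0%N hN); exact: sqrtr_ge0.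
set s := (Num.sqrt a)^-1.
have s0 : 0 <= s by rewrite invr_ge0 sqrtr_ge0.
have s1 : s <= 1.
  by rewrite invf_le1 ?sqrtr_gt0 // -sqrtr1 ler_wsqrtr.
have step k : (k < N)%N -> exp_norm a (Y k) <= be + s * exp_norm a (Y k.+1).
  move=> kN; rewrite (hY k kN); apply: (le_trans (nrm_triangle hw _ _)).
  apply: lerD; last exact: exp_norm_antideriv.
  by apply: le_trans (hb k kN); exact: exp_norm_const (ltW a0).
have key j : (j < N)%N -> exp_norm a (Y (N - j.+1)%N) <= j.+1%:R * be + s * exp_norm a (Y N).
  elim: j => [|j IH] jN.
    by rewrite mul1r -{2}(subnK jN) addn1; apply: step; rewrite subn1 prednK.
  have h1 := step (N - j.+2)%N (ltac:(by rewrite ltn_subrL hN)).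
  rewrite subnSK // in h1; apply: (le_trans h1).
  have h2 := IH (ltnW jN).
  have h3 : s * exp_norm a (Y (N - j.+1)%N) <= j.+1%:R * be + s * exp_norm a (Y N).
    apply: le_trans h2; rewrite -[leRHS]mul1r ler_wpM2r //; exact: nrm_ge0.
  by rewrite -[in leRHS]natr1 mulrDl mul1r; lra.
move=> k kN; have kE : k = (N - (N - k.+1).+1)%N by rewrite subnSK // subKn // ltnW.
rewrite {1}kE; apply: (le_trans (key _ _)); first by rewrite ltn_subrL hN.
by rewrite lerD2r ler_wpM2r // ler_nat subnSK // leq_subr.
Qed.

Lemma lower_terms_bound : exists2 C, 0 <= C & forall a Y (t : R), 0 <= a -> 
  (forall k, (k < N)%N -> exp_norm a (Y k) <= t) ->
  exp_norm a (matrix_op (invmx (P N)) (\sum_(k < N) matrix_op (P k) (Y k))) <= C * t.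
Proof.
have [C0 C00 hC0] := exp_norm_matrix_op (invmx (P N)).
have /choice [C hC] : forall k : 'I_N, exists C, 0 <= C /\ forall a x, 0 <= a ->
    exp_norm a (matrix_op (P k) x) <= C * exp_norm a x.
  by move=> k; have [C ? ?] := exp_norm_matrix_op (P k); exists C.
exists (C0 * \sum_k C k).
  by rewrite mulr_ge0 // sumr_ge0 // => k _; have [] := hC k.
move=> a Y t a0 ht; apply: (le_trans (hC0 a _ a0)); rewrite -mulrA ler_wpM2l //.
have hw := exp_weight_hilbert d a0.
have tri (s : seq 'I_N) : exp_norm a (\sum_(k <- s) matrix_op (P k) (Y k)) <= \sum_(k <- s) exp_norm a (matrix_op (P k) (Y k)).
  elim: s => [|k s IH]; first by rewrite !big_nil /exp_norm (nrm0 hw).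
  by rewrite !big_cons; apply: (le_trans (nrm_triangle hw _ _)); rewrite lerD2l.
apply: (le_trans (tri _)); rewrite mulr_suml; apply: ler_sum => k _.
have [Ck0 hk] := hC k; apply: (le_trans (hk a _ a0)).
by rewrite ler_wpM2l // ht.
Qed.

Definition traces_norm b : R := Num.sqrt (\sum_(k < N) sqnorm (b k)).

Lemma traces_norm_ge b k : (k < N)%N -> Num.sqrt (sqnorm (b k)) <= traces_norm b.
Proof.
move=> kN; rewrite ler_wsqrtr // (bigD1 (Ordinal kN)) //= lerDl sumr_ge0 // => *.
exact: sqnorm_ge0.
Qed.

Lemma jet_top x Y b : jet x Y b ->
  Y N = matrix_op (invmx (P N)) (A0 N P H x) - matrix_op (invmx (P N)) (\sum_(k < N) matrix_op (P k) (Y k)).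
Proof.
move=> hs; have [_ MB _] := lin_additive (matrix_op_lin (invmx (P N))).
rewrite -MB (jet_A0 hs) big_ord_recr /= addrC addrK matrix_op_mul mulVmx // matrix_op1 //.
Qed.

(** Insert [chain_bound] in [jet_top]: the lower order terms contribute
    C1 s |Y_N| to |Y_N|, and this is absorbed in the left side as soon as
    2 C1 s <= 1. *)
Lemma a_priori : exists C3 C4 a0, [/\ 0 <= C3, 0 <= C4, 1 <= a0 &
  forall a x Y b, a0 <= a -> jet x Y b ->
    exp_norm a x <= C3 / Num.sqrt a * exp_norm a (A0 N P H x) + C4 * traces_norm b].
Proof.
have [C0 C00 hC0] := exp_norm_matrix_op (invmx (P N)).
have [C1 C10 hC1] := lower_terms_bound.
pose C4 := m^-1 * (N%:R + 2 * C1 * N%:R).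
pose a0 := (2 * C1 + 1) ^+ 2.
have a01 : 1 <= a0 by rewrite /a0 expr2; nra.
exists (m^-1 * (2 * C0)), C4, a0; split=> //.
- by rewrite !mulr_ge0 // invr_ge0 ltW.
- by rewrite mulr_ge0 ?invr_ge0 ?(ltW m0) // addr_ge0 // !mulr_ge0.
move=> a x Y b ha hs; have [Y0 hY] := hs.
have a1 : 1 <= a by apply: le_trans ha.
have ap : 0 < a by apply: lt_le_trans a1.
have hw := exp_weight_hilbert d (ltW ap).
set s := (Num.sqrt a)^-1; set be := traces_norm b.
have be0 : 0 <= be by exact: sqrtr_ge0.
have s0 : 0 < s by rewrite invr_gt0 sqrtr_gt0.
have s1 : s <= 1 by rewrite invf_le1 ?sqrtr_gt0 // -sqrtr1 ler_wsqrtr.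
have sC : s * (2 * C1) <= 1.
  rewrite mulrC -ler_pdivlMr // invrK mul1r.
  apply: (@le_trans _ _ (Num.sqrt a0)); last by rewrite ler_wsqrtr.
  by rewrite sqrtr_sqr ger0_norm ?lerDl // addr_ge0 // mulr_ge0.
have hb k : (k < N)%N -> exp_norm a (Y k) <= N%:R * be + s * exp_norm a (Y N).
  move=> kN; apply: (chain_bound a1 hY _ kN) => j jN; exact: traces_norm_ge.
have hv : exp_norm a (Y N) <= C0 * exp_norm a (A0 N P H x) + C1 * (N%:R * be + s * exp_norm a (Y N)).
  rewrite {1}(jet_top hs); apply: (le_trans (nrm_triangleB hw _ _)).
  by apply: lerD; [exact: hC0 (ltW ap)|exact: hC1 (ltW ap) hb].
have hx : exp_norm a x <= m^-1 * (N%:R * be + s * exp_norm a (Y N)).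
  apply: (le_trans (exp_norm_Hop_ge hH M0 x (ltW ap))); rewrite ler_wpM2l ?invr_ge0 ?(ltW m0) //.
  by rewrite -Y0; exact: hb.
apply: (le_trans hx); rewrite /C4 -!mulrA -mulrDr ler_wpM2l ?invr_ge0 ?(ltW m0) //.
have vN : 0 <= exp_norm a (Y N) by exact: nrm_ge0.
have N0 : (0 : R) <= N%:R by exact: ler0n.
move: hv vN; rewrite -/s; move: (exp_norm a (Y N)) (exp_norm a (A0 N P H x)) => v w hv vN.
have h1 : s * (2 * C1) * v <= 1 * v by rewrite ler_wpM2r.
have hv2 : v <= 2 * C0 * w + 2 * C1 * (N%:R * be) by lra.
have h2 : s * v <= s * (2 * C0 * w + 2 * C1 * (N%:R * be)) by rewrite ler_wpM2l // ltW.
have h3 : s * (2 * C1 * (N%:R * be)) <= 1 * (2 * C1 * (N%:R * be)).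
  by rewrite ler_wpM2r // !mulr_ge0.
lra.
Qed.

(** The derivative of order N - j, obtained from the one of order N. *)
Fixpoint iterated_primitives b (v : X) (j : nat) : X :=
  if j is j'.+1 then const_class (b (N - j)%N) + antideriv (iterated_primitives b v j') else v.

Lemma iterated_primitivesS b v j : iterated_primitives b v j.+1 = const_class (b (N - j.+1)%N) + antideriv (iterated_primitives b v j).
Proof. by []. Qed.

Lemma iterated_primitives_chain b v : primitive_chain N (fun k => iterated_primitives b v (N - k)) b.
Proof.
move=> k kN; have kE : (N - (N - k.+1).+1 = k)%N by rewrite subnSK // subKn // ltnW.
transitivity (iterated_primitives b v (N - k.+1).+1); first by congr iterated_primitives; rewrite subnSK.
by rewrite iterated_primitivesS kE.
Qed.

Lemma iterated_primitives_lin c b v b' v' j :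
  iterated_primitives (fun k => c *: b k + b' k) (c *: v + v') j = c *: iterated_primitives b v j + iterated_primitives b' v' j.
Proof.
elim: j => [//|j IH].
by rewrite (iterated_primitivesS _ _ j) (iterated_primitivesS b) (iterated_primitivesS b') IH const_class_lin antideriv_lin scalerDr addrACA.
Qed.

(** The unknown is the top derivative v = Y_N, with the lower ones recovered as
    iterated primitives. The equation
    v = P_N^-1 (f - sum_(k < N) P_k Y_k(v, b)) is affine in v, and its linear
    part S is a contraction in the norm with the weight exp(-a z), a large. *)
Lemma ivp_exists f b : exists x Y, jet x Y b /\ A0 N P H x = f.
Proof.
have [C1 C10 hC1] := lower_terms_bound.
pose a := (2 * C1 + 1) ^+ 2.
have a1 : 1 <= a by rewrite /a expr2; nra.
have ap : 0 < a by apply: lt_le_trans a1.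
have hw := exp_weight_hilbert d (ltW ap).
set s := (Num.sqrt a)^-1.
have sC : C1 * s <= 2^-1.
  rewrite /s /a sqrtr_sqr ger0_norm; last by rewrite addr_ge0 // mulr_ge0.
  by rewrite ler_pdivrMr; lra.
pose Q b v := \sum_(k < N) matrix_op (P k) (iterated_primitives b v (N - k)).
(* Q b v is the sum of the lower order terms; S is the part that depends on v *)
pose S v := - matrix_op (invmx (P N)) (Q (fun=> 0) v).
have [M00 MB MD] := lin_additive (matrix_op_lin (invmx (P N))).
have QD b1 v1 v2 : Q b1 (v1 + v2) = Q b1 v1 + Q (fun=> 0) v2.
  rewrite /Q -big_split; apply: eq_bigr => k _ /=.
  have e : (fun k => 1 *: (fun=> 0) k + b1 k) = b1.
    by apply/funext => i; rewrite scaler0 add0r.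
  have := iterated_primitives_lin 1 (fun=> 0) v2 b1 v1 (N - k); rewrite e !scale1r => e2; rewrite (addrC v1) e2.
  have [_ _ PkD] := lin_additive (matrix_op_lin (P k)).
  exact: etrans (PkD _ _) (addrC _ _).
have SB v1 v2 : S (v1 - v2) = S v1 - S v2.
  have e : S v1 = S (v1 - v2) + S v2.
    by rewrite /S -{1}(subrK v2 v1) QD MD opprD.
  by rewrite e addrK.
have Sq v : exp_norm a (S v) <= 2^-1 * exp_norm a v.
  rewrite /S /exp_norm (nrmN hw) -/(exp_norm a _).
  have h := @chain_bound a 0 _ _ a1 (iterated_primitives_chain (fun=> 0) v).
  have /h h2 : forall k, (k < N)%N -> Num.sqrt (sqnorm ((fun=> 0) k : 'cV[R[i]]_d)) <= 0.
    by move=> k _; rewrite /= sqnorm0 sqrtr0.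
  apply: (le_trans (hC1 a _ _ (ltW ap) h2)).
  rewrite mulr0 add0r subnn /= mulrA; apply: ler_wpM2r => //; exact: nrm_ge0.
have q1 : 2^-1 < 1 :> R by lra.
have [v hv] := contraction_fixpoint hw (matrix_op (invmx (P N)) (f - Q b 0)) q1 SB Sq.
pose Y k := iterated_primitives b v (N - k).
have [x hx] := Hop_surjective hH M0 (Y 0%N).
have hs : jet x Y b by split; [exact/esym|exact: iterated_primitives_chain].
exists x, Y; split=> //.
rewrite (jet_A0 hs) big_ord_recr /= /Y subnn /=.
have -> : \sum_(k < N) matrix_op (P k) (iterated_primitives b v (N - k)) = Q b 0 + Q (fun=> 0) v.
  by rewrite -QD add0r.
have [MN0 MNB MND] := lin_additive (matrix_op_lin (P N)).
have MV u : matrix_op (P N) (matrix_op (invmx (P N)) u) = u by rewrite matrix_op_mul mulmxV // matrix_op1.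
move: hv; rewrite /S; move: (Q b 0) (Q (fun=> 0) v) => q0 qv hv.
have -> : matrix_op (P N) v = f - q0 - qv.
  by rewrite {1}hv MND MV -[- matrix_op _ qv]sub0r MNB MN0 sub0r MV.
by rewrite addrC -!addrA [- qv + _]addrCA addNr addr0 addNr addr0.
Qed.

Lemma jet_eq0 x Y b : jet x Y b -> A0 N P H x = 0 ->
  (forall k, (k < N)%N -> b k = 0) -> x = 0.
Proof.
move=> hs h0 hb; have [C3 [C4 [a [C30 C40 a1 h]]]] := a_priori.
have ap : 0 < a by apply: lt_le_trans a1.
have hw := exp_weight_hilbert d (ltW ap).
have := h a x Y b (lexx _) hs; rewrite h0 /exp_norm (nrm0 hw) mulr0 add0r.
have -> : traces_norm b = 0.
  by rewrite /traces_norm big1 ?sqrtr0 // => k _; rewrite hb // sqnorm0.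
rewrite mulr0 => hx; apply: (nrm_eq0 hw); apply/eqP; rewrite eq_le hx; exact: nrm_ge0.
Qed.
End port_hamiltonian_operator.

(** * Boundary dissipation and the inverse operator *)

Lemma linear_inverse (F : nzRingType) (V : lmodType F) (D : set V) (A : V -> V) :
  (forall c x y, D x -> D y -> D (c *: x + y) /\ A (c *: x + y) = c *: A x + A y) ->
  (forall x, D x -> A x = 0 -> x = 0) -> (forall y, exists x, D x /\ A x = y) ->
  exists K : {linear V -> V}, forall x y, (D x /\ A x = y) <-> x = K y.
Proof.
move=> lin inj /choice [k hk].
have uniq x y : D x -> A x = y -> x = k y.
  move=> Dx Ax; have [Dk Ak] := hk y; have [h1 h2] := lin (-1) (k y) x Dk Dx.
  apply/eqP; rewrite -subr_eq0 -scaleN1r addrC; apply/eqP/inj => //.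
  by rewrite h2 Ak Ax scaleN1r addNr.
have klin : linear k.
  move=> c x y; have [Dx Ax] := hk x; have [Dy Ay] := hk y.
  have [h1 h2] := lin c _ _ Dx Dy; apply/esym/uniq => //.
  by rewrite h2 Ax Ay.
pose mk := GRing.isLinear.Build F V V *:%R k klin.
pose K : {linear V -> V} := HB.pack k mk.
exists K => x y; split=> [[]|->]; first exact: uniq.
exact: hk.
Qed.

(** If |K f| <= c beta + g |f| while kappa beta^2 <= |K f| |f|, then
    beta <= (1 + (c + g) / kappa) |f|: either beta <= |f|, or |K f| is at most
    (c + g) beta and one factor beta cancels. *)
Lemma boundary_bound (R : realFieldType) (kappa c g k n be : R) : 0 < kappa -> 0 <= c ->
  0 <= g -> 0 <= n -> 0 <= be -> k <= c * be + g * n -> kappa * be ^+ 2 <= k * n ->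
  k <= (c * (1 + (c + g) / kappa) + g) * n.
Proof.
move=> kp c0 g0 n0 be0 h1 h2.
have q0 : 0 <= (c + g) / kappa by rewrite divr_ge0 ?addr_ge0 // ltW.
suff : be <= (1 + (c + g) / kappa) * n by move=> h; have := ler_wpM2l c0 h; lra.
have [bn|nb] := leP be n.
  by rewrite mulrDl mul1r (le_trans bn) // lerDl mulr_ge0.
have b0 : 0 < be by exact: le_lt_trans nb.
suff : be <= (c + g) / kappa * n by move=> h; rewrite mulrDl mul1r (le_trans h) // lerDr.
rewrite mulrAC ler_pdivlMr // mulrC -(ler_pM2r b0) -mulrA -expr2 (le_trans h2) //.
have h3 : k <= (c + g) * be.
  by rewrite (le_trans h1) // mulrDl lerD2l ler_wpM2l // ltW.
by rewrite (le_trans (ler_wpM2r n0 h3)) // mulrAC.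
Qed.

Lemma ker_lin (F : comPzRingType) p q (B : 'M[F]_(p, q)) (c : F) (u v w : 'cV[F]_q) :
  B *m u = 0 -> B *m v = 0 -> w = c *: u + v -> B *m w = 0.
Proof. by move=> hu hv ->; rewrite mulmxDr -scalemxAr hu hv scaler0 addr0. Qed.

Lemma ker_compensate (F : comPzRingType) p q (B : 'M[F]_(p, q)) (u v w : 'cV[F]_q) :
  B *m u = - (B *m v) -> w = 1 *: u + v -> B *m w = 0.
Proof. by move=> h ->; rewrite mulmxDr scale1r h addNr. Qed.

Section boundary_damped_operator.
Context (R : realType) (N d : nat) (hN : (1 <= N)%N).
Context (P : nat -> 'M[R[i]]_d) (hPN : P N \in unitmx).
Context (m M : R) (H : R -> 'M[R[i]]_d) (hH : weight m M H) (M0 : 0 < M).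
Context (W : 'M[R[i]]_(N * d, \sum_(k < N) d + \sum_(k < N) d)).
Context (kappa : R) (kappa0 : 0 < kappa).
Local Notation X := (L2space R d).
Local Notation r := (rform H).
Local Notation A := (A0 N P H).
Local Notation D := (dom_A P H W).
Local Notation jet := (jet N H).
Definition boundary x : R := Num.sqrt (\sum_(k < N) sqnorm (trace k (Hmul H x) 0)).
Hypothesis diss : forall x, D x -> r (A x) x <= - kappa * boundary x ^+ 2.
Let hr : hilbert_form r := rform_hilbert hH.
Implicit Types (x f : X) (Y : nat -> X) (b : nat -> 'cV[R[i]]_d).

Lemma boundary_jet x Y b : jet x Y b -> boundary x = traces_norm N b.
Proof.
move=> hs; congr Num.sqrt; apply: eq_bigr => k _.
by rewrite (jet_trace0 hH M0 hs).
Qed.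

Lemma D_lin c x y : D x -> D y -> D (c *: x + y) /\ A (c *: x + y) = c *: A x + A y.
Proof.
move=> [Dx Wx] [Dy Wy]; have [h1 h2] := A0_lin P hH M0 c Dx Dy.
exact: (conj (conj h1 (ker_lin Wx Wy (port_lin P hH M0 c Dx Dy))) h2).
Qed.

Lemma boundary_eq0 x k : boundary x = 0 -> (k < N)%N -> trace k (Hmul H x) 0 = 0.
Proof.
move=> /eqP; rewrite sqrtr_eq0 => h kN; apply: sqnorm_eq0.
have /eqP : \sum_(k < N) sqnorm (trace k (Hmul H x) 0) = 0.
  by apply/eqP; rewrite eq_le h sumr_ge0 // => i _; exact: sqnorm_ge0.
rewrite psumr_eq0 => [/allP /(_ (Ordinal kN) (mem_index_enum _)) /eqP //|i _].
exact: sqnorm_ge0.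
Qed.

Lemma boundary_ge0 x : 0 <= boundary x. Proof. exact: sqrtr_ge0. Qed.

Lemma ker_boundary x : D x -> A x = 0 -> boundary x = 0.
Proof.
move=> Dx Ax; have := diss Dx; rewrite Ax (form0l hr) mulNr oppr_ge0.
rewrite pmulr_rle0 // => h; apply/eqP.
by rewrite -sqrf_eq0 eq_le h sqr_ge0.
Qed.

Lemma A_injective x : D x -> A x = 0 -> x = 0.
Proof.
move=> Dx Ax; have bx := ker_boundary Dx Ax; have [hx _] := Dx.
have [Y [b hs]] := dom_jet hx.
apply: (jet_eq0 hN hPN hH M0 hs Ax) => k kN.
by rewrite -(jet_trace0 hH M0 hs kN) boundary_eq0.
Qed.

Definition ivp b x f : Prop := (exists Y, jet x Y b) /\ A x = f.

Lemma ivp_lin c b x f b' x' f' : ivp b x f -> ivp b' x' f' ->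
  ivp (fun k => c *: b k + b' k) (c *: x + x') (c *: f + f').
Proof.
move=> [[Y hs] hf] [[Y' hs'] hf']; split.
  by exists (fun k => c *: Y k + Y' k); exact: (jet_lin hH M0 c hs hs').
have [_ e] := A0_lin P hH M0 c (jet_dom hH M0 hs) (jet_dom hH M0 hs').
by apply: (etrans e); rewrite hf hf'.
Qed.

Lemma ivp_unique b x x' f : ivp b x f -> ivp b x' f -> x = x'.
Proof.
move=> h h'; have [[Y hs] e] := ivp_lin (-1) h' h.
apply/eqP; rewrite -subr_eq0 -scaleN1r addrC; apply/eqP.
apply: (jet_eq0 hN hPN hH M0 hs); first by rewrite e scaleN1r addNr.
by move=> k _; rewrite scaleN1r addNr.
Qed.

Definition blocks (u : 'cV[R[i]]_(\sum_(k < N) d)) (k : nat) : 'cV[R[i]]_d :=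
  if insub k is Some i then submxcol u (i : 'I_N) else 0.

Lemma blocks_lin c u v k : blocks (c *: u + v) k = c *: blocks u k + blocks v k.
Proof.
rewrite /blocks; case: insubP => [i _ _|_]; last by rewrite scaler0 addr0.
by apply/matrixP => i' j; rewrite !mxE.
Qed.

Lemma blocks_eq0 u : (forall k, (k < N)%N -> blocks u k = 0) -> u = 0.
Proof.
move=> h; rewrite -[u]submxcolK -[RHS]mxcol0; apply/eq_mxcolP => k.
by have := h k (ltn_ord k); rewrite /blocks valK.
Qed.

(** Correct a solution x1 of A_0 x1 = f by a solution of the homogeneous equation.
    The latter depends linearly on its N d initial values u, and the boundary
    map L u = W (port variables) is injective by the dissipation inequality,
    hence onto. *)
Lemma A_surjective f : exists x, D x /\ A x = f.
Proof.
have /choice [h hh] : forall u, exists x, ivp (blocks u) x 0.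
  by move=> u; have [x [Y [hs e]]] := ivp_exists hN hPN hH M0 0 (blocks u); exists x; split=> //; exists Y.
have hlin c u v : h (c *: u + v) = c *: h u + h v.
  have := ivp_lin c (hh u) (hh v); rewrite scaler0 addr0.
  rewrite (_ : (fun k => _) = blocks (c *: u + v)); last first.
    by apply/funext => k; rewrite blocks_lin.
  exact: ivp_unique.
have hdom u : dom_A0 N H (h u) by have [[Y hs] _] := hh u; exact: (jet_dom hH M0 hs).
pose L u := W *m port_variables N P H (h u).
have Llin c u v : L (c *: u + v) = c *: L u + L v.
  rewrite /L hlin (port_lin P hH M0 c (hdom u) (hdom v)).
  by rewrite mulmxDr scalemxAr.
have Linj u : L u = 0 -> u = 0.
  move=> Lu; have [[Y hs] hA] := hh u; have Du : D (h u) by exact: conj (hdom u) Lu.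
  apply: blocks_eq0 => k kN; rewrite -(jet_trace0 hH M0 hs kN).
  by apply: boundary_eq0 => //; exact: ker_boundary.
have dims : (\sum_(k < N) d = N * d)%N by rewrite sum_nat_const card_ord.
have [x1 [Y1 [hs1 e1]]] := ivp_exists hN hPN hH M0 f (fun=> 0).
have hx1 := jet_dom hH M0 hs1.
have [u hu] := injective_linear_surjective dims Llin Linj (- (W *m port_variables N P H x1)).
have [hd hA] := A0_lin P hH M0 1 (hdom u) hx1; have [_ hAu] := hh u.
exists (1 *: h u + x1); split; last by rewrite hA hAu scaler0 add0r.
split; first exact: hd.
exact: (ker_compensate hu (port_lin P hH M0 1 (hdom u) hx1)).
Qed.

Lemma zero_traces_inverse : exists G : {linear X -> X},
  forall x f, ivp (fun=> 0) x f <-> x = G f.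
Proof.
pose D0 : set X := [set x | exists Y, jet x Y (fun=> 0)].
apply: (@linear_inverse _ _ D0 A).
- move=> c x y Dx Dy; have := ivp_lin c (conj Dx erefl) (conj Dy erefl).
  rewrite (_ : (fun k => _) = (fun=> 0)) //.
  by apply/funext => k; rewrite scaler0 addr0.
- by move=> x [Y hs] Ax; exact: (jet_eq0 hN hPN hH M0 hs Ax).
- by move=> f; have [x [Y [hs e]]] := ivp_exists hN hPN hH M0 f (fun=> 0); exists x; split=> //; exists Y.
Qed.

Section inverses.
Context (K G : {linear X -> X}).
Hypothesis KP : forall x y, (D x /\ A x = y) <-> x = K y.
Hypothesis GP : forall x f, ivp (fun=> 0) x f <-> x = G f.
Local Notation nrm := (form_norm r).

Lemma ivp_G f : ivp (fun=> 0) (G f) f. Proof. exact/GP. Qed.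

Lemma weighted_nrm a x : 0 <= a ->
  nrm x <= Num.sqrt (M / expR (- a)) * exp_norm a x /\ exp_norm a x <= Num.sqrt (1 / m) * nrm x.
Proof.
move=> a0; split; [exact: weight_norm_le hH (weight_exp d a0) (ltW M0)|].
exact: weight_norm_le (weight_exp d a0) hH ler01.
Qed.

(** In the norm with the weight exp(-a z), G has norm at most C3 / sqrt a, which is
    at most e for large a; the constant C only compares this norm with that of X. *)
Lemma G_quasinilpotent e : 0 < e ->
  exists C, forall n f, nrm (iter n G f) <= C * e ^+ n * nrm f.
Proof.
move=> e0; have [C3 [C4 [a0 [C30 _ a01 h]]]] := a_priori hN hPN hH M0.
pose a := a0 + (C3 / e) ^+ 2.
have aa : a0 <= a by rewrite lerDl sqr_ge0.
have ap : 0 < a by apply: lt_le_trans aa; apply: lt_le_trans a01.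
have sa : C3 / Num.sqrt a <= e.
  rewrite ler_pdivrMr ?sqrtr_gt0 // mulrC -ler_pdivrMr //.
  rewrite -[leLHS]ger0_norm ?divr_ge0 ?(ltW e0) // -sqrtr_sqr ler_wsqrtr //.
  by rewrite lerDr (le_trans ler01).
clearbody a.
have wG f : exp_norm a (G f) <= e * exp_norm a f.
  have [[Y hs] eA] := ivp_G f; have := h a _ _ _ aa hs.
  rewrite eA (_ : traces_norm N _ = 0); last first.
    by rewrite /traces_norm big1 ?sqrtr0 // => k _; exact: sqnorm0.
  rewrite mulr0 addr0 => h1; apply: (le_trans h1).
  by apply: ler_wpM2r sa; exact: sqrtr_ge0.
have wGn n f : exp_norm a (iter n G f) <= e ^+ n * exp_norm a f.
  elim: n => [|n IH]; first by rewrite mul1r.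
  by rewrite iterS (le_trans (wG _)) // exprS -mulrA ler_pM2l.
exists (Num.sqrt (M / expR (- a)) * Num.sqrt (1 / m)) => n f.
have [h1 _] := weighted_nrm (iter n G f) (ltW ap).
have [_ h2] := weighted_nrm f (ltW ap).
apply: (le_trans h1); rewrite -!mulrA ler_wpM2l ?sqrtr_ge0 // (le_trans (wGn n f)) //.
by rewrite mulrCA ler_wpM2l // exprn_ge0 // ltW.
Qed.

Lemma ivp_subG b x f : ivp b x f -> ivp b (x - G f) 0.
Proof.
move=> h; have := ivp_lin (-1) (ivp_G f) h.
have -> : -1 *: G f + x = x - G f by rewrite scaleN1r addrC.
have -> : -1 *: f + f = 0 by rewrite scaleN1r addNr.
rewrite (_ : (fun k => _) = b) //.
by apply/funext => k; rewrite scaler0 add0r.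
Qed.

Lemma ivp_bound : exists a C, [/\ 0 <= a, 0 <= C &
  forall b x, ivp b x 0 -> exp_norm a x <= C * traces_norm N b].
Proof.
have [C3 [C4 [a [C30 C40 a1 h]]]] := a_priori hN hPN hH M0.
have a0 : 0 <= a by apply: le_trans a1.
exists a, C4; split=> // b x [[Y hs] e]; apply: (le_trans (h a _ _ _ (lexx a) hs)).
by rewrite e /exp_norm (nrm0 (exp_weight_hilbert d a0)) mulr0 add0r.
Qed.

(** K f - G f solves the homogeneous equation with the initial values of K f. *)
Lemma K_sub_G_le : exists2 c, 0 <= c & forall f, nrm (K f - G f) <= c * boundary (K f).
Proof.
have [a [C [a0 C0 h]]] := ivp_bound.
exists (Num.sqrt (M / expR (- a)) * C); first by rewrite mulr_ge0 ?sqrtr_ge0.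
move=> f; have [[hd _] eK] := (KP (K f) f).2 erefl; have [Y [b hs]] := dom_jet hd.
have hb := h _ _ (ivp_subG (conj (ex_intro _ Y hs) eK)).
have [h2 _] := weighted_nrm (K f - G f) a0.
rewrite (boundary_jet hs); apply: (le_trans h2).
by rewrite -mulrA ler_wpM2l ?sqrtr_ge0.
Qed.

Lemma K_dissipative f : r (K f) f <= - kappa * boundary (K f) ^+ 2.
Proof.
have [hD eK] := (KP (K f) f).2 erefl.
by have := diss hD; rewrite eK (formC hr).
Qed.

Lemma K_bounded : exists c, forall f, nrm (K f) <= c * nrm f.
Proof.
have [c c0 hc] := K_sub_G_le; have [C hC] := G_quasinilpotent ltr01.
pose g := Num.max C 0; have g0 : 0 <= g by rewrite le_max lexx orbT.
have hg f : nrm (G f) <= g * nrm f.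
  apply: (le_trans (hC 1%N f)); rewrite expr1n mulr1 ler_wpM2r ?nrm_ge0 //.
  by rewrite le_max lexx.
exists (c * (1 + (c + g) / kappa) + g) => f.
apply: (boundary_bound kappa0 c0 g0 (nrm_ge0 _ f) (boundary_ge0 (K f))).
  rewrite -[K f in leLHS](subrK (G f)); apply: (le_trans (nrm_triangle hr _ _)).
  exact: lerD.
have := K_dissipative f; have := form_ge hr (K f) f; rewrite mulNr => h1 h2.
by have := le_trans h1 h2; rewrite lerN2.
Qed.

Lemma K_injective f : K f = 0 -> f = 0.
Proof.
move=> Kf; have [_ <-] := (KP (K f) f).2 erefl; rewrite Kf.
have [D0 A0'] := (KP (K 0) 0).2 erefl; rewrite linear0 in A0'.
exact: A0'.
Qed.

Lemma stable_generation : exists T, [/\ C0_semigroup nrm T, contractive nrm T,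
  generates nrm D A T & asymptotically_stable nrm T].
Proof.
have [c Kc] := K_bounded; have [c2 c20 KG] := K_sub_G_le.
have Kdiss f : r (K f) f <= 0.
  apply: (le_trans (K_dissipative f)).
  by rewrite mulNr oppr_le0 mulr_ge0 ?sqr_ge0 // ltW.
exists (semigroup r K); split.
- exact: (T_C0 hr Kc Kdiss K_injective).
- by move=> t x t0; have [_] := T_contraction hr Kc Kdiss K_injective t0; apply.
- exact: (T_generates hr Kc Kdiss K_injective KP).
- exact: (semigroup_stable hr Kc K_injective kappa0 (fun f => boundary_ge0 (K f))
    K_dissipative (raddfB G) KG G_quasinilpotent).
Qed.
End inverses.

Lemma exists_stable_semigroup : exists T, [/\ C0_semigroup (form_norm r) T,
  contractive (form_norm r) T, generates (form_norm r) D A T &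
  asymptotically_stable (form_norm r) T].
Proof.
have [K KP] := linear_inverse D_lin A_injective A_surjective.
by have [G GP] := zero_traces_inverse; exact: stable_generation KP GP.
Qed.
End boundary_damped_operator.

Theorem proposition2p11 (R : realType) (N d : nat)
  (hN : (1 <= N)%N) (hd : (1 <= d)%N)
  (P : nat -> 'M[R[i]]_d)
  (hP : forall k, (1 <= k <= N)%N -> (P k) ^t* = (-1) ^+ k.-1 *: P k)
  (hPN : P N \in unitmx)
  (H : R -> 'M[R[i]]_d)
  (hHmeas : entrywise (measurable_fun (unit_itv R)) H)
  (m0 M0 : R) (hm0 : 0 < m0) (hmM : m0 <= M0)
  (hH : ae01 (fun z => (H z) ^t* = H z /\
     forall xi : 'cV[R[i]]_d,
       m0%:C * (sqnorm xi)%:C <= (xi ^t* *m H z *m xi) 0 0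
                              <= M0%:C * (sqnorm xi)%:C))
  (W : 'M[R[i]]_(N * d, \sum_(k < N) d + \sum_(k < N) d))
  (hW : \rank W = (N * d)%N)
  (kappa : R) (hkappa : 0 < kappa)
  (hdiss : forall x, dom_A P H W x ->
     complex.Re (inner_H H (A0 N P H x) x)
       <= - kappa * \sum_(k < N) sqnorm (trace k (Hmul H x) 0)) :
  exists T : R -> L2space R d -> L2space R d,
    [/\ C0_semigroup (norm_H H) T,
        contractive (norm_H H) T,
        generates (norm_H H) (dom_A P H W) (A0 N P H) T &
        asymptotically_stable (norm_H H) T].
Proof.
have hw : weight m0 M0 H.
  split=> //; apply: (ae01S _ hH) => z _ [h1 h2]; exact: herm_boundsP.
have nE : norm_H H = form_norm (rform H).
  by apply/funext => x; rewrite /norm_H /form_norm rform_inner.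
rewrite nE; apply: (exists_stable_semigroup hN hPN hw (lt_le_trans hm0 hmM) hkappa) => x Dx.
rewrite rform_inner sqr_sqrtr; first exact: hdiss.
by apply: sumr_ge0 => k _; exact: sqnorm_ge0.
Qed.
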